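(* Let $\Omega\subset\mathbb R^n$ be open and let $u\in C^{1,1}_{\rm loc}(\Omega)$ satisfy $u\ge0$ in $\Omega$ and $\Delta u=\chi_{\{u>0\}}$ a.e. in $\Omega$. For each $m\in\{0,\dots,n-1\}$, the set $\Sigma_m$ is locally contained in an $m$-dimensional manifold of class $C^1$.
   Context: Let $\mathcal P$ be the set of polynomials $p(x)=\frac12\langle Ax,x\rangle$ with $A\in\mathbb R^{n\times n}$ symmetric, nonnegative definite, $\mathrm{tr}(A)=1$. A point $x_0\in\partial\{u>0\}$ is a singular point if there exist $r_k\to0^+$ and $p\in\mathcal P$ such that $u(x_0+r_kx)/r_k^2\to p(x)$ in $C^1_{\rm loc}(\mathbb R^n)$; $\Sigma$ denotes the set of singular points. At each $x_0\in\Sigma$ the full limit $p_{*,x_0}(x):=\lim_{r\to0^+}u(x_0+rx)/r^2$ exists and belongs to $\mathcal P$. For $m\in\{0,\dots,n-1\}$, $\Sigma_m:=\{x_0\in\Sigma:\ \dim\ker D^2p_{*,x_0}=m\}$. *)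

(* Defs.v *)
From HB Require Import structures.
From mathcomp Require Import all_boot all_order all_algebra.
From mathcomp Require Import all_classical all_reals all_analysis.
Set Implicit Arguments. Unset Strict Implicit. Unset Printing Implicit Defensive.
Import Order.TTheory GRing.Theory Num.Theory.
Import numFieldNormedType.Exports.
Local Open Scope classical_set_scope.
Local Open Scope ring_scope.

Section Defs.
Variable R : realType.

Definition evec (n : nat) (i : 'I_n) : 'rV[R]_n := delta_mx 0 i.

Definition partial (n : nat) (i : 'I_n) (f : 'rV[R]_n -> R) (x : 'rV[R]_n) : R :=
  'D_(evec i) f x.

Definition box (n : nat) (a b : 'rV[R]_n) : set 'rV[R]_n :=
  [set x | forall i, a 0 i <= x 0 i <= b 0 i].
Definition box_vol (n : nat) (a b : 'rV[R]_n) : R := \prod_(i < n) (b 0 i - a 0 i).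
Definition lebesgue_null (n : nat) (N : set 'rV[R]_n) : Prop :=
  forall eps : R, 0 < eps ->
  exists a b : nat -> 'rV[R]_n,
    (forall k i, a k 0 i <= b k 0 i) /\
    N `<=` \bigcup_k box (a k) (b k) /\
    (forall K : nat, \sum_(k < K) box_vol (a k) (b k) <= eps).

Definition C11_loc (n : nat) (Omega : set 'rV[R]_n) (u : 'rV[R]_n -> R) : Prop :=
  (forall x, Omega x -> differentiable u x) /\
  (forall x, Omega x -> exists r : R, exists L : R, 0 < r /\
     ball x r `<=` Omega /\
     forall y z i, ball x r y -> ball x r z ->
       `|partial i u y - partial i u z| <= L * `|y - z|).

(* Delta u = chi_{u>0} a.e. in Omega (pointwise second derivatives, which
   exist a.e. for C^{1,1} functions) *)
Definition obstacle_eq_ae (n : nat) (Omega : set 'rV[R]_n) (u : 'rV[R]_n -> R) : Prop :=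
  exists N : set 'rV[R]_n, lebesgue_null N /\
  forall x, Omega x -> ~ N x ->
    (forall i : 'I_n, derivable (partial i u) x (evec i)) /\
    \sum_(i < n) partial i (partial i u) x = (if 0 < u x then 1 else 0).

Definition Pmat (n : nat) (A : 'M[R]_n) : Prop :=
  A^T = A /\ (forall v : 'rV[R]_n, 0 <= (v *m A *m v^T) 0 0) /\ \tr A = 1.
Definition pA (n : nat) (A : 'M[R]_n) (x : 'rV[R]_n) : R :=
  2^-1 * (x *m A *m x^T) 0 0.

Definition resc (n : nat) (u : 'rV[R]_n -> R) (x0 : 'rV[R]_n) (r : R)
  (x : 'rV[R]_n) : R := u (x0 + r *: x) / r ^+ 2.

Definition C1_close (n : nat) (f g : 'rV[R]_n -> R) (Rad eps : R) : Prop :=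
  forall x : 'rV[R]_n, `|x| <= Rad ->
    `|f x - g x| <= eps /\ forall i, `|partial i f x - partial i g x| <= eps.

Definition pos_set (n : nat) (Omega : set 'rV[R]_n) (u : 'rV[R]_n -> R) :=
  [set x | Omega x /\ 0 < u x].
Definition free_boundary (n : nat) (Omega : set 'rV[R]_n) (u : 'rV[R]_n -> R) :=
  closure (pos_set Omega u) `\` interior (pos_set Omega u).

Definition singular_set (n : nat) (Omega : set 'rV[R]_n) (u : 'rV[R]_n -> R) :=
  [set x0 | Omega x0 /\ free_boundary Omega u x0 /\
    exists (rk : nat -> R) (A : 'M[R]_n),
      (forall k, 0 < rk k) /\ rk @ \oo --> (0 : R) /\ Pmat A /\
      forall Rad eps : R, 0 < eps ->
        \forall k \near \oo, C1_close (resc u x0 (rk k)) (pA A) Rad eps].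

Definition full_blowup (n : nat) (u : 'rV[R]_n -> R) (x0 : 'rV[R]_n) (A : 'M[R]_n) :=
  Pmat A /\ forall Rad eps : R, 0 < eps ->
    exists delta : R, 0 < delta /\
      forall r : R, 0 < r -> r < delta -> C1_close (resc u x0 r) (pA A) Rad eps.

Definition singular_stratum (n : nat) (Omega : set 'rV[R]_n) (u : 'rV[R]_n -> R)
  (m : nat) :=
  [set x0 | singular_set Omega u x0 /\
    exists A : 'M[R]_n, full_blowup u x0 A /\ \rank (kermx A) = m].

Definition C1_on (n k : nat) (V : set 'rV[R]_n) (F : 'rV[R]_n -> 'rV[R]_k) : Prop :=
  (forall x, V x -> differentiable F x) /\
  (forall (i : 'I_n) (j : 'I_k) x, V x ->
     {for x, continuous (fun y => jacobian F y i j)}).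

Definition C1_submanifold (n m : nat) (M : set 'rV[R]_n) : Prop :=
  (m <= n)%N /\
  forall y, M y -> exists (V : set 'rV[R]_n) (F : 'rV[R]_n -> 'rV[R]_(n - m)),
    open V /\ V y /\ C1_on V F /\
    (forall x, V x -> \rank (jacobian F x) = (n - m)%N) /\
    M `&` V = [set x | V x /\ F x = 0].

End Defs.

(* Main.v *)
Require Import Defs.
From HB Require Import structures.
From mathcomp Require Import all_boot all_order all_algebra.
From mathcomp Require Import all_classical all_reals all_analysis.
From mathcomp Require Import ring lra zify.
Set Implicit Arguments. Unset Strict Implicit. Unset Printing Implicit Defensive.
Import Order.TTheory GRing.Theory Num.Theory.
Import numFieldNormedType.Exports.
Local Open Scope classical_set_scope.
Local Open Scope ring_scope.

(** The rescalings u(y + r x) / r^2 at a contact point y have a Weiss energy that is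
    monotone in r; at singular points its limit is the common energy of all p in P, and
    this lower bound passes to limits y0 of singular points. Hence a blow-up U at y0 is
    2-homogeneous, and Monneau's functional, the weighted L^2 distance of the rescalings to
    U, is monotone at every singular point y. It is small at one fixed scale for all y near
    y0, hence at all smaller scales. Evaluating there at a second singular point z gives
    |D^2 p_y - D^2 p_z| = o(1) and |D^2 p_y (z - y)| = o(|z - y|) as y, z -> y0. These are
    the compatibility conditions of Whitney's C^1 extension theorem on the closure of the
    stratum, for the value 0 and the gradients D^2 p_y P, where P has n - m columns and
    D^2 p_x0 P has rank n - m. The zero set of the resulting C^1 map is the manifold.

    Integrals are ultralimits of Riemann sums over a cube. The almost everywhere equation
    is turned into its weak form by bounded convergence of difference quotients, and the
    Whitney extension is a quotient of two such integrals. *)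


(** * Ultralimits and the integral over a cube *)

(** Two choices keep the argument elementary. Integrals over balls and spheres give way to the
    radial weight [phi], equal to the square of the positive part of 1 - |x|^2 with the Euclidean
    |x|: its gradient is a multiple of x, so integration by parts yields radial derivatives, which
    Euler's identity evaluates for 2-homogeneous functions. And the scale r is changed to r (1 + t)
    with an error of order t^2, so that no energy has to be differentiated in r. The delicate point
    is that Whitney's theorem asks for a closed set, while a limit y0 of points of the stratum may
    lie outside it. The blow-up U at y0 is taken along a subsequence and is never identified as a
    polynomial: Monneau's monotonicity uses only that U is homogeneous and solves Laplacian U = 1
    weakly. That equation comes from the energy: Laplacian U <= 1 tested with |x|^2 / (2 n) bounds
    the energy of U by that of P, so the opposite bound forces equality for this test function,
    hence for all those dominated by |x|^2. *)

Lemma free_ultrafilter_exists :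
  exists U : set_system nat, UltraFilter U /\ eventually `<=` U.
Proof. exact: ultraFilterLemma. Qed.

Definition free_ultrafilter : set_system nat := projT1 (cid free_ultrafilter_exists).

#[global] Instance free_ultrafilter_ultra : UltraFilter free_ultrafilter.
Proof. exact: (projT2 (cid free_ultrafilter_exists)).1. Qed.

#[global] Instance free_ultrafilter_proper : ProperFilter free_ultrafilter.
Proof. exact: ultra_proper. Qed.

Lemma free_ultrafilter_sub : eventually `<=` free_ultrafilter.
Proof. exact: (projT2 (cid free_ultrafilter_exists)).2. Qed.

Section Ultralimit.
Variable R : realType.
Implicit Types a b : nat -> R.

Definition bounded_seq a := exists C : R, forall k, `|a k| <= C.

(** Along an ultrafilter every bounded sequence converges, so this is a positive linear functional
    on bounded sequences that extends the ordinary limit. *)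
Definition ulim a : R := lim (a @ free_ultrafilter).

Lemma ulim_cvg a : bounded_seq a -> a @ free_ultrafilter --> ulim a.
Proof.
move=> [C aC]; have := @segment_compact R (- C) C.
move=> /(_ (a @ free_ultrafilter) _)[|l [_ al]].
  apply: (@filterE _ free_ultrafilter) => k; rewrite /= in_itv /= -ler_norml; exact: aC.
rewrite /ulim; apply/cvg_ex; exists l => V Vl.
(* For an ultrafilter a cluster point is a limit: otherwise the preimage of the complement of V
   would belong to the filter, and V would have to meet its own complement. *)
have [//|UV] := @in_ultra_setVsetC _ free_ultrafilter (a @^-1` V) _.
by have [x []] := al (~` V) V UV Vl.
Qed.

Lemma ulim_eq a l : a @ free_ultrafilter --> l -> ulim a = l.
Proof. by move=> al; apply: cvg_lim al. Qed.

Lemma ulim_lim a l : a @ \oo --> l -> ulim a = l.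
Proof. by move=> al; apply: ulim_eq => A /al; apply: free_ultrafilter_sub. Qed.

Lemma ulimD a b : bounded_seq a -> bounded_seq b ->
  ulim (fun k => a k + b k) = ulim a + ulim b.
Proof. by move=> /ulim_cvg aa /ulim_cvg bb; apply: ulim_eq; apply: cvgD. Qed.

Lemma ulimZ c a : bounded_seq a -> ulim (fun k => c * a k) = c * ulim a.
Proof. by move=> /ulim_cvg aa; apply: ulim_eq; apply: cvgMr. Qed.

Lemma ulim_ge0 a : bounded_seq a -> (forall k, 0 <= a k) -> 0 <= ulim a.
Proof.
move=> /ulim_cvg aa a0.
apply: (@closed_cvg _ _ _ free_ultrafilter_proper a (fun x => 0 <= x)) aa => //.
exact: filterE.
Qed.

Lemma ulim_le a b : bounded_seq a -> bounded_seq b ->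
  (forall k, a k <= b k) -> ulim a <= ulim b.
Proof.
move=> ba bb ab; rewrite -subr_ge0 -mulN1r -ulimZ // -ulimD //; last first.
  by case: ba => C aC; exists C => k; rewrite mulN1r normrN.
apply: ulim_ge0 => [|k]; last by rewrite mulN1r subr_ge0.
case: ba bb => C aC [D bD]; exists (D + C) => k.
by rewrite mulN1r (le_trans (ler_normB _ _))// lerD.
Qed.

Lemma ulim_cst c : ulim (fun _ => c) = c.
Proof. by apply: ulim_eq; apply: cvg_cst. Qed.

End Ultralimit.

Lemma ulim_eventually (R : realType) (a b : nat -> R) N0 : bounded_seq a ->
  (forall k, (N0 <= k)%N -> a k = b k) -> ulim a = ulim b.
Proof.
move=> /ulim_cvg aa ab; apply/esym/ulim_eq; apply: cvg_trans aa.
apply: near_eq_cvg; apply: free_ultrafilter_sub.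
by exists N0 => // k /= /ab.
Qed.

Section CubeNorm.
Variables (R : realType) (n : nat).
Implicit Types x y : 'rV[R]_n.

Lemma coord_le_norm x i : `|x 0 i| <= `|x|.
Proof.
rewrite [leRHS]/Num.norm /= mx_normrE.
by rewrite (@le_bigmax _ _ _ _ (fun ij : 'I_1 * 'I_n => `|x ij.1 ij.2|) (0, i)).
Qed.

Lemma norm_le_coord x (C : R) : 0 <= C -> (forall i, `|x 0 i| <= C) -> `|x| <= C.
Proof.
move=> C0 xC; rewrite [leLHS]/Num.norm /= mx_normrE; apply/bigmax_leP; split => //.
by move=> [i j] _ /=; rewrite (ord1 i).
Qed.

Lemma norm_evec (i : 'I_n) : `|evec R i| <= 1.
Proof.
apply: norm_le_coord => // j; rewrite /evec mxE eqxx /=.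
by case: (_ == _); rewrite ?normr1 ?normr0.
Qed.

End CubeNorm.

Section GridIntegral.
Variables (R : realType) (n : nat).
Local Notation T := 'rV[R]_n.
Implicit Types (f g : T -> R).

(** The nodes fill the half-open cube [-2, 2)^n with spacing 2^-N. The predecessor gives the index
    type the form ['I_p.+1], which carries addition modulo p + 1; [intQ_shift] translates nodes by
    means of it. *)
Definition grid_size N := (4 * 2 ^ N).-1.

Lemma grid_sizeS N : (grid_size N).+1 = (4 * 2 ^ N)%N.
Proof. by rewrite /grid_size prednK // muln_gt0 expn_gt0. Qed.

Definition mesh N : R := ((2 ^ N)%N%:R)^-1.

Lemma mesh_gt0 N : 0 < mesh N.
Proof. by rewrite invr_gt0 ltr0n expn_gt0. Qed.

Lemma mesh_ge0 N : 0 <= mesh N.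
Proof. exact/ltW/mesh_gt0. Qed.

Lemma mesh_size N : mesh N * (grid_size N).+1%:R = 4.
Proof.
by rewrite grid_sizeS natrM mulrCA mulVf ?mulr1 // pnatr_eq0 -lt0n expn_gt0.
Qed.

Lemma mesh_small (e : R) : 0 < e -> exists N0, forall N, (N0 <= N)%N -> mesh N < e.
Proof.
move=> e0; have [N0 hN] : exists N0 : nat, e^-1 < N0%:R.
  exists (Num.bound e^-1).
  by apply: archi_boundP; rewrite invr_ge0 ltW.
exists N0 => N NN; rewrite -[e]invrK ltf_pV2 ?posrE ?invr_gt0 ?ltr0n ?expn_gt0 //.
apply: lt_le_trans hN _; rewrite ler_nat (leq_trans NN) //.
exact/ltnW/ltn_expl.
Qed.

Definition node N (k : {ffun 'I_n -> 'I_(grid_size N).+1}) : T :=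
  \row_i (-2 + (k i)%:R * mesh N).

Lemma node_bounds N (k : {ffun 'I_n -> 'I_(grid_size N).+1}) i :
  -2 <= node k 0 i < 2.
Proof.
rewrite mxE; have := ltn_ord (k i); rewrite -(ltr_nat R) => kM.
have := mesh_gt0 N; have := mesh_size N; set h := mesh N => hs h0.
have : (k i)%:R * h < 4 by rewrite -hs mulrC ltr_pM2l.
have : 0 <= (k i)%:R * h by rewrite mulr_ge0 // ltW.
lra.
Qed.

Lemma node_norm N (k : {ffun 'I_n -> 'I_(grid_size N).+1}) : `|node k| <= 2.
Proof.
by apply: norm_le_coord => // i; rewrite ler_norml; have := node_bounds k i; lra.
Qed.

Definition gsum N f : R := mesh N ^+ n * \sum_k f (@node N k).

(* Every bounded function is integrable in this sense. The functional is positive and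
   linear, and exactly invariant under dyadic translations of functions supported in
   the unit cube, because these map nodes of fine grids to nodes. *)
Definition intQ f : R := ulim (fun N => gsum N f).

Definition bnd f := exists C : R, forall x, `|x| <= 2 -> `|f x| <= C.

Lemma gsum_abs N f (C : R) : (forall x, `|x| <= 2 -> `|f x| <= C) ->
  `|gsum N f| <= 4 ^+ n * C.
Proof.
move=> fC; rewrite /gsum normrM ger0_norm ?exprn_ge0 ?mesh_ge0 //.
apply: (@le_trans _ _ (mesh N ^+ n * \sum_(k : {ffun 'I_n -> 'I_(grid_size N).+1}) C)).
  rewrite ler_wpM2l ?exprn_ge0 ?mesh_ge0 //.
  apply: le_trans (ler_norm_sum _ _ _) _; apply: ler_sum => k _.
  by apply: fC; apply: node_norm.
rewrite sumr_const card_ffun !card_ord -(mulr_natl C) mulrA natrX -exprMn mesh_size //.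
Qed.

Lemma gsum_bounded f : bnd f -> bounded_seq (fun N => gsum N f).
Proof. by case=> C fC; exists (4 ^+ n * C) => N; apply: gsum_abs. Qed.

Lemma intQ_ext f g : (forall x, `|x| <= 2 -> f x = g x) -> intQ f = intQ g.
Proof.
move=> fg; rewrite /intQ; congr ulim; apply/funext => N; rewrite /gsum.
by congr (_ * _); apply: eq_bigr => k _; apply: fg; apply: node_norm.
Qed.

Lemma gsumD N f g : gsum N (fun x => f x + g x) = gsum N f + gsum N g.
Proof. by rewrite /gsum big_split mulrDr. Qed.

Lemma gsumZ N (c : R) f : gsum N (fun x => c * f x) = c * gsum N f.
Proof. by rewrite /gsum -mulr_sumr mulrCA. Qed.

Lemma bndD f g : bnd f -> bnd g -> bnd (fun x => f x + g x).
Proof.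
move=> [C fC] [D gD]; exists (C + D) => x xQ.
by rewrite (le_trans (ler_normD _ _)) // lerD ?fC ?gD.
Qed.

Lemma bndM f g : bnd f -> bnd g -> bnd (fun x => f x * g x).
Proof.
move=> [C fC] [D gD]; exists (C * D) => x xQ.
by rewrite normrM ler_pM ?fC ?gD.
Qed.

Lemma bndC (c : R) : bnd (fun _ => c).
Proof. by exists `|c|. Qed.

Lemma bndN f : bnd f -> bnd (fun x => - f x).
Proof. by case=> C fC; exists C => x /fC; rewrite normrN. Qed.

Lemma bndB f g : bnd f -> bnd g -> bnd (fun x => f x - g x).
Proof. by move=> ? ?; apply: bndD => //; apply: bndN. Qed.

Lemma bndX f k : bnd f -> bnd (fun x => f x ^+ k).
Proof.
move=> bf; elim: k => [|k IH]; first by under eq_fun do rewrite expr0; exact: bndC.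
by under eq_fun do rewrite exprS; apply: bndM.
Qed.

Lemma bnd_sum (J : Type) (s : seq J) (F : J -> T -> R) : (forall j, bnd (F j)) ->
  bnd (fun x => \sum_(j <- s) F j x).
Proof.
move=> bF; elim: s => [|j s IH].
  by under eq_fun do rewrite big_nil; exact: bndC.
by under eq_fun do rewrite big_cons; apply: bndD.
Qed.

Lemma intQD f g : bnd f -> bnd g -> intQ (fun x => f x + g x) = intQ f + intQ g.
Proof.
move=> bf bg; rewrite /intQ; under [X in ulim X]funext do rewrite gsumD.
by rewrite ulimD //; apply: gsum_bounded.
Qed.

Lemma intQZ (c : R) f : bnd f -> intQ (fun x => c * f x) = c * intQ f.
Proof.
move=> bf; rewrite /intQ; under [X in ulim X]funext do rewrite gsumZ.
by rewrite ulimZ //; apply: gsum_bounded.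
Qed.

Lemma intQN f : bnd f -> intQ (fun x => - f x) = - intQ f.
Proof.
by move=> bf; rewrite -mulN1r -intQZ //; apply: intQ_ext => x _; rewrite mulN1r.
Qed.

Lemma intQB f g : bnd f -> bnd g -> intQ (fun x => f x - g x) = intQ f - intQ g.
Proof. by move=> bf bg; rewrite intQD ?intQN //; apply: bndN. Qed.

Lemma intQ0 : intQ (fun _ => 0) = 0.
Proof.
rewrite -[RHS](mul0r (intQ (fun _ => 0))) -intQZ; last exact: bndC.
by apply: intQ_ext => x _; rewrite mul0r.
Qed.

Lemma intQ_sum (J : Type) (s : seq J) (F : J -> T -> R) : (forall j, bnd (F j)) ->
  intQ (fun x => \sum_(j <- s) F j x) = \sum_(j <- s) intQ (F j).
Proof.
move=> bF; elim: s => [|j s IH].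
  by rewrite big_nil -[RHS]intQ0; apply: intQ_ext => x _; rewrite big_nil.
rewrite big_cons -IH -intQD //; last exact: bnd_sum.
by apply: intQ_ext => x _; rewrite big_cons.
Qed.

Lemma intQ_le f g : bnd f -> bnd g -> (forall x, `|x| <= 2 -> f x <= g x) ->
  intQ f <= intQ g.
Proof.
move=> bf bg fg; apply: ulim_le; try exact: gsum_bounded.
move=> N; rewrite ler_wpM2l ?exprn_ge0 ?mesh_ge0 //.
by apply: ler_sum => k _; apply: fg; apply: node_norm.
Qed.

Lemma intQ_ge0 f : bnd f -> (forall x, `|x| <= 2 -> 0 <= f x) -> 0 <= intQ f.
Proof. by move=> bf f0; rewrite -intQ0; apply: intQ_le => //; apply: bndC. Qed.

Lemma intQ_abs f (C : R) : (forall x, `|x| <= 2 -> `|f x| <= C) -> `|intQ f| <= 4 ^+ n * C.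
Proof.
move=> fC; have bf : bnd f by exists C.
rewrite ler_norml; apply/andP; split.
  rewrite -[leLHS](@ulim_cst R); apply: ulim_le; [|exact: gsum_bounded|].
    by exists `|- (4 ^+ n * C)|.
  by move=> N; have := gsum_abs N fC; rewrite ler_norml => /andP[].
rewrite -[leRHS](@ulim_cst R); apply: ulim_le; [exact: gsum_bounded| |].
  by exists `|4 ^+ n * C|.
by move=> N; have := gsum_abs N fC; rewrite ler_norml => /andP[].
Qed.

(** For N >= j the step 2^-j is a whole number [s] of grid steps, so the translation is the cyclic
    permutation adding [s] to the index [i0]. Where the index wraps around, the translated point and
    the node that replaces it both lie outside the unit cube, and [F] vanishes at both. *)
Lemma intQ_shift F j i0 : bnd F -> (forall x, 1 < `|x| -> F x = 0) ->
  intQ (fun x => F (x + mesh j *: evec R i0)) = intQ F.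
Proof.
move=> [C FC] F0.
have C0 : 0 <= C by apply: le_trans (FC 0 _); rewrite ?normr_ge0 ?normr0.
have bF' : bnd (fun x => F (x + mesh j *: evec R i0)).
  exists C => x _; have [h|/F0->] := leP `|x + mesh j *: evec R i0| 1.
    by apply: FC; apply: le_trans h _; rewrite ler1n.
  by rewrite normr0.
apply: (@ulim_eventually _ _ _ j); first exact: gsum_bounded.
move=> N jN; congr (_ * _).
pose s : 'I_(grid_size N).+1 := inord (2 ^ (N - j)).
have sv : (s : nat) = (2 ^ (N - j))%N.
  rewrite inordK // grid_sizeS; apply: (@leq_ltn_trans (2 ^ N)%N).
    by rewrite leq_exp2l // leq_subr.
  by rewrite ltn_Pmull // expn_gt0.
have mj : s%:R * mesh N = mesh j.
  have E : (2 ^ N)%N%:R = (2 ^ (N - j))%N%:R * (2 ^ j)%N%:R :> R.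
    by rewrite -natrM -expnD subnK.
  by rewrite sv /mesh E invfM mulrA mulfV ?mul1r // pnatr_eq0 -lt0n expn_gt0.
pose h (k : {ffun 'I_n -> 'I_(grid_size N).+1}) : {ffun 'I_n -> 'I_(grid_size N).+1} :=
  [ffun i => if i == i0 then k i + s else k i].
have hi : injective h.
  move=> k1 k2 /ffunP hk; apply/ffunP => i; have := hk i; rewrite !ffunE.
  by case: ifP => _ // /addIr.
rewrite [RHS](reindex_inj hi); apply: eq_bigr => k _.
have [lt|ge] := ltnP (k i0 + s) (grid_size N).+1.
  congr F; apply/rowP => i; rewrite !mxE ffunE.
  have [->|ne] := eqVneq i i0; last by rewrite andbF mulr0 addr0.
  by rewrite eqxx mulr1 /= modn_small // natrD mulrDl mj addrA.
have sM : (s <= 2 ^ N)%N by rewrite sv leq_exp2l // leq_subr.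
have msz := mesh_size N; have m0 := mesh_gt0 N.
have mj1 : mesh j <= 1.
  by rewrite /mesh invf_le1 ?ler1n ?ltr0n ?expn_gt0.
rewrite !F0 //.
- apply: lt_le_trans (coord_le_norm _ i0); rewrite mxE ffunE eqxx /=.
  have -> : ((k i0 + s) %% (grid_size N).+1 = k i0 + s - (grid_size N).+1)%N.
    rewrite -[in LHS](subnK ge) modnDr modn_small //.
    have := ltn_ord (k i0); have := ltn_ord s; lia.
  rewrite natrB // natrD mulrBl mulrDl mj [_ * mesh N in X in _ - X]mulrC msz.
  have : (k i0)%:R * mesh N < 4 by rewrite -msz mulrC ltr_pM2l // ltr_nat.
  move=> ?; rewrite ltr0_norm; lra.
- apply: lt_le_trans (coord_le_norm _ i0); rewrite !mxE !eqxx mulr1 -mj -addrA -mulrDl -natrD.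
  have : 4 <= (k i0 + s)%:R * mesh N by rewrite -msz mulrC ler_pM2r // ler_nat.
  move=> ?; rewrite gtr0_norm; lra.
Qed.

End GridIntegral.

Ltac bnd_tac := repeat first
  [ assumption | apply: bndC | apply: bndB | apply: bndN | apply: bndD
  | apply: bndM | apply: bndX | (apply: bnd_sum => ?) ].

(** * Boxes *)

Lemma ulim_ge_eventually (R : realType) (a : nat -> R) (c : R) N0 : bounded_seq a ->
  (forall k, (N0 <= k)%N -> c <= a k) -> c <= ulim a.
Proof.
move=> [C aC] ca; rewrite (@ulim_eventually _ a (fun k => if (N0 <= k)%N then a k else c) N0).
- rewrite -[leLHS]ulim_cst; apply: ulim_le.
  + by exists `|c|.
  + exists (C + `|c|) => k; have C0 := le_trans (normr_ge0 _) (aC k).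
    by case: ifP => _; [have := normr_ge0 c | ]; have := aC k; lra.
  + by move=> k; case: ifP => // /ca.
- by exists C.
- by move=> k ->.
Qed.

Section Counting.
Variable R : realType.

Lemma count_le (M : nat) (al be : R) : al <= be + 1 ->
  \sum_(k < M) (if al <= k%:R <= be then 1 else 0) <= be - al + 1.
Proof.
(* The induction on [M] needs a bound in which the interval is cut off at [M]. *)
move=> ab; suff : \sum_(k < M) (if al <= k%:R <= be then 1 else 0)
    <= Num.max 0 (Num.min (be + 1) M%:R - al) :> R.
  move/le_trans; apply; rewrite ge_max; apply/andP; split; first by lra.
  by rewrite -addrA [- al + 1]addrC addrA lerD2r ge_min lexx.
elim: M => [|M IH]; first by rewrite big_ord0 le_max lexx.
rewrite big_ord_recr /= -natr1; case: ifP => [/andP[aM Mb]|_].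
  have -> : Num.min (be + 1) (M%:R + 1) = M%:R + 1 by apply/min_idPr; lra.
  rewrite le_max; apply/orP; right.
  suff : Num.max 0 (Num.min (be + 1) M%:R - al) <= M%:R - al by lra.
  rewrite ge_max subr_ge0 aM /= lerD2r ge_min lexx orbT //.
rewrite addr0; apply: le_trans IH _; rewrite ge_max !le_max lexx /=.
apply/orP; right; rewrite lerD2r le_min !ge_min lexx /=.
by apply/orP; right; lra.
Qed.

Lemma count_ge (M : nat) (al be : R) : 0 <= al -> be <= M%:R ->
  be - al - 1 <= \sum_(k < M) (if al <= k%:R <= be then 1 else 0).
Proof.
move=> a0 bM; suff : Num.min be M%:R - al - 1
    <= \sum_(k < M) (if al <= k%:R <= be then 1 else 0) :> R.
  by rewrite (_ : Num.min be M%:R = be) //; apply/min_idPl.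
elim: M {bM} => [|M IH].
  rewrite big_ord0; have : Num.min be 0 <= 0 by rewrite ge_min lexx orbT.
  by lra.
rewrite big_ord_recr /= -natr1; case: ifP => [/andP[aM Mb]|/negbT].
  have : Num.min be (M%:R + 1) <= M%:R + 1 by rewrite ge_min lexx orbT.
  move: IH; rewrite (_ : Num.min be M%:R = M%:R); last by apply/min_idPr.
  by lra.
rewrite negb_and -!ltNge addr0 => /orP[Ma|bM].
  have : Num.min be (M%:R + 1) <= M%:R + 1 by rewrite ge_min lexx orbT.
  have : 0 <= \sum_(k < M) (if al <= k%:R <= be then 1 else 0 : R).
    by apply: sumr_ge0 => k _; case: ifP.
  by lra.
move: IH; rewrite (_ : Num.min be M%:R = be); last by apply/min_idPl; lra.
have -> : Num.min be (M%:R + 1) = be by apply/min_idPl; lra.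
by [].
Qed.

End Counting.

Section Boxes.
Variables (R : realType) (n : nat).
Local Notation T := 'rV[R]_n.
Implicit Types (a b c x : T).

(** The product form of the indicator of [box a b] lets grid sums factor over the coordinates by
    distributivity. *)
Definition box_ind a b x : R :=
  \prod_(i < n) (if a 0 i <= x 0 i <= b 0 i then 1 else 0).

Lemma box_ind_ge0 a b x : 0 <= box_ind a b x.
Proof. by apply: prodr_ge0 => i _; case: ifP. Qed.

Lemma box_ind_le1 a b x : box_ind a b x <= 1.
Proof.
have : box_ind a b x <= \prod_(i < n) 1.
  by apply: ler_prod => i _; case: ifP => _; rewrite ?lexx ?ler01.
by rewrite big1_eq.
Qed.

Lemma box_ind_in a b x : box a b x -> box_ind a b x = 1.
Proof. by move=> xb; rewrite /box_ind big1 // => i _; rewrite xb. Qed.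

Lemma box_ind_out a b x : ~ box a b x -> box_ind a b x = 0.
Proof.
move=> xb; have [i hi] : exists i, ~~ (a 0 i <= x 0 i <= b 0 i).
  apply/existsP; rewrite -negb_forall; apply/negP => /forallP h; exact: xb.
by rewrite /box_ind (bigD1 i) //= (negPf hi) mul0r.
Qed.

Lemma bnd_box_ind a b : bnd (box_ind a b).
Proof.
by exists 1 => x _; rewrite ger0_norm ?box_ind_ge0 // box_ind_le1.
Qed.

Lemma gsum_box N a b : gsum N (box_ind a b) =
  \prod_(i < n) (mesh R N * \sum_(k < (grid_size N).+1)
    (if (a 0 i + 2) / mesh R N <= k%:R <= (b 0 i + 2) / mesh R N then 1 else 0)).
Proof.
rewrite big_split /= prodr_const card_ord; congr (_ * _).
rewrite bigA_distr_bigA /=; apply: eq_bigr => k _; apply: eq_bigr => i _.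
rewrite mxE (ler_pdivrMr _ _ (mesh_gt0 R N)) (ler_pdivlMr _ _ (mesh_gt0 R N)).
by rewrite [-2 + _]addrC lerBrDr lerBlDr.
Qed.

Lemma prod_cvg (c : 'I_n -> R) (h : nat -> R) : h @ \oo --> (0 : R) ->
  (fun N => \prod_(i < n) (c i + h N)) @ \oo --> \prod_(i < n) c i.
Proof.
move=> h0; elim: (index_enum _) => [|i s IH].
  rewrite big_nil; under eq_fun do rewrite big_nil; exact: cvg_cst.
rewrite big_cons; under eq_fun do rewrite big_cons.
apply: cvgM => //; rewrite -[X in _ --> X]addr0; apply: cvgD => //; exact: cvg_cst.
Qed.

Lemma mesh_cvg : mesh R @ \oo --> (0 : R).
Proof.
apply/cvgrPdist_lt => e e0; have [N0 hN] := mesh_small e0.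
exists N0 => // N /= NN; rewrite sub0r normrN ger0_norm ?mesh_ge0 //; exact: hN.
Qed.

(** On each axis, node count times mesh exceeds the side by at most one mesh, and this excess
    disappears in the limit. *)
Lemma intQ_box_le a b : (forall i, a 0 i <= b 0 i) -> intQ (box_ind a b) <= box_vol a b.
Proof.
move=> ab; have cv := @prod_cvg (fun i => b 0 i - a 0 i) _ mesh_cvg.
rewrite /box_vol -(ulim_lim cv); apply: ulim_le.
- exact/gsum_bounded/bnd_box_ind.
- have /cvg_seq_bounded [M [_ hM]] : cvgn (fun N => \prod_(i < n) (b 0 i - a 0 i + mesh R N)).
    by apply/cvg_ex; eexists; exact: cv.
  exists (M + 1) => k; apply: hM => //; lra.
move=> N; rewrite gsum_box; apply: ler_prod => i _; apply/andP; split.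
  by rewrite mulr_ge0 ?mesh_ge0 // sumr_ge0 // => k _; case: ifP.
have m0 := mesh_gt0 R N; rewrite mulrC -ler_pdivlMr //.
apply: le_trans (count_le _ _) _.
  have := ab i; rewrite -subr_ge0 => h.
  suff : 0 <= (b 0 i - a 0 i) / mesh R N by rewrite mulrBl !mulrDl; lra.
  by rewrite divr_ge0 ?mesh_ge0.
by rewrite !mulrDl mulfV ?gt_eqF // mulNr; lra.
Qed.

(** The cube has side 2 s; claiming only s per axis absorbs the mesh step lost in counting. The
    bounds on c and s keep the cube inside the grid. *)
Lemma intQ_cube_ge c (s : R) : `|c| <= 1 -> 0 < s <= 1 ->
  s ^+ n <= intQ (box_ind (c - const_mx s) (c + const_mx s)).
Proof.
move=> c1 /andP[s0 s1]; have [N0 hN] := mesh_small s0.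
apply: (@ulim_ge_eventually _ _ _ N0); first exact/gsum_bounded/bnd_box_ind.
move=> N /hN mN; rewrite gsum_box.
have -> : s ^+ n = \prod_(i < n) s by rewrite prodr_const card_ord.
apply: ler_prod => i _; rewrite (ltW s0) /= mulrC -ler_pdivrMr ?mesh_gt0 //.
have := le_trans (coord_le_norm c i) c1; rewrite ler_norml => /andP[c2 c3].
have m0 := mesh_gt0 R N; rewrite !mxE.
apply: le_trans (count_ge _ _).
- have : 1 <= s / mesh R N by rewrite ler_pdivlMr // mul1r ltW.
  by rewrite !mulrDl mulNr; lra.
- by rewrite divr_ge0 ?mesh_ge0 //; lra.
- by rewrite ler_pdivrMr // mulrC mesh_size; lra.
Qed.

End Boxes.

(** * Bounded convergence *)

(** The witness, the inverse of 1 plus the sum of the inverses, also serves the empty family. *)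
Lemma fin_min_pos (R : realType) m (d : 'I_m -> R) : (forall i, 0 < d i) ->
  exists e : R, 0 < e /\ forall i, e <= d i.
Proof.
move=> d0; have s0 : 0 <= \sum_(i < m) (d i)^-1.
  by apply: sumr_ge0 => i _; rewrite invr_ge0 ltW.
exists (\sum_(i < m) (d i)^-1 + 1)^-1; split; first by rewrite invr_gt0 ltr_wpDl.
move=> i; rewrite -[leRHS]invrK lef_pV2 ?posrE ?invr_gt0 ?ltr_wpDl //.
rewrite (bigD1 i) //= -addrA lerDl addr_ge0 // sumr_ge0 // => j _.
by rewrite invr_ge0 ltW.
Qed.

Section BoundedConvergence.
Variables (R : realType) (n : nat).
Local Notation T := 'rV[R]_n.

Lemma cube_cluster (x : nat -> T) (r : R) : (forall k, `|x k| <= r) ->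
  exists y : T, `|y| <= r /\
    forall d : R, 0 < d -> forall n0, exists k, (n0 <= k)%N /\ `|x k - y| < d.
Proof.
move=> xr; have cK : compact [set y : T | `|y| <= r].
  apply: bounded_closed_compact.
    by exists r; split; [exact: num_real|] => M rM y /= /le_trans; apply; exact: ltW.
  exact: (closed_comp (fun y _ => @norm_continuous _ _ y) (@closed_le R r)).
have [|y [yr cly]] := cK (x @ \oo) _; first by exists 0%N => // k _; exact: xr.
exists y; split => // d d0 n0.
have [|_ [[k kn <-] yk]] := cly [set x k | k in [set k | (n0 <= k)%N]] (ball y d) _ (nbhsx_ballx _ _ d0).
  by exists n0 => // k kn /=; exists k.
by exists k; split => //; rewrite distrC; move: yk; rewrite mx_norm_ball.
Qed.

Fixpoint run_max (f : nat -> T -> R) j l (x : T) : R :=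
  if l is l'.+1 then Num.max (run_max f j l' x) (f (j + l')%N x) else 0.

Lemma run_max_ge0 f j l x : 0 <= run_max f j l x.
Proof. by elim: l => [|l IH] //=; rewrite le_max IH. Qed.

Lemma run_max_le f j l x (C : R) : 0 <= C ->
  (forall k, (j <= k)%N -> f k x <= C) -> run_max f j l x <= C.
Proof.
by move=> C0 fC; elim: l => [|l IH] //=; rewrite ge_max IH fC // leq_addr.
Qed.

Lemma run_max_ge f j l x k : (j <= k < j + l)%N -> f k x <= run_max f j l x.
Proof.
elim: l => [|l IH] /=; first by rewrite addn0 leqNgt andNb.
rewrite addnS ltnS [(k <= _)%N]leq_eqVlt => /andP[jk /orP[/eqP ->|kl]]; rewrite le_max ?lexx ?orbT //.
by rewrite IH // jk.
Qed.

Lemma run_max_mono f j l l' x : (l <= l')%N -> run_max f j l x <= run_max f j l' x.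
Proof.
move=> ll; rewrite -(subnKC ll); elim: (l' - l)%N => [|m IH]; first by rewrite addn0.
by rewrite addnS /= le_max IH.
Qed.

Lemma run_max_sub f j l j' l' x : (j' <= j)%N -> (j + l <= j' + l')%N ->
  run_max f j l x <= run_max f j' l' x.
Proof.
move=> jj; elim: l => [|l IH] h /=; first exact: run_max_ge0.
rewrite ge_max IH /=; last by apply: leq_trans h; rewrite leq_add2l.
by apply: run_max_ge; rewrite (leq_trans jj) ?leq_addr //= -addnS.
Qed.

(** The Lipschitz bound lets a lower bound for a running maximum pass from a sequence of points to a
    cluster point. *)
Lemma run_max_lip f j l (K : T -> Prop) :
  (forall k, exists L : R, forall x y, K x -> K y -> `|f k x - f k y| <= L * `|x - y|) ->
  exists L : R, forall x y, K x -> K y ->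
    `|run_max f j l x - run_max f j l y| <= L * `|x - y|.
Proof.
move=> fL; elim: l => [|l [L IH]] /=.
  by exists 0 => x y _ _; rewrite subrr normr0 mul0r.
have [L' hL'] := fL (j + l)%N; exists (`|L| + `|L'|) => x y Kx Ky.
have := IH x y Kx Ky; have := hL' x y Kx Ky.
set a := run_max f j l x; set b := run_max f j l y; set c := f _ x; set d := f _ y.
have := ler_norm L; have := ler_norm L'; have := normr_ge0 L; have := normr_ge0 L'.
have := normr_ge0 (x - y); set D := `|x - y|; rewrite !ler_norml.
move=> D0 l1 l2 l3 l4 /andP[c1 c2] /andP[a1 a2].
have h1 : L * D <= `|L| * D by rewrite ler_wpM2r.
have h2 : L' * D <= `|L'| * D by rewrite ler_wpM2r.
have h3 : 0 <= `|L| * D by rewrite mulr_ge0.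
have h4 : 0 <= `|L'| * D by rewrite mulr_ge0.
rewrite mulrDl; case: (leP a c) => ac; case: (leP b d) => bd; apply/andP; split; lra.
Qed.

(** The boxes are made open so that a cluster point of points outside a box that stay away from it
    cannot lie in it. Enlarging box number k costs eps / 2^(k+2), altogether at most eps / 2. *)
Lemma lebesgue_null_cover (N : set T) (eps : R) : lebesgue_null N -> 0 < eps ->
  exists a b : nat -> T,
    N `<=` \bigcup_k [set x | forall i, a k 0 i < x 0 i < b k 0 i] /\
    forall K, \sum_(k < K) intQ (box_ind (a k) (b k)) <= eps.
Proof.
move=> N0 e0; have e2 : 0 < eps / 2 by lra.
have [a [b [ab [Nab vab]]]] := N0 _ e2.
have enl k : exists h : R, 0 < h /\
    box_vol (a k - const_mx h) (b k + const_mx h) <= box_vol (a k) (b k) + eps / 2 ^+ k.+2.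
  have h0 : (fun N => 2 * mesh R N) @ \oo --> (0 : R).
    by rewrite -[X in _ --> X](mulr0 2); apply: cvgMr; exact: mesh_cvg.
  have cv := @prod_cvg R n (fun i => b k 0 i - a k 0 i) _ h0.
  have ek : 0 < eps / 2 ^+ k.+2 by rewrite divr_gt0 ?exprn_gt0.
  have /cvgrPdist_lt/(_ _ ek) [N1 _ /(_ N1 (leqnn _)) /=] := cv.
  rewrite ltr_norml => /andP[h1 h2]; exists (mesh R N1); split; first exact: mesh_gt0.
  rewrite /box_vol (eq_bigr (fun i => b k 0 i - a k 0 i + 2 * mesh R N1)); first by lra.
  by move=> i _; rewrite !mxE; lra.
have [h hP] := choice enl.
exists (fun k => a k - const_mx (h k)), (fun k => b k + const_mx (h k)); split.
  move=> x /Nab [k _ xk]; exists k => // i; have := xk i; have := (hP k).1.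
  by rewrite !mxE; lra.
move=> K; apply: (@le_trans _ _ (\sum_(k < K) (box_vol (a k) (b k) + eps / 2 ^+ k.+2))).
  apply: ler_sum => k _; apply: le_trans (hP k).2; apply: intQ_box_le => i.
  by have := ab k i; have := (hP k).1; rewrite !mxE; lra.
rewrite big_split /=; apply: (@le_trans _ _ (eps / 2 + eps / 2)); last by lra.
apply: lerD; first exact: vab.
suff : \sum_(i < K) eps / 2 ^+ i.+2 <= eps / 2 - eps / 2 ^+ K.+1.
  by move/le_trans; apply; rewrite gerBl divr_ge0 ?exprn_ge0 // ltW.
elim: K => [|K IH]; first by rewrite big_ord0 expr1; lra.
rewrite big_ord_recr /=; apply: le_trans (lerD IH (lexx _)) _.
rewrite [2 ^+ K.+2]exprS invfM; lra.
Qed.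

(* Lewin's elementary argument: the functions [H j], nearly maximal integrals of
   [max_(j <= k < j + l) f k], stay large simultaneously at some point outside the first
   boxes covering [N]; a cluster point of such points contradicts the convergence. *)
Lemma bounded_convergence (N : set T) (f : nat -> T -> R) (C : R) :
  lebesgue_null N ->
  (forall k, exists L : R, forall x y, `|x| <= 1 -> `|y| <= 1 ->
     `|f k x - f k y| <= L * `|x - y|) ->
  (forall k x, `|x| <= 1 -> 0 <= f k x <= C) ->
  (forall k x, 1 < `|x| -> f k x = 0) ->
  (forall x, `|x| <= 1 -> ~ N x -> forall e : R, 0 < e ->
     exists K, forall k, (K <= k)%N -> f k x <= e) ->
  forall d : R, 0 < d -> exists k, intQ (f k) <= d.
Proof.
move=> N0 flip fC fout fcv d d0; apply/not_existsP => nlow.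
have low k : d < intQ (f k) by rewrite ltNge; apply/negP/nlow.
have C0 : 0 <= C.
  by have := fC 0%N 0; rewrite normr0 ler01 => /(_ isT)/andP[h1 h2]; exact: le_trans h1 h2.
have f0 k x : 0 <= f k x.
  by have [/(fC k)/andP[]//|/fout->//] := leP `|x| 1.
have fC' k x : f k x <= C.
  by have [/(fC k)/andP[]//|/fout->//] := leP `|x| 1.
have bf k : bnd (f k) by exists C => x _; rewrite ger0_norm.
have rmC j l x : run_max f j l x <= C by apply: run_max_le.
have brm j l : bnd (run_max f j l).
  by exists C => x _; rewrite ger0_norm ?run_max_ge0.
pose c4 : R := 4 ^+ n; have c40 : 0 < c4 by rewrite exprn_gt0.
have irmC j l : intQ (run_max f j l) <= c4 * C.
  apply: le_trans (ler_norm _) _; apply: intQ_abs => x _.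
  by rewrite ger0_norm ?run_max_ge0.
(* The integrals of [H j] exceed d, while three errors of d / 4 each are allowed: the slacks [ep],
   the covering boxes, and the level [dl] integrated over the cube. *)
pose ep j : R := d / 4 / 2 ^+ j.+1.
have ep0 j : 0 < ep j by rewrite !divr_gt0 ?exprn_gt0.
have msel j : exists l, (0 < l)%N /\
    forall l', intQ (run_max f j l') <= intQ (run_max f j l) + ep j.
  pose S := [set intQ (run_max f j l) | l in [set l | (0 < l)%N]].
  have S0 : S !=set0 by exists (intQ (run_max f j 1)), 1%N.
  have Sub : has_ubound S by exists (c4 * C) => _ [l _ <-]; exact: irmC.
  have [_ [l l0 <-] hl] := sup_adherent (ep0 j) (conj S0 Sub).
  exists l; split => // l'; apply: (@le_trans _ _ (sup S)); last by lra.
  apply: (@le_trans _ _ (intQ (run_max f j l'.+1))).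
    by apply: intQ_le => // x _; exact: run_max_mono.
  by apply: ub_le_sup => //; exists l'.+1.
have [l lP] := choice msel; pose H j := run_max f j (l j).
have [a [b [Nab vab]]] : exists a b : nat -> T,
    N `<=` \bigcup_k [set x | forall i, a k 0 i < x 0 i < b k 0 i] /\
    forall K, \sum_(k < K) intQ (box_ind (a k) (b k)) <= d / 4 / (C + 1).
  by apply: lebesgue_null_cover => //; rewrite !divr_gt0 //; lra.
pose O k := [set x : T | forall i, a k 0 i < x 0 i < b k 0 i].
pose dl := d / 4 / c4; have dl0 : 0 < dl by rewrite !divr_gt0.
have pick j : exists x : T, [/\ `|x| <= 1, forall i, (i <= j)%N -> dl <= H i x &
    forall i, (i < j)%N -> ~ O i x].
  apply: contrapT => /forallNP nx.
  (* If no point qualifies, a point of the unit cube either lies in one of the first boxes, where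
     the last sum is at least 1, or has some [H i x] below [dl], and then [H j x] exceeds [dl] by at
     most the i-th term of the first sum. *)
  have ptw x : H j x <= dl + \sum_(i < j) (Num.max (H j x) (H i x) - H i x)
      + C * \sum_(i < j) box_ind (a i) (b i) x.
    have s1 : 0 <= \sum_(i < j) (Num.max (H j x) (H i x) - H i x).
      by apply: sumr_ge0 => i _; rewrite subr_ge0 le_max lexx orbT.
    have s2 : 0 <= C * \sum_(i < j) box_ind (a i) (b i) x.
      by rewrite mulr_ge0 // sumr_ge0 // => i _; exact: box_ind_ge0.
    have [x1|x1] := leP `|x| 1; last first.
      suff : H j x = 0 by lra.
      apply/eqP; rewrite eq_le run_max_ge0 andbT; apply: run_max_le => // k _.
      by rewrite fout.
    have := nx x; case/not_and3P => // [/existsNP[i /not_implyP[ij /negP]]|/existsNP[i /not_implyP[ij /contrapT Oi]]].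
      rewrite -ltNge => Hi; move: ij; rewrite leq_eqVlt => /orP[/eqP ij|ij].
        by move: Hi; rewrite ij => Hi; lra.
      suff : H j x - H i x <= \sum_(i < j) (Num.max (H j x) (H i x) - H i x) by lra.
      rewrite (bigD1 (Ordinal ij)) //= ler_wpDr //.
        by apply: sumr_ge0 => i' _; rewrite subr_ge0 le_max lexx orbT.
      by rewrite lerD2r le_max lexx.
    suff : C <= C * \sum_(i < j) box_ind (a i) (b i) x.
      by have := rmC j (l j) x; rewrite -/(H j x); lra.
    rewrite ler_peMr // (bigD1 (Ordinal ij)) //= box_ind_in; last first.
      by move=> i'; have /andP[/ltW -> /ltW ->] := Oi i'.
    by rewrite ler_wpDr // sumr_ge0 // => i' _; exact: box_ind_ge0.
  have bH i : bnd (H i) by exact: brm.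
  have bmax i : bnd (fun x => Num.max (H j x) (H i x)).
    by exists C => x _; rewrite ger0_norm ?ge_max ?le_max ?rmC ?run_max_ge0.
  have bb i : bnd (box_ind (a i) (b i)) by exact: bnd_box_ind.
  have : intQ (H j) <= intQ (fun x => dl + \sum_(i < j) (Num.max (H j x) (H i x) - H i x)
      + C * \sum_(i < j) box_ind (a i) (b i) x).
    by apply: intQ_le => //; bnd_tac.
  rewrite intQD; [|by bnd_tac..]. rewrite intQD; [|by bnd_tac..].
  rewrite intQZ; [|by bnd_tac..]. rewrite !intQ_sum; [|by move=> i; bnd_tac..].
  have t1 : intQ (fun _ : T => dl) <= d / 4.
    apply: le_trans (ler_norm _) _; apply: le_trans (intQ_abs (C := dl) _) _.
      by move=> x _; rewrite (ger0_norm (ltW dl0)).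
    by rewrite /dl mulrC divfK ?gt_eqF.
  have t2 : \sum_(i < j) intQ (fun x => Num.max (H j x) (H i x) - H i x) <= d / 4.
    apply: (@le_trans _ _ (\sum_(i < j) ep i)).
      apply: ler_sum => i _; rewrite intQB //.
      (* A window starting at i and long enough to contain those of [H i] and [H j] dominates both,
         and by the choice of [l i] its integral gains at most [ep i]. *)
      have [_ /(_ (maxn (l i) (j + l j - i))%N)] := lP i.
      suff : intQ (fun x => Num.max (H j x) (H i x)) <=
        intQ (run_max f i (maxn (l i) (j + l j - i))) by rewrite -/(H i); lra.
      apply: intQ_le => // x _; rewrite ge_max; apply/andP; split.
        apply: run_max_sub; first exact: ltnW.
        by rewrite -leq_subLR leq_max leqnn orbT.
      by apply: run_max_mono; rewrite leq_max leqnn.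
    suff : \sum_(i < j) ep i <= d / 4 - d / 4 / 2 ^+ j.
      by move/le_trans; apply; rewrite gerBl !divr_ge0 ?exprn_ge0 // ltW.
    elim: (j) => [|J IH]; first by rewrite big_ord0 expr0; lra.
    rewrite big_ord_recr /=; apply: le_trans (lerD IH (lexx _)) _.
    by rewrite /ep [2 ^+ J.+1]exprS invfM; lra.
  have t3 : C * \sum_(i < j) intQ (box_ind (a i) (b i)) <= d / 4.
    apply: (@le_trans _ _ ((C + 1) * (d / 4 / (C + 1)))); last first.
      by rewrite mulrC divfK // gt_eqF //; lra.
    apply: ler_pM => //; last by lra.
    by apply: sumr_ge0 => i _; apply: intQ_ge0 => // x _; exact: box_ind_ge0.
  have t4 : d < intQ (H j).
    apply: lt_le_trans (low j) _; apply: intQ_le => // x _.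
    by apply: run_max_ge; rewrite leqnn /= -[X in (X < _)%N]addn0 ltn_add2l (lP j).1.
  by lra.
have [x xP] := choice pick.
have [|y [y1 ycl]] := @cube_cluster x 1; first by move=> k; case: (xP k).
have yH i : dl <= H i y.
  have [L hL] := run_max_lip i (l i) flip.
  rewrite leNgt; apply/negP => yi.
  have e0 : 0 < (dl - H i y) / (`|L| + 1) by rewrite divr_gt0 ?subr_gt0 // ltr_wpDl.
  have [k [ik xk]] := ycl _ e0 i; have [x1 xH _] := xP k.
  have := hL _ _ x1 y1; rewrite -/(H i) => /(le_trans (ler_norm _)) h.
  have : L * `|x k - y| <= (`|L| + 1) * `|x k - y|.
    by rewrite ler_wpM2r // (le_trans (ler_norm _)) // lerDl.
  have L1 : 0 < `|L| + 1 by rewrite ltr_wpDl.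
  move: xk; rewrite (ltr_pdivlMr _ _ L1) mulrC.
  have := xH i ik; lra.
have yO i : ~ O i y.
  move=> Oy; have : exists e : R, 0 < e /\ forall z, `|z - y| < e -> O i z.
    have dpos i' : 0 < Num.min (y 0 i' - a i 0 i') (b i 0 i' - y 0 i').
      by have /andP[? ?] := Oy i'; rewrite lt_min !subr_gt0; apply/andP.
    have [e [e0 he]] := fin_min_pos dpos; exists e; split => // z zy i'.
    have := le_lt_trans (coord_le_norm (z - y) i') zy; rewrite !mxE.
    have := he i'; rewrite le_min ltr_norml => /andP[h1 h2] /andP[h3 h4].
    by apply/andP; split; lra.
  move=> [e [e0 he]]; have [k [ik xk]] := ycl _ e0 i.+1; have [_ _ xO] := xP k.
  exact: (xO i ik (he _ xk)).
have nNy : ~ N y by move=> /Nab[k _ /yO].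
(* Outside [N] all terms from [K] on are at most [dl / 2] at [y], hence so is [H K y], against
   [yH]. *)
have [K hK] := fcv y y1 nNy (dl / 2) (divr_gt0 dl0 (ltr0n _ 2)).
have := yH K; apply/negP; rewrite -ltNge.
apply: (@le_lt_trans _ _ (dl / 2)); last by lra.
by apply: run_max_le => //; lra.
Qed.

End BoundedConvergence.

(** * Functions of class C^{1,1} *)

Section Dot.
Variables (R : realType) (n : nat).
Local Notation T := 'rV[R]_n.
Implicit Types (x y z : T).

(** The norm of row vectors is the sup norm; Euclidean squares are written with [dot] and compared
    with it in [norm_sq_le_dot] and [dotxx_le]. *)
Definition dot x y : R := \sum_i x 0 i * y 0 i.

Lemma dotC x y : dot x y = dot y x.
Proof. by apply: eq_bigr => i _; rewrite mulrC. Qed.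

Lemma dotDl x y z : dot (x + y) z = dot x z + dot y z.
Proof. by rewrite /dot -big_split; apply: eq_bigr => i _; rewrite mxE mulrDl. Qed.

Lemma dotZl (c : R) x y : dot (c *: x) y = c * dot x y.
Proof. by rewrite /dot mulr_sumr; apply: eq_bigr => i _; rewrite mxE mulrA. Qed.

Lemma dotNl x y : dot (- x) y = - dot x y.
Proof. by rewrite -scaleN1r dotZl mulN1r. Qed.

Lemma dotBl x y z : dot (x - y) z = dot x z - dot y z.
Proof. by rewrite dotDl dotNl. Qed.

Lemma dotDr x y z : dot x (y + z) = dot x y + dot x z.
Proof. by rewrite dotC dotDl !(dotC _ x). Qed.

Lemma dotZr (c : R) x y : dot x (c *: y) = c * dot x y.
Proof. by rewrite dotC dotZl dotC. Qed.

Lemma dotNr x y : dot x (- y) = - dot x y.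
Proof. by rewrite dotC dotNl dotC. Qed.

Lemma dotBr x y z : dot x (y - z) = dot x y - dot x z.
Proof. by rewrite dotDr dotNr. Qed.

Lemma dot0l x : dot 0 x = 0.
Proof. by rewrite -(scale0r 0) dotZl mul0r. Qed.

Lemma dot_abs x y : `|dot x y| <= n%:R * (`|x| * `|y|).
Proof.
apply: le_trans (ler_norm_sum _ _ _) _.
apply: (@le_trans _ _ (\sum_(i < n) `|x| * `|y|)).
  by apply: ler_sum => i _; rewrite normrM ler_pM // coord_le_norm.
by rewrite sumr_const card_ord -(mulr_natl (`|x| * `|y|)).
Qed.

Lemma dot_le x y (C D : R) : `|x| <= C -> `|y| <= D -> `|dot x y| <= n%:R * (C * D).
Proof.
by move=> xC yD; apply: le_trans (dot_abs _ _) _; rewrite ler_wpM2l // ler_pM.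
Qed.

Lemma dot_evec x i : dot x (evec R i) = x 0 i.
Proof.
rewrite /dot (bigD1 i) //= /evec mxE !eqxx mulr1 big1 ?addr0 // => j ji.
by rewrite mxE (negPf ji) andbF mulr0.
Qed.

Lemma dotxx_ge0 x : 0 <= dot x x.
Proof. by apply: sumr_ge0 => i _; rewrite -expr2 sqr_ge0. Qed.

Lemma norm_sq_le_dot x : `|x| ^+ 2 <= dot x x.
Proof.
have h : `|x| <= Num.sqrt (dot x x).
  apply: norm_le_coord; first exact: sqrtr_ge0.
  move=> i; rewrite -sqrtr_sqr ler_wsqrtr // /dot (bigD1 i) //= expr2 lerDl.
  by apply: sumr_ge0 => j _; rewrite -expr2 sqr_ge0.
by rewrite -[leRHS]sqr_sqrtr ?dotxx_ge0 // ler_pXn2r // nnegrE ?sqrtr_ge0.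
Qed.

Lemma dotxx_le x : dot x x <= n%:R * `|x| ^+ 2.
Proof. by apply: le_trans (ler_norm _) _; rewrite expr2; exact: dot_abs. Qed.

Lemma row_norm_le (v : 'I_n -> R) (C : R) : 0 <= C -> (forall i, `|v i| <= C) ->
  `|\row_i v i| <= C.
Proof. by move=> C0 vC; apply: norm_le_coord => // i; rewrite mxE. Qed.

End Dot.

Section C11.
Variables (R : realType) (n : nat).
Local Notation T := 'rV[R]_n.
Implicit Types (f : T -> R) (g : T -> T) (B : T -> Prop) (C D : R).

(* [g] plays the role of the gradient of [f] on [B]. *)
Record C11 B C f g : Prop := MkC11 {
  C11_ge0 : 0 <= C;
  C11_val : forall x, B x -> `|f x| <= C;
  C11_grad : forall x, B x -> `|g x| <= C;
  C11_lip : forall x y, B x -> B y -> `|f y - f x| <= C * `|y - x|;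
  C11_glip : forall x y, B x -> B y -> `|g y - g x| <= C * `|y - x|;
  C11_taylor : forall x y, B x -> B y ->
    `|f y - f x - dot (g x) (y - x)| <= C * `|y - x| ^+ 2 }.

Lemma C11_weaken B C D f g : C <= D -> C11 B C f g -> C11 B D f g.
Proof.
move=> CD [C0 h1 h2 h3 h4 h5]; split; first exact: le_trans CD.
- by move=> x /h1/le_trans; apply.
- by move=> x /h2/le_trans; apply.
- by move=> x y Bx By; apply: le_trans (h3 _ _ Bx By) _; rewrite ler_wpM2r.
- by move=> x y Bx By; apply: le_trans (h4 _ _ Bx By) _; rewrite ler_wpM2r.
- by move=> x y Bx By; apply: le_trans (h5 _ _ Bx By) _; rewrite ler_wpM2r ?exprn_ge0.
Qed.

Lemma C11_ext B C f g f' g' : (forall x, B x -> f x = f' x) ->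
  (forall x, B x -> g x = g' x) -> C11 B C f g -> C11 B C f' g'.
Proof.
move=> ff gg [C0 h1 h2 h3 h4 h5]; split => //.
- by move=> x Bx; rewrite -ff ?h1.
- by move=> x Bx; rewrite -gg ?h2.
- by move=> x y Bx By; rewrite -!ff ?h3.
- by move=> x y Bx By; rewrite -!gg ?h4.
- by move=> x y Bx By; rewrite -!ff -?gg ?h5.
Qed.

Lemma C11D B C1 C2 f1 g1 f2 g2 : C11 B C1 f1 g1 -> C11 B C2 f2 g2 ->
  C11 B (C1 + C2) (fun x => f1 x + f2 x) (fun x => g1 x + g2 x).
Proof.
move=> [C0 h1 h2 h3 h4 h5] [C0' h1' h2' h3' h4' h5']; split.
- exact: addr_ge0.
- by move=> x Bx; apply: le_trans (ler_normD _ _) (lerD _ _); auto.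
- by move=> x Bx; apply: le_trans (ler_normD _ _) (lerD _ _); auto.
- move=> x y Bx By; rewrite mulrDl opprD addrACA.
  by apply: le_trans (ler_normD _ _) (lerD _ _); auto.
- move=> x y Bx By; rewrite mulrDl opprD addrACA.
  by apply: le_trans (ler_normD _ _) (lerD _ _); auto.
- move=> x y Bx By; rewrite mulrDl dotDl.
  rewrite (_ : _ - _ = (f1 y - f1 x - dot (g1 x) (y - x))
    + (f2 y - f2 x - dot (g2 x) (y - x))); last by ring.
  by apply: le_trans (ler_normD _ _) (lerD _ _); auto.
Qed.

Lemma C11_cst B (c : R) : C11 B `|c| (fun _ => c) (fun _ => 0).
Proof.
by split => // [x _|x y _ _|x y _ _|x y _ _];
  rewrite ?subrr ?dot0l ?subrr ?normr0 // mulr_ge0 ?exprn_ge0.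
Qed.

(** The factor 4 counts the four products in the Lipschitz bound of the gradient; the other clauses
    produce at most three. *)
Lemma C11M B C1 C2 f1 g1 f2 g2 : C11 B C1 f1 g1 -> C11 B C2 f2 g2 ->
  C11 B (4 * (C1 * C2)) (fun x => f1 x * f2 x) (fun x => f1 x *: g2 x + f2 x *: g1 x).
Proof.
move=> [C0 h1 h2 h3 h4 h5] [C0' h1' h2' h3' h4' h5'].
have CC : 0 <= C1 * C2 by exact: mulr_ge0.
split.
- by rewrite mulr_ge0.
- move=> x Bx; rewrite normrM; apply: (@le_trans _ _ (C1 * C2)); last by lra.
  by rewrite ler_pM; auto.
- move=> x Bx; apply: (@le_trans _ _ (C1 * C2 + C2 * C1)); last by lra.
  apply: le_trans (ler_normD _ _) _; rewrite !normrZ.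
  by apply: lerD; rewrite ler_pM; auto.
- move=> x y Bx By; rewrite (_ : _ - _ = f1 y * (f2 y - f2 x) + f2 x * (f1 y - f1 x)); last by ring.
  apply: (@le_trans _ _ (C1 * (C2 * `|y - x|) + C2 * (C1 * `|y - x|))).
    apply: le_trans (ler_normD _ _) _; rewrite !normrM.
    by apply: lerD; rewrite ler_pM; auto.
  by have := mulr_ge0 CC (normr_ge0 (y - x)); nra.
- move=> x y Bx By.
  rewrite (_ : _ - _ = f1 y *: (g2 y - g2 x) + (f1 y - f1 x) *: g2 x
     + (f2 y *: (g1 y - g1 x) + (f2 y - f2 x) *: g1 x)); last first.
    by apply/rowP => i; rewrite !mxE; ring.
  apply: (@le_trans _ _ ((C1 * (C2 * `|y - x|) + (C1 * `|y - x|) * C2) +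
     (C2 * (C1 * `|y - x|) + (C2 * `|y - x|) * C1))); last by nra.
  apply: le_trans (ler_normD _ _) _; apply: lerD.
    apply: le_trans (ler_normD _ _) _; rewrite !normrZ.
    by apply: lerD; rewrite ler_pM; auto.
  apply: le_trans (ler_normD _ _) _; rewrite !normrZ.
  by apply: lerD; rewrite ler_pM; auto.
- move=> x y Bx By; rewrite dotDl !dotZl.
  rewrite (_ : _ - _ = f1 x * (f2 y - f2 x - dot (g2 x) (y - x))
    + f2 x * (f1 y - f1 x - dot (g1 x) (y - x)) + (f1 y - f1 x) * (f2 y - f2 x)); last by ring.
  apply: (@le_trans _ _ (C1 * (C2 * `|y - x| ^+ 2) + C2 * (C1 * `|y - x| ^+ 2) +
     (C1 * `|y - x|) * (C2 * `|y - x|))); last first.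
    by have := mulr_ge0 CC (sqr_ge0 `|y - x|); nra.
  apply: le_trans (ler_normD _ _) _; apply: lerD; last first.
    by rewrite normrM ler_pM; auto.
  apply: le_trans (ler_normD _ _) _; rewrite !normrM.
  by apply: lerD; rewrite ler_pM; auto.
Qed.

Lemma C11Z B C (c : R) f g : C11 B C f g ->
  C11 B (4 * (`|c| * C)) (fun x => c * f x) (fun x => c *: g x).
Proof.
move=> fg; apply: C11_ext (C11M (C11_cst B c) fg) => // x _.
by rewrite scaler0 addr0.
Qed.

Lemma C11N B C f g : C11 B C f g ->
  C11 B (4 * C) (fun x => - f x) (fun x => - g x).
Proof.
move=> /(C11Z (-1)); rewrite normrN1 mul1r.
by apply: C11_ext => x _; rewrite ?mulN1r ?scaleN1r.
Qed.

Lemma C11X B C f g k : C11 B C f g -> C11 B (4 ^+ k * (C + 1) ^+ k)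
  (fun x => f x ^+ k) (fun x => (k%:R * f x ^+ k.-1) *: g x).
Proof.
move=> fg; have C0 := C11_ge0 fg; elim: k => [|k IH].
  apply: C11_weaken (C11_ext _ _ (C11_cst B 1)) => [|x _|x _].
  - by rewrite normr1 mulr1.
  - by rewrite expr0.
  - by rewrite mul0r scale0r.
apply: C11_weaken (C11_ext _ _ (C11M fg IH)) => [|x _|x _].
- rewrite !exprS (_ : 4 * 4 ^+ k * _ = 4 * ((C + 1) * (4 ^+ k * (C + 1) ^+ k))); last by ring.
  rewrite ler_wpM2l // ler_wpM2r ?lerDl // mulr_ge0 ?exprn_ge0 // addr_ge0 //.
- by rewrite exprS.
- rewrite scalerA -scalerDl; congr (_ *: _); case: k {IH} => [|k] /=.
    by rewrite mul0r mulr0 add0r mul1r.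
  have -> : k.+2%:R = k.+1%:R + 1 :> R by rewrite natr1.
  by rewrite exprS; ring.
Qed.

(** [K] is fixed before [f] and [g] because the lemma is applied to a whole family [wdist z], whose
    integral over z calls for one common constant. *)
Lemma C11_inv B C (c : R) : 0 < c -> exists K : R, forall f g,
  C11 B C f g -> (forall x, B x -> c <= f x) ->
  C11 B K (fun x => (f x)^-1) (fun x => (- (f x)^-2) *: g x).
Proof.
move=> c0; pose e := c^-1; exists (e + e * e * C + 2 * (e * e * e * C * C)).
move=> f g [C0 h1 h2 h3 h4 h5] cf.
have e0 : 0 <= e by rewrite invr_ge0 ltW.
have f0 x : B x -> f x != 0 by move=> /cf h; rewrite gt_eqF // (lt_le_trans c0).
have fe x : B x -> `|(f x)^-1| <= e.
  move=> Bx; have h := lt_le_trans c0 (cf x Bx).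
  by rewrite ger0_norm ?invr_ge0 ?(ltW h) // lef_pV2 ?posrE ?cf.
have fe2 x : B x -> `|(f x)^-2| <= e * e.
  by move=> Bx; rewrite -exprVn expr2 normrM ler_pM ?fe.
have fl x y : B x -> B y -> `|(f y)^-1 - (f x)^-1| <= e * e * (C * `|y - x|).
  move=> Bx By.
  rewrite (_ : _ - _ = - ((f y)^-1 * (f x)^-1 * (f y - f x))); last first.
    by field; rewrite !f0.
  rewrite normrN normrM ler_pM //; last exact: h3.
  by rewrite normrM ler_pM ?fe.
have p1 : 0 <= e * e * C by rewrite !mulr_ge0.
have p2 : 0 <= e * e * e * C * C by rewrite !mulr_ge0.
split.
- lra.
- by move=> x Bx; apply: le_trans (fe x Bx) _; lra.
- move=> x Bx; rewrite normrZ normrN; apply: (@le_trans _ _ (e * e * C)); last by lra.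
  by rewrite ler_pM ?fe2 ?h2.
- move=> x y Bx By; apply: le_trans (fl x y Bx By) _.
  rewrite (_ : _ * (C * _) = e * e * C * `|y - x|); last by ring.
  by rewrite ler_wpM2r //; lra.
- move=> x y Bx By.
  rewrite (_ : _ - _ = - ((f y)^-2 *: (g y - g x) +
      (((f y)^-1 - (f x)^-1) * ((f y)^-1 + (f x)^-1)) *: g x)); last first.
    by apply/rowP => i; rewrite !mxE; field; rewrite !f0.
  rewrite normrN; apply: (@le_trans _ _ (e * e * (C * `|y - x|) +
     (e * e * (C * `|y - x|)) * (e + e) * C)); last first.
    rewrite (_ : _ + _ = (e * e * C + 2 * (e * e * e * C * C)) * `|y - x|); last by ring.
    by rewrite ler_wpM2r //; lra.
  apply: le_trans (ler_normD _ _) _; rewrite !normrZ; apply: lerD.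
    by rewrite ler_pM ?fe2 ?h4.
  rewrite ler_pM ?h2 ?mulr_ge0 //; apply: ler_pM => //; first exact: fl.
  by apply: le_trans (ler_normD _ _) _; rewrite lerD ?fe.
- move=> x y Bx By; rewrite dotZl.
  rewrite (_ : _ - _ = - ((f x)^-2 * (f y - f x - dot (g x) (y - x))) +
      (f y - f x) * (f y - f x) * ((f x)^-2 * (f y)^-1)); last first.
    by field; rewrite !f0.
  apply: (@le_trans _ _ (e * e * (C * `|y - x| ^+ 2) +
     (C * `|y - x|) * (C * `|y - x|) * (e * e * e))); last first.
    rewrite (_ : _ + _ = (e * e * C + e * e * e * C * C) * `|y - x| ^+ 2); last by ring.
    by rewrite ler_wpM2r ?exprn_ge0 //; lra.
  apply: le_trans (ler_normD _ _) _; rewrite normrN; apply: lerD.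
    by rewrite normrM ler_pM ?fe2 ?h5.
  rewrite !normrM; apply: ler_pM; rewrite ?mulr_ge0 //; last first.
    by rewrite ler_pM ?fe2 ?fe.
  by apply: ler_pM; rewrite ?h3.
Qed.

Lemma C11_affine B (r : R) (a : T) (c : R) : 0 <= r -> (forall x, B x -> `|x| <= r) ->
  C11 B (n%:R * (`|a| * r) + `|a| + n%:R * `|a| + `|c|)
    (fun x => dot a x + c) (fun _ => a).
Proof.
move=> r0 Br; have p1 : 0 <= n%:R * (`|a| * r) by rewrite !mulr_ge0.
have p2 : 0 <= n%:R * `|a| by rewrite mulr_ge0.
have p3 := normr_ge0 a; have p4 := normr_ge0 c.
split.
- lra.
- move=> x /Br xr; apply: le_trans (ler_normD _ _) _.
  have := dot_le (lexx `|a|) xr; lra.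
- move=> x _; lra.
- move=> x y _ _; rewrite (_ : _ - _ = dot a (y - x)); last by rewrite dotBr; ring.
  by apply: le_trans (dot_abs _ _) _; rewrite mulrA ler_wpM2r //; lra.
- by move=> x y _ _; rewrite subrr normr0 mulr_ge0 //; lra.
- move=> x y _ _; rewrite dotBr (_ : _ - _ = 0); last by ring.
  by rewrite normr0 mulr_ge0 ?exprn_ge0 //; lra.
Qed.

Lemma C11_sqdist B (r : R) (z : T) : 1 <= r -> (forall x, B x -> `|x - z| <= r) ->
  C11 B (4 * (n%:R + 1) * (r * r)) (fun x => dot (x - z) (x - z)) (fun x => 2 *: (x - z)).
Proof.
move=> r1 Br; have p1 : 0 <= n%:R :> R by [].
have p2 : r <= r * r by nra.
have p3 : 0 <= n%:R * r by nra.
have p4 : n%:R * r <= n%:R * (r * r) by rewrite ler_wpM2l.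
have E x y : dot (y - z) (y - z) - dot (x - z) (x - z) = dot ((y - z) + (x - z)) (y - x).
  by rewrite !(dotDl, dotDr, dotNl, dotNr) (dotC z x) (dotC z y) (dotC y x); ring.
split.
- by rewrite !mulr_ge0 //; lra.
- move=> x /Br xr; apply: le_trans (dot_le xr xr) _; nra.
- move=> x /Br xr; rewrite normrZ ger0_norm //; nra.
- move=> x y Bx By; rewrite E; apply: le_trans (dot_abs _ _) _.
  rewrite mulrA ler_wpM2r //; apply: (@le_trans _ _ (n%:R * (r + r))); last by nra.
  by rewrite ler_wpM2l //; apply: le_trans (ler_normD _ _) _; rewrite lerD ?Br.
- move=> x y _ _; rewrite -scalerBr normrZ ger0_norm //.
  rewrite (_ : y - z - _ = y - x); last by rewrite opprB addrA subrK.
  by rewrite ler_wpM2r //; nra.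
- move=> x y _ _; rewrite E dotZl.
  rewrite (_ : _ - _ = dot (y - x) (y - x)); last first.
    by rewrite !(dotDl, dotDr, dotNl, dotNr) (dotC z x) (dotC z y) (dotC y x); ring.
  rewrite ger0_norm ?dotxx_ge0 //; apply: le_trans (dotxx_le _) _.
  by rewrite ler_wpM2r ?exprn_ge0 //; nra.
Qed.

Lemma bnd_C11 C f g : C11 (fun x => `|x| <= 2) C f g -> bnd f.
Proof. by move=> fg; exists C => x xQ; exact: (C11_val fg). Qed.

(** Every clause of [C11] bounds an expression linear in [f] and [g], so it passes through the
    integral at the cost of the volume 4^n. This takes the place of differentiation under the
    integral sign. *)
Lemma C11_intQ B C (f : T -> T -> R) (g : T -> T -> T) :
  (forall z, `|z| <= 2 -> C11 B C (f z) (g z)) ->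
  C11 B (4 ^+ n * C) (fun x => intQ (fun z => f z x))
    (fun x => \row_i intQ (fun z => g z x 0 i)).
Proof.
move=> fg; have C0 : 0 <= C.
  have h : `|0 : T| <= 2 by rewrite normr0.
  exact: C11_ge0 (fg 0 h).
have c4 : 0 <= 4 ^+ n :> R by rewrite exprn_ge0.
have bf x : B x -> bnd (fun z => f z x).
  by move=> Bx; exists C => z /fg /C11_val; apply.
have bg x i : B x -> bnd (fun z => g z x 0 i).
  move=> Bx; exists C => z /fg /C11_grad /(_ x Bx); apply: le_trans; exact: coord_le_norm.
split.
- exact: mulr_ge0.
- by move=> x Bx; apply: intQ_abs => z /fg /C11_val; apply.
- move=> x Bx; apply: row_norm_le; first exact: mulr_ge0.
  move=> i; apply: intQ_abs => z /fg /C11_grad /(_ x Bx).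
  by apply: le_trans; exact: coord_le_norm.
- move=> x y Bx By; rewrite -(intQB (bf _ By) (bf _ Bx)) -mulrA.
  by apply: intQ_abs => z /fg /C11_lip; apply.
- move=> x y Bx By; rewrite -mulrA; apply: norm_le_coord; first by rewrite !mulr_ge0.
  move=> i; rewrite !mxE -(intQB (bg _ i By) (bg _ i Bx)); apply: intQ_abs => z /fg /C11_glip /(_ x y Bx By).
  apply: le_trans; apply: le_trans (coord_le_norm _ i); by rewrite !mxE.
- move=> x y Bx By; rewrite -(intQB (bf _ By) (bf _ Bx)) /dot.
  under eq_bigr => i _ do rewrite mxE mulrC -(intQZ _ (bg x i Bx)).
  rewrite -intQ_sum; last by move=> i; apply: bndM; [exact: bndC|exact: bg].
  rewrite -intQB; [|by apply: bndB; exact: bf|]; last first.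
    by apply: bnd_sum => i; apply: bndM; [exact: bndC|exact: bg].
  rewrite -mulrA; apply: intQ_abs => z /fg /C11_taylor /(_ x y Bx By).
  apply: le_trans; rewrite le_eqVlt; apply/orP; left; apply/eqP; congr `|_ - _|.
  by apply: eq_bigr => i _; rewrite mulrC.
Qed.

End C11.

(** * Integration by parts *)

Section Ibp.
Variables (R : realType) (n : nat).
Local Notation T := 'rV[R]_n.
Local Notation Q := (fun x : T => is_true (`|x| <= 2)).

Lemma entry_le_norm m k (A : 'M[R]_(m, k)) i j : `|A i j| <= `|A|.
Proof.
rewrite [leRHS]/Num.norm /= mx_normrE.
by rewrite (@le_bigmax _ _ _ _ (fun ij : 'I_m * 'I_k => `|A ij.1 ij.2|) (i, j)).
Qed.

Lemma mx_norm_le m k (A : 'M[R]_(m, k)) (C : R) : 0 <= C ->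
  (forall i j, `|A i j| <= C) -> `|A| <= C.
Proof.
move=> C0 AC; rewrite [leLHS]/Num.norm /= mx_normrE; by apply/bigmax_leP; split.
Qed.

Lemma mulmx_norm m k (X : 'M[R]_(m, n)) (A : 'M[R]_(n, k)) :
  `|X *m A| <= n%:R * (`|X| * `|A|).
Proof.
apply: mx_norm_le => [|i j]; first by rewrite !mulr_ge0.
rewrite mxE; apply: le_trans (ler_norm_sum _ _ _) _.
apply: (@le_trans _ _ (\sum_(l < n) `|X| * `|A|)).
  by apply: ler_sum => l _; rewrite normrM ler_pM ?entry_le_norm.
by rewrite sumr_const card_ord -(mulr_natl (`|X| * `|A|)).
Qed.

(** For dyadic h the integral of F(x + h e_i) - F(x) is exactly 0, so by Taylor's formula h times
    the integral of the derivative is at most a multiple of h^2. *)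
Lemma intQ_partial C F G i : C11 Q C F G -> (forall x, 1 < `|x| -> F x = 0) ->
  (forall x, 1 < `|x| -> G x = 0) -> intQ (fun x => G x 0 i) = 0.
Proof.
move=> FG F0 G0; have C0 := C11_ge0 FG.
have bF := bnd_C11 FG.
have bG : bnd (fun x => G x 0 i).
  exists C => x xQ; apply: le_trans (coord_le_norm _ i) _; exact: (C11_grad FG).
have bFs j : bnd (fun x => F (x + mesh R j *: evec R i)).
  exists C => x _; have [h|/F0->] := leP `|x + mesh R j *: evec R i| 1.
    by apply: (C11_val FG); apply: le_trans h _; rewrite ler1n.
  by rewrite normr0.
have key j : `|intQ (fun x => G x 0 i)| <= 4 ^+ n * (C * mesh R j).
  have m0 := mesh_gt0 R j; have mj1 : mesh R j <= 1.
    by rewrite /mesh invf_le1 ?ler1n ?ltr0n ?expn_gt0.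
  have : intQ (fun x => mesh R j * G x 0 i - (F (x + mesh R j *: evec R i) - F x)) =
      mesh R j * intQ (fun x => G x 0 i).
    rewrite intQB; [|by bnd_tac..]; rewrite intQB // intQ_shift // subrr subr0.
    by rewrite intQZ.
  move=> E; rewrite -(ler_pM2l m0) -[X in X * `|_|](gtr0_norm m0) -normrM -E.
  rewrite (_ : _ * (4 ^+ n * _) = 4 ^+ n * (C * mesh R j ^+ 2)); last by ring.
  apply: intQ_abs => x xQ.
  have ev : `|mesh R j *: evec R i| <= mesh R j.
    by rewrite normrZ (gtr0_norm m0) ler_piMr ?norm_evec ?mesh_ge0.
  have [xQ'|xQ'] := leP `|x + mesh R j *: evec R i| 2.
    have := C11_taylor FG xQ xQ'.
    have -> : x + mesh R j *: evec R i - x = mesh R j *: evec R i by rewrite addrC addKr.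
    rewrite dotZr dot_evec.
    rewrite distrC => /le_trans h; apply: h.
    by rewrite ler_wpM2l // ler_pXn2r ?nnegrE ?mesh_ge0.
  have x1 : 1 < `|x|.
    have := ler_normD x (mesh R j *: evec R i); lra.
  rewrite G0 // mxE mulr0 !F0 //; last by apply: lt_trans xQ'; rewrite ltr1n.
  by rewrite !subrr normr0 mulr_ge0 // exprn_ge0 // mesh_ge0.
apply/eqP; rewrite -normr_le0; apply/ler_addgt0Pr => e e0; rewrite add0r.
have c4 : 0 < 4 ^+ n * (C + 1) :> R by rewrite mulr_gt0 ?exprn_gt0 // ltr_wpDl.
have [N0 /(_ _ (leqnn _)) hN] := mesh_small (divr_gt0 e0 c4).
apply: le_trans (key N0) _; rewrite mulrA.
move: hN; rewrite (ltr_pdivlMr _ _ c4) => /ltW; apply: le_trans.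
rewrite mulrC ler_wpM2l ?mesh_ge0 // ler_wpM2l ?exprn_ge0 // lerDl //.
Qed.

End Ibp.

(** The square of the positive part is convex with second derivative at most 2; this yields the
    Taylor clause for [phi] across the kink of [hat]. *)
Lemma sq_pos_taylor (R : realType) (s t : R) :
  0 <= Num.max 0 t ^+ 2 - Num.max 0 s ^+ 2 - 2 * Num.max 0 s * (t - s) <= (t - s) ^+ 2.
Proof.
have t2 := sqr_ge0 t; have s2 := sqr_ge0 s; have d2 := sqr_ge0 (t - s).
case: (leP 0 t) => ht; case: (leP 0 s) => hs; rewrite ?expr0n /=.
- by apply/andP; split; nra.
- have := mulr_ge0 ht (ltW (_ : 0 < - s)); rewrite oppr_gt0 => /(_ hs) h.
  by apply/andP; split; nra.
- have := mulr_ge0 hs (ltW (_ : 0 < - t)); rewrite oppr_gt0 => /(_ ht) h.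
  by apply/andP; split; nra.
- by apply/andP; split; nra.
Qed.

(** * The radial cutoff and its gradient *)

Section Cutoff.
Variables (R : realType) (n : nat).
Local Notation T := 'rV[R]_n.
Local Notation Q := (fun x : T => is_true (`|x| <= 2)).
Implicit Types (f v w U : T -> R) (g h G : T -> T).

(** Squaring [hat] makes [phi] of class C^{1,1}. It vanishes outside the Euclidean unit ball, hence
    outside the unit cube, as [intQ_shift] and [intQ_partial] require. *)
Definition hat (x : T) : R := Num.max 0 (1 - dot x x).
Definition phi (x : T) : R := hat x ^+ 2.
Definition psi (x : T) : R := 2 * hat x.
Definition gphi (x : T) : T := (-2 * psi x) *: x.

Lemma hat_ge0 x : 0 <= hat x. Proof. by rewrite le_max lexx. Qed.
Lemma hat_le1 x : hat x <= 1.
Proof. by rewrite ge_max ler01 /= gerBl dotxx_ge0. Qed.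
Lemma psi_ge0 x : 0 <= psi x. Proof. by rewrite mulr_ge0 ?hat_ge0. Qed.
Lemma psi_le2 x : psi x <= 2. Proof. by have := hat_le1 x; rewrite /psi; lra. Qed.
Lemma phi_ge0 x : 0 <= phi x. Proof. by rewrite exprn_ge0 ?hat_ge0. Qed.
Lemma phi_le1 x : phi x <= 1. Proof. by rewrite exprn_ile1 ?hat_ge0 ?hat_le1. Qed.

Lemma hat_out x : 1 < `|x| -> hat x = 0.
Proof.
move=> x1; apply/max_idPl; rewrite subr_le0.
apply: le_trans (norm_sq_le_dot x); rewrite expr2; nra.
Qed.
Lemma phi_out x : 1 < `|x| -> phi x = 0.
Proof. by move=> /hat_out e; rewrite /phi e expr0n. Qed.
Lemma psi_out x : 1 < `|x| -> psi x = 0.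
Proof. by move=> /hat_out e; rewrite /psi e mulr0. Qed.

Lemma bnd_phi : bnd phi.
Proof. by exists 1 => x _; rewrite ger0_norm ?phi_ge0 ?phi_le1. Qed.
Lemma bnd_psi : bnd psi.
Proof. by exists 2 => x _; rewrite ger0_norm ?psi_ge0 ?psi_le2. Qed.

Lemma dotxx_sub (x y : T) : dot y y - dot x x = 2 * dot x (y - x) + dot (y - x) (y - x).
Proof. by rewrite !(dotDl, dotDr, dotNl, dotNr) (dotC y x); ring. Qed.

Lemma hat_lip x y : `|x| <= 2 -> `|y| <= 2 -> `|hat y - hat x| <= 4 * n%:R * `|y - x|.
Proof.
move=> xQ yQ; apply: (@le_trans _ _ `|dot y y - dot x x|).
  rewrite /hat; case: (leP 0 (1 - dot y y)) => hy; case: (leP 0 (1 - dot x x)) => hx;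
    rewrite ler_norml; case: (leP 0 (dot y y - dot x x)) => h;
    rewrite ?(ger0_norm h) ?(ltr0_norm h); apply/andP; split; lra.
rewrite (_ : _ - _ = dot (y + x) (y - x)); last first.
  by rewrite !(dotDl, dotDr, dotNl, dotNr) (dotC y x); ring.
apply: le_trans (dot_abs _ _) _; rewrite mulrA ler_wpM2r //.
rewrite mulrC ler_wpM2r //; apply: le_trans (ler_normD _ _) _; lra.
Qed.

Lemma C11_phi : exists C, C11 Q C phi gphi.
Proof.
have n0 : 0 <= n%:R :> R by [].
exists (16 * (n%:R + 1) ^+ 2 + 8); split.
- by nra.
- move=> x _; rewrite ger0_norm ?phi_ge0 //; have := phi_le1 x; nra.
- move=> x xQ; rewrite normrZ normrM normrN (ger0_norm (psi_ge0 x)) ger0_norm //.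
  have := psi_le2 x; have := psi_ge0 x; have := normr_ge0 x; nra.
- move=> x y xQ yQ; rewrite /phi subr_sqr normrM.
  have := hat_lip xQ yQ; have := hat_le1 x; have := hat_le1 y.
  have := hat_ge0 x; have := hat_ge0 y; have := normr_ge0 (y - x).
  set d := `|y - x|; move=> d0 a1 a2 a3 a4 h; rewrite (@ger0_norm _ (hat y + hat x)); last lra.
  apply: (@le_trans _ _ (4 * n%:R * d * 2)); first by rewrite ler_pM //; lra.
  by rewrite mulrAC ler_wpM2r //; nra.
- move=> x y xQ yQ; rewrite /gphi.
  rewrite (_ : _ - _ = (-2 * psi y) *: (y - x) - (2 * (psi y - psi x)) *: x); last first.
    by apply/rowP => i; rewrite !mxE; ring.
  apply: le_trans (ler_normB _ _) _; rewrite !normrZ /psi -mulrBr !normrM normrN.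
  rewrite !(@ger0_norm _ 2) // (ger0_norm (hat_ge0 y)).
  have := hat_lip xQ yQ; have := hat_le1 y; have := hat_ge0 y.
  set d := `|y - x|; set e := `|hat y - hat x|; move=> a1 a2 a3.
  have d0 : 0 <= d by exact: normr_ge0.
  have e0 : 0 <= e by exact: normr_ge0.
  have h1 : 2 * (2 * hat y) * d <= 4 * d by rewrite ler_wpM2r //; lra.
  have h2 : 2 * (2 * e) * `|x| <= 2 * (2 * (4 * n%:R * d)) * 2.
    by rewrite ler_pM //; lra.
  apply: le_trans (lerD h1 h2) _; rewrite (_ : _ + _ = (4 + 32 * n%:R) * d); last by ring.
  by rewrite ler_wpM2r //; nra.
- move=> x y xQ yQ; rewrite dotZl /phi.
  have E : -2 * psi x * dot x (y - x) =
     2 * hat x * (dot x x - dot y y) + 2 * hat x * dot (y - x) (y - x).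
    by rewrite /psi -(opprB (dot y y)) dotxx_sub; ring.
  rewrite E; have b1 := dotxx_le (y - x); have b2 := dotxx_ge0 (y - x).
  have b3 := hat_lip xQ yQ; have a1 := hat_le1 x; have a2 := hat_ge0 x.
  set d := `|y - x| in b1 b3 *; have d0 : 0 <= d by exact: normr_ge0.
  have b4 : `|hat y ^+ 2 - hat x ^+ 2 - 2 * hat x * (dot x x - dot y y)| <=
     (4 * n%:R * d) ^+ 2.
    have t : (dot y y - dot x x) ^+ 2 <= (4 * n%:R * d) ^+ 2.
      have -> : dot y y - dot x x = dot (y + x) (y - x).
        by rewrite !(dotDl, dotDr, dotNl, dotNr) (dotC y x); ring.
      rewrite -(real_normK (num_real (dot (y + x) (y - x)))) ler_pXn2r ?nnegrE ?mulr_ge0 //.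
      apply: le_trans (dot_abs _ _) _; rewrite mulrA ler_wpM2r //.
      rewrite mulrC ler_wpM2r //; apply: le_trans (ler_normD _ _) _; lra.
    apply: le_trans _ t; have := sq_pos_taylor (1 - dot x x) (1 - dot y y).
    rewrite -/(hat x) -/(hat y) => /andP[t1 t2].
    rewrite ger0_norm; nra.
  rewrite (_ : _ - _ = (hat y ^+ 2 - hat x ^+ 2 - 2 * hat x * (dot x x - dot y y))
    - 2 * hat x * dot (y - x) (y - x)); last by ring.
  apply: le_trans (ler_normB _ _) _.
  rewrite (@ger0_norm _ (2 * hat x * _)); last by rewrite !mulr_ge0.
  have h2 : 2 * hat x * dot (y - x) (y - x) <= 2 * (n%:R * d ^+ 2).
    by rewrite ler_pM //; lra.
  apply: le_trans (lerD b4 h2) _.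
  rewrite (_ : _ + _ = (16 * n%:R ^+ 2 + 2 * n%:R) * d ^+ 2); last by ring.
  by rewrite ler_wpM2r ?exprn_ge0 //; nra.
Qed.

End Cutoff.

(** * The Weiss energy and the Monneau functional *)

Section Energy.
Variables (R : realType) (n : nat).
Local Notation T := 'rV[R]_n.
Local Notation Q := (fun x : T => is_true (`|x| <= 2)).
Implicit Types (f v w U V : T -> R) (g h G : T -> T).

Definition Iphi f := intQ (fun x => phi x * f x).
Definition Ipsi f := intQ (fun x => psi x * f x).

Definition vbnd g := exists C : R, forall x, `|x| <= 2 -> `|g x| <= C.

Lemma bnd_dot g h : vbnd g -> vbnd h -> bnd (fun x => dot (g x) (h x)).
Proof.
move=> [C gC] [D hD]; exists (n%:R * (C * D)) => x xQ.
by apply: dot_le; auto.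
Qed.

Lemma vbnd_id : vbnd (fun x => x). Proof. by exists 2. Qed.

Lemma vbndB g h : vbnd g -> vbnd h -> vbnd (fun x => g x - h x).
Proof.
move=> [C gC] [D hD]; exists (C + D) => x xQ.
by apply: le_trans (ler_normB _ _) _; apply: lerD; auto.
Qed.

Lemma vbnd_C11 C f g : C11 Q C f g -> vbnd g.
Proof. by move=> fg; exists C => x xQ; exact: (C11_grad fg). Qed.

Lemma bndphi f : bnd f -> bnd (fun x => phi x * f x).
Proof. by move=> bf; apply: bndM => //; exact: bnd_phi. Qed.

Lemma bndpsi f : bnd f -> bnd (fun x => psi x * f x).
Proof. by move=> bf; apply: bndM => //; exact: bnd_psi. Qed.

Lemma Ipsi_ext f f' : (forall x, `|x| <= 2 -> psi x != 0 -> f x = f' x) -> Ipsi f = Ipsi f'.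
Proof.
move=> ff; apply: intQ_ext => x xQ; have [->|px] := eqVneq (psi x) 0.
  by rewrite !mul0r.
by rewrite ff.
Qed.

Lemma Iphi_ext f f' : (forall x, `|x| <= 2 -> f x = f' x) -> Iphi f = Iphi f'.
Proof. by move=> ff; apply: intQ_ext => x xQ; rewrite ff. Qed.

Lemma IpsiD f f' : bnd f -> bnd f' -> Ipsi (fun x => f x + f' x) = Ipsi f + Ipsi f'.
Proof.
move=> bf bf'; rewrite /Ipsi -intQD; [|exact: bndpsi..].
by apply: intQ_ext => x _; rewrite mulrDr.
Qed.

Lemma IpsiZ (c : R) f : bnd f -> Ipsi (fun x => c * f x) = c * Ipsi f.
Proof.
move=> bf; rewrite /Ipsi -intQZ; last exact: bndpsi.
by apply: intQ_ext => x _; rewrite mulrCA.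
Qed.

Lemma IphiD f f' : bnd f -> bnd f' -> Iphi (fun x => f x + f' x) = Iphi f + Iphi f'.
Proof.
move=> bf bf'; rewrite /Iphi -intQD; [|exact: bndphi..].
by apply: intQ_ext => x _; rewrite mulrDr.
Qed.

Lemma IphiZ (c : R) f : bnd f -> Iphi (fun x => c * f x) = c * Iphi f.
Proof.
move=> bf; rewrite /Iphi -intQZ; last exact: bndphi.
by apply: intQ_ext => x _; rewrite mulrCA.
Qed.

Lemma Iphi_ge0 f : bnd f -> (forall x, `|x| <= 2 -> 0 <= f x) -> 0 <= Iphi f.
Proof.
move=> bf f0; apply: intQ_ge0; first exact: bndphi.
by move=> x xQ; rewrite mulr_ge0 ?phi_ge0 ?f0.
Qed.

Lemma Ipsi_ge0 f : bnd f -> (forall x, `|x| <= 2 -> 0 <= f x) -> 0 <= Ipsi f.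
Proof.
move=> bf f0; apply: intQ_ge0; first exact: bndpsi.
by move=> x xQ; rewrite mulr_ge0 ?psi_ge0 ?f0.
Qed.

Lemma Ipsi_le f f' : bnd f -> bnd f' -> (forall x, `|x| <= 1 -> f x <= f' x) ->
  Ipsi f <= Ipsi f'.
Proof.
move=> bf bf' ff; apply: intQ_le; [exact: bndpsi..|].
move=> x xQ; have [x1|/psi_out->] := leP `|x| 1; last by rewrite !mul0r.
by rewrite ler_wpM2l ?psi_ge0 ?ff.
Qed.

Lemma Ipsi_abs f (C : R) : (forall x, `|x| <= 1 -> `|f x| <= C) ->
  `|Ipsi f| <= 4 ^+ n * (2 * C).
Proof.
move=> fC; have C0 : 0 <= C by apply: le_trans (fC 0 _); rewrite ?normr0.
apply: intQ_abs => x xQ; have [x1|/psi_out->] := leP `|x| 1; last first.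
  by rewrite mul0r normr0 mulr_ge0.
by rewrite normrM (ger0_norm (psi_ge0 x)) ler_pM ?psi_ge0 ?psi_le2 ?fC.
Qed.

Lemma Iphi_abs f (C : R) : (forall x, `|x| <= 1 -> `|f x| <= C) ->
  `|Iphi f| <= 4 ^+ n * C.
Proof.
move=> fC; have C0 : 0 <= C by apply: le_trans (fC 0 _); rewrite ?normr0.
apply: intQ_abs => x xQ; have [x1|/phi_out->] := leP `|x| 1; last first.
  by rewrite mul0r normr0.
by rewrite normrM (ger0_norm (phi_ge0 x)) -[leRHS]mul1r ler_pM ?phi_ge0 ?phi_le1 ?fC.
Qed.

(* The weak form of the integral of [g . grad (f phi)], since [grad phi = - 2 psi x]. *)
Definition weak_pair g f h :=
  Iphi (fun x => dot (g x) (h x)) - 2 * Ipsi (fun x => f x * dot (g x) x).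

(* With [gphi = - 2 psi x], the term with [v ^ 2] plays the role of the boundary term of
   Weiss' energy, smoothed over the spheres of radius at most 1. *)
Definition weiss v g :=
  Iphi (fun x => dot (g x) (g x)) + 2 * Iphi v - 4 * Ipsi (fun x => v x ^+ 2).

(* [sol_sup] is the weak form of [Laplacian v <= 1] and [sol_eq] that of
   [v Laplacian v = v]; both hold for solutions of the obstacle problem, and
   they are stable under uniform limits. *)
Record obstacle_sol v g : Prop := MkSol {
  sol_C11 : exists C, C11 Q C v g;
  sol_ge0 : forall x, `|x| <= 2 -> 0 <= v x;
  sol_quad : exists D : R, forall x, `|x| <= 2 -> `|v x| <= D * `|x| ^+ 2;
  sol_sup : forall C f h, C11 Q C f h -> (forall x, `|x| <= 2 -> 0 <= f x) ->
    - Iphi f <= weak_pair g f h;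
  sol_eq : weak_pair g v g = - Iphi v }.

(* Models of blow-ups at singular points: nonnegative solutions of [Laplacian U = 1],
   homogeneous of degree 2 on the unit ball. *)
Record homog_sol U G : Prop := MkHomog {
  homog_C11 : exists C, C11 Q C U G;
  homog_ge0 : forall x, `|x| <= 2 -> 0 <= U x;
  homog_quad : exists D : R, forall x, `|x| <= 2 -> `|U x| <= D * `|x| ^+ 2;
  homog_euler : forall x, `|x| <= 2 -> psi x != 0 -> dot (G x) x = 2 * U x;
  homog_weak : forall C D f h, C11 Q C f h ->
    (forall x, `|x| <= 2 -> `|f x| <= D * `|x| ^+ 2) -> weak_pair G f h = - Iphi f }.

Ltac bt := repeat first
  [ assumption | apply: bndC | apply: bndB | apply: bndN | apply: bndD
  | apply: bndM | apply: bndX | apply: bnd_dot | apply: vbndB | apply: vbnd_id ].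

(** Expand the nonnegative integral of phi |h - g|^2, then test Laplacian v <= 1 with w >= 0 and use
    v Laplacian v = v. The quadratic terms with weight [psi] come from w^2 - v^2 = 2 v (w - v) + (w
    - v)^2. *)
Lemma weiss_step v g w h : obstacle_sol v g -> obstacle_sol w h ->
  4 * Ipsi (fun x => (w x - v x) * (dot (g x) x - 2 * v x))
    - 4 * Ipsi (fun x => (w x - v x) ^+ 2) <= weiss w h - weiss v g.
Proof.
move=> vs ws; have [Cv vC] := sol_C11 vs; have [Cw wC] := sol_C11 ws.
have bv := bnd_C11 vC; have bw := bnd_C11 wC.
have bg := vbnd_C11 vC; have bh := vbnd_C11 wC.
have h1 : 0 <= Iphi (fun x => dot (h x) (h x)) + (-2) * Iphi (fun x => dot (g x) (h x))
   + Iphi (fun x => dot (g x) (g x)).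
  rewrite -IphiZ; [|by bt]. rewrite -!IphiD; [|by bt..].
  apply: Iphi_ge0 => [|x xQ]; first by bt.
  have := dotxx_ge0 (h x - g x).
  by rewrite !(dotDl, dotDr, dotNl, dotNr) (dotC (h x) (g x)); lra.
have h2 := sol_sup vs wC (sol_ge0 ws); have h3 := sol_eq vs.
rewrite /weak_pair in h2 h3; rewrite /weiss.
have -> : Ipsi (fun x => (w x - v x) * (dot (g x) x - 2 * v x)) =
   Ipsi (fun x => w x * dot (g x) x) + (-1) * Ipsi (fun x => v x * dot (g x) x)
   + (-2) * Ipsi (fun x => w x * v x) + 2 * Ipsi (fun x => v x ^+ 2).
  rewrite -!IpsiZ; [|by bt..]. rewrite -!IpsiD; [|by bt..].
  by apply: Ipsi_ext => x _ _; ring.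
have -> : Ipsi (fun x => (w x - v x) ^+ 2) = Ipsi (fun x => w x ^+ 2)
   + (-2) * Ipsi (fun x => w x * v x) + Ipsi (fun x => v x ^+ 2).
  rewrite -!IpsiZ; [|by bt..]. rewrite -!IpsiD; [|by bt..].
  by apply: Ipsi_ext => x _ _; ring.
lra.
Qed.

Lemma homog_Iphi_pair U G V H : homog_sol U G -> homog_sol V H ->
  Iphi (fun x => dot (G x) (H x)) = 4 * Ipsi (fun x => U x * V x) - Iphi V.
Proof.
move=> Us Vs; have [CU UC] := homog_C11 Us; have [CV VC] := homog_C11 Vs.
have bU := bnd_C11 UC; have bV := bnd_C11 VC.
have [D VD] := homog_quad Vs; have := homog_weak Us VC VD; rewrite /weak_pair.
rewrite (_ : Ipsi (fun x => V x * dot (G x) x) = 2 * Ipsi (fun x => U x * V x)).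
  by lra.
rewrite -IpsiZ; last by bt.
by apply: Ipsi_ext => x xQ px; rewrite (homog_euler Us) //; ring.
Qed.

(** In [homog_Iphi_pair] everything but the last term is symmetric in U and V. This is why all
    blow-ups at singular points share one energy level. *)
Lemma homog_Iphi_eq U G V H : homog_sol U G -> homog_sol V H -> Iphi U = Iphi V.
Proof.
move=> Us Vs; have := homog_Iphi_pair Us Vs; have := homog_Iphi_pair Vs Us.
rewrite (_ : Iphi (fun x => dot (H x) (G x)) = Iphi (fun x => dot (G x) (H x))).
  rewrite (_ : Ipsi (fun x => V x * U x) = Ipsi (fun x => U x * V x)); first by lra.
  by apply: Ipsi_ext => x _ _; rewrite mulrC.
by apply: Iphi_ext => x _; rewrite dotC.
Qed.

Lemma homog_weiss U G : homog_sol U G -> weiss U G = Iphi U.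
Proof.
move=> Us; rewrite /weiss (homog_Iphi_pair Us Us).
rewrite (_ : Ipsi (fun x => U x * U x) = Ipsi (fun x => U x ^+ 2)); first by lra.
by apply: Ipsi_ext => x _ _; rewrite expr2.
Qed.

(** When v is the rescaling at scale r, [dot (g x) x - 2 * v x] is r times its derivative in r, so
    the right side is r times the derivative of Monneau's functional; it is bounded below by the
    energy excess. Three tests give this: v against itself, Laplacian v <= 1 against U, and
    Laplacian U = 1 against v. *)
Lemma monneau_deriv v g U G : obstacle_sol v g -> homog_sol U G ->
  weiss v g - weiss U G <=
    2 * Ipsi (fun x => (v x - U x) * (dot (g x) x - 2 * v x)).
Proof.
move=> vs Us; have [Cv vC] := sol_C11 vs; have [CU UC] := homog_C11 Us.
have bv := bnd_C11 vC; have bU := bnd_C11 UC.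
have bg := vbnd_C11 vC; have bG := vbnd_C11 UC.
have h1 := sol_eq vs; have h2 := sol_sup vs UC (homog_ge0 Us).
have [D vD] := sol_quad vs; have h3 := homog_weak Us vC vD.
rewrite /weak_pair in h1 h2 h3; rewrite (homog_weiss Us) /weiss.
have e1 : Ipsi (fun x => v x * dot (G x) x) = 2 * Ipsi (fun x => v x * U x).
  rewrite -IpsiZ; last by bt.
  by apply: Ipsi_ext => x xQ px; rewrite (homog_euler Us) //; ring.
rewrite e1 (_ : Iphi (fun x => dot (G x) (g x)) = Iphi (fun x => dot (g x) (G x))) in h3; last first.
  by apply: Iphi_ext => x _; rewrite dotC.
have -> : Ipsi (fun x => (v x - U x) * (dot (g x) x - 2 * v x)) =
   Ipsi (fun x => v x * dot (g x) x) + (-1) * Ipsi (fun x => U x * dot (g x) x)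
   + (-2) * Ipsi (fun x => v x ^+ 2) + 2 * Ipsi (fun x => v x * U x).
  rewrite -!IpsiZ; [|by bt..]. rewrite -!IpsiD; [|by bt..].
  by apply: Ipsi_ext => x _ _; ring.
lra.
Qed.

End Energy.

Lemma sum_ord_le (R : realType) n (F : 'I_n -> R) (c : R) : (forall i, F i <= c) ->
  \sum_(i < n) F i <= n%:R * c.
Proof.
move=> Fc; apply: (@le_trans _ _ (\sum_(i < n) c)); first exact: ler_sum.
by rewrite sumr_const card_ord -(mulr_natl c).
Qed.

Lemma cvg_fin_sum (R : realType) (J : Type) (s : seq J) (F : J -> nat -> R) (l : J -> R) :
  (forall j, F j @ \oo --> l j) ->
  (fun k => \sum_(j <- s) F j k) @ \oo --> \sum_(j <- s) l j.
Proof.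
move=> Fl; elim: s => [|j s IH].
  rewrite big_nil; under eq_fun do rewrite big_nil; exact: cvg_cst.
by rewrite big_cons; under eq_fun do rewrite big_cons; apply: cvgD.
Qed.

(** * The polynomials of P as homogeneous solutions *)

Section Quadratic.
Variables (R : realType) (n : nat).
Local Notation T := 'rV[R]_n.
Local Notation Q := (fun x : T => is_true (`|x| <= 2)).
Implicit Types A : 'M[R]_n.

Lemma pA_dot A x : pA A x = 2^-1 * dot (x *m A) x.
Proof.
by rewrite /pA [X in _ * X]mxE; congr (_ * _); apply: eq_bigr => i _; rewrite [x^T _ _]mxE.
Qed.

Lemma dot_mulmx_sym A (x y : T) : A^T = A -> dot (x *m A) y = dot (y *m A) x.
Proof.
move=> As; rewrite /dot.
under eq_bigr => i _ do rewrite mxE mulr_suml.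
rewrite exchange_big; apply: eq_bigr => j _ /=; rewrite mxE mulr_suml.
by apply: eq_bigr => i _; rewrite -[in RHS]As mxE; ring.
Qed.

(** The constant depends on [A] only through its norm, so by [Pmat_norm] one constant serves all of
    P. *)
Lemma C11_pA_norm A : A^T = A ->
  C11 Q (2 * (n%:R * `|A| + n%:R * (n%:R * `|A|))) (pA A) (fun x => x *m A).
Proof.
move=> As; pose a := n%:R * `|A|; pose b := n%:R * a; rewrite -/a -/b.
have a0 : 0 <= a by rewrite mulr_ge0.
have b0 : 0 <= b by rewrite mulr_ge0.
have mA (x : T) : `|x *m A| <= a * `|x|.
  by apply: le_trans (mulmx_norm _ _) _; rewrite /a mulrAC mulrA.
have E x y : pA A y - pA A x - dot (x *m A) (y - x) = 2^-1 * dot ((y - x) *m A) (y - x).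
  rewrite !pA_dot mulmxBl !(dotDl, dotDr, dotNl, dotNr) (dot_mulmx_sym y x As); lra.
have E2 x y : pA A y - pA A x = 2^-1 * dot ((y - x) *m A) (y + x).
  rewrite !pA_dot mulmxBl !(dotDl, dotDr, dotNl, dotNr) (dot_mulmx_sym y x As); lra.
have dA (x y : T) : `|dot (x *m A) y| <= b * (`|x| * `|y|).
  apply: le_trans (dot_abs _ _) _; rewrite /b -mulrA ler_wpM2l // mulrA ler_wpM2r //.
split.
- lra.
- move=> x xQ; rewrite pA_dot normrM ger0_norm //.
  have := dA x x; have : `|x| * `|x| <= 2 * 2 by rewrite ler_pM.
  have := normr_ge0 x; nra.
- move=> x xQ; apply: le_trans (mA x) _; have := normr_ge0 x; nra.
- move=> x y xQ yQ; rewrite E2 normrM ger0_norm //.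
  have h : `|y + x| <= 4 by apply: le_trans (ler_normD _ _) _; lra.
  have := dA (y - x) (y + x); have := normr_ge0 (y - x); set d := `|y - x| => d0.
  have : d * `|y + x| <= d * 4 by rewrite ler_wpM2l.
  nra.
- move=> x y _ _; rewrite -mulmxBl; apply: le_trans (mA _) _.
  by rewrite ler_wpM2r //; lra.
- move=> x y _ _; rewrite E normrM ger0_norm //.
  have := dA (y - x) (y - x); rewrite -expr2; have := sqr_ge0 `|y - x|; nra.
Qed.

Lemma C11_pA A : A^T = A -> exists C, C11 Q C (pA A) (fun x => x *m A).
Proof. by move=> As; eexists; exact: C11_pA_norm. Qed.

Lemma pA_homog A : Pmat A -> homog_sol (pA A) (fun x => x *m A).
Proof.
move=> [As [Apos Atr]]; have [C AC] := C11_pA As; split; first by exists C.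
- by move=> x _; rewrite /pA mulr_ge0.
- exists (2^-1 * (n%:R * (n%:R * `|A|))) => x _; rewrite pA_dot normrM ger0_norm // -mulrA.
  rewrite ler_wpM2l //; apply: le_trans (dot_abs _ _) _; rewrite -!mulrA ler_wpM2l //.
  have := mulmx_norm x A; have := normr_ge0 x; set d := `|x| => d0 h.
  apply: le_trans (ler_wpM2r d0 h) _; rewrite le_eqVlt; apply/orP; left; apply/eqP; ring.
- by move=> x _ _; rewrite pA_dot; lra.
move=> Cf D f h fC _; have [Cp pC] := @C11_phi R n.
have fpC := C11M fC pC.
(* The integrand is the i-th partial derivative of [f phi] times the i-th coordinate of [x *m A].
   Summed over i this is the divergence of the field [f phi (x *m A)], in which the trace of [A] is
   1. *)
have key i : intQ (fun x => ((f x * phi x) *: (col i A)^T + (dot (col i A)^T x + 0) *: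
     (f x *: gphi x + phi x *: h x)) 0 i) = 0.
  apply: intQ_partial (C11M fpC (C11_affine (col i A)^T 0 (_ : 0 <= 2) _)) _ _ => //.
  - by move=> x /phi_out->; rewrite mulr0 mul0r.
  - move=> x x1; rewrite phi_out // mulr0 scale0r add0r /gphi psi_out //.
    by rewrite !(mulr0, scale0r, scaler0, addr0).
have : \sum_i intQ (fun x => ((f x * phi x) *: (col i A)^T + (dot (col i A)^T x + 0) *:
     (f x *: gphi x + phi x *: h x)) 0 i) = 0 by rewrite big1.
have bf := bnd_C11 fC; have bp := @bnd_phi R n; have bs := @bnd_psi R n.
have vh := vbnd_C11 fC; have vid := @vbnd_id R n; have vA := vbnd_C11 AC.
have vgp := vbnd_C11 pC.
have bco (g : T -> T) i : vbnd g -> bnd (fun x => g x 0 i).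
  by case=> E gE; exists E => x /gE; apply: le_trans; exact: coord_le_norm.
have bx i : bnd (fun x : T => x 0 i) := bco _ i vid.
have bh i : bnd (fun x : T => h x 0 i) := bco _ i vh.
rewrite -intQ_sum; last first.
  move=> i; under eq_fun do rewrite !mxE addr0.
  apply: bndD; first by apply: bndM; [apply: bndM | apply: bndC].
  apply: bndM; last by repeat (first [assumption|apply: bndC|apply: bndD|apply: bndM|apply: bx|apply: bh]).
  by apply: bnd_dot => //; exists `|(col i A)^T|.
rewrite (_ : intQ _ = Iphi f + weak_pair (fun x => x *m A) f h); first by lra.
rewrite /weak_pair -mulN1r; have -> : -1 * (2 * Ipsi (fun x => f x * dot (x *m A) x)) =
    (-2) * Ipsi (fun x => f x * dot (x *m A) x) by ring.
rewrite /Iphi /Ipsi -intQZ; last by apply: bndM => //; apply: bndM => //; apply: bnd_dot.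
rewrite -!intQD; last first.
all: try by repeat (first [assumption | apply: bndC | apply: bndD | apply: bndM | apply: bnd_dot]).
apply: intQ_ext => x _.
have E i : ((f x * phi x) *: (col i A)^T + (dot (col i A)^T x + 0) *:
     (f x *: gphi x + phi x *: h x)) 0 i =
   (f x * phi x) * A i i + (x *m A) 0 i * (f x * (-2 * psi x) * x 0 i + phi x * h x 0 i).
  rewrite !mxE addr0; congr (_ + _ * _); last by ring.
  by apply: eq_bigr => j _; rewrite !mxE mulrC.
under eq_bigr do rewrite E.
rewrite big_split -mulr_sumr /= -[\sum_i A i i]/(\tr A) Atr mulr1 mulrC; congr (_ + _).
rewrite /dot !mulr_sumr -big_split; apply: eq_bigr => i _ /=; ring.
Qed.

End Quadratic.

(** * From the almost everywhere equation to its weak form *)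

Section WeakForm.
Variables (R : realType) (n : nat).
Local Notation T := 'rV[R]_n.
Local Notation Q := (fun x : T => is_true (`|x| <= 2)).

Definition diff_quot (g : T -> T) k (x : T) : R :=
  \sum_(i < n) (g (x + mesh R k *: evec R i) 0 i - g x 0 i) / mesh R k.

Lemma mesh_le1 k : mesh R k <= 1.
Proof. by rewrite /mesh invf_le1 ?ler1n ?ltr0n ?expn_gt0. Qed.

Lemma norm_mesh_evec k (i : 'I_n) : `|mesh R k *: evec R i| <= mesh R k.
Proof.
by rewrite normrZ (gtr0_norm (mesh_gt0 R k)) ler_piMr ?norm_evec ?mesh_ge0.
Qed.

(** Summation by parts is exact for dyadic steps and moves the difference from g to z. Replacing the
    difference of z by its derivative and the shifted g by g costs one factor of the mesh. *)
Lemma diff_quot_weak C (v : T -> R) (g : T -> T) D (z : T -> R) (h : T -> T) k :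
  C11 Q C v g -> (forall x, `|g x| <= C) -> C11 Q D z h ->
  (forall x, 1 < `|x| -> z x = 0) -> (forall x, 1 < `|x| -> h x = 0) ->
  `|intQ (fun x => diff_quot g k x * z x) + intQ (fun x => dot (g x) (h x))|
    <= 4 ^+ n * (n%:R * (2 * C * D) * mesh R k).
Proof.
move=> vC gC zD z0 h0; set m := mesh R k; have m0 : 0 < m := mesh_gt0 R k.
have C0 := C11_ge0 vC; have D0 := C11_ge0 zD.
have bz := bnd_C11 zD; have vh := vbnd_C11 zD; have vg : vbnd g by exists C.
have bz' i : bnd (fun x => z (x + m *: evec R i)).
  exists D => x _; have [x1|/z0->] := leP `|x + m *: evec R i| 1; last by rewrite normr0.
  by apply: (C11_val zD); apply: le_trans x1 _; rewrite ler1n.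
have bg i : bnd (fun x => g x 0 i).
  by exists C => x _; apply: le_trans (coord_le_norm _ i) _.
have bg' i : bnd (fun x => g (x + m *: evec R i) 0 i).
  by exists C => x _; apply: le_trans (coord_le_norm _ i) _.
have bh i : bnd (fun x => h x 0 i).
  by exists D => x xQ; apply: le_trans (coord_le_norm _ i) _; exact: (C11_grad zD).
pose r i x := m^-1 * (g (x + m *: evec R i) 0 i * (z (x + m *: evec R i) - z x)).
have br i : bnd (r i) by rewrite /r; repeat (first [assumption|apply: bg'|apply: bz'|apply: bndC|apply: bndB|apply: bndM]).
have E1 i : intQ (fun x => (g (x + m *: evec R i) 0 i - g x 0 i) / m * z x) = - intQ (r i).
  have S := @intQ_shift R n (fun x => g x 0 i * z x) k i (bndM (bg i) bz).
  have {}S : intQ (fun x => g (x + m *: evec R i) 0 i * z (x + m *: evec R i))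
     = intQ (fun x => g x 0 i * z x) by apply: S => x /z0->; rewrite mulr0.
  have b1 : bnd (fun x => g (x + m *: evec R i) 0 i * z (x + m *: evec R i)) by apply: bndM.
  have b2 : bnd (fun x => g x 0 i * z x) by apply: bndM.
  apply/eqP; rewrite -subr_eq0 opprK -intQD //; last first.
    by apply: bndM => //; apply: bndM; [apply: bndB|apply: bndC].
  apply/eqP; rewrite (_ : intQ _ = m^-1 * (intQ (fun x => g (x + m *: evec R i) 0 i * z (x + m *: evec R i)) - intQ (fun x => g x 0 i * z x))).
    by rewrite S subrr mulr0.
  rewrite -intQB // -intQZ; last by apply: bndB.
  by apply: intQ_ext => x _; rewrite /r; ring.
have E2 : intQ (fun x => diff_quot g k x * z x) = - \sum_i intQ (r i).
  rewrite -sumrN (eq_bigr _ (fun i _ => esym (E1 i))) -intQ_sum.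
    by apply: intQ_ext => x _; rewrite /diff_quot mulr_suml.
  by move=> i; apply: bndM => //; apply: bndM; [apply: bndB|apply: bndC].
rewrite E2 -intQ_sum // addrC -intQB; [|exact: bnd_dot|exact: bnd_sum].
apply: intQ_abs => x xQ; rewrite /dot -sumrB; apply: le_trans (ler_norm_sum _ _ _) _.
rewrite -mulrA; apply: sum_ord_le => i; rewrite /r.
have ev := norm_mesh_evec k i; rewrite -/m in ev.
have [xQ'|xQ'] := leP `|x + m *: evec R i| 2; last first.
  have x1 : 1 < `|x|.
    by have := ler_normD x (m *: evec R i); have := mesh_le1 k; rewrite -/m; lra.
  rewrite h0 // mxE z0; last by apply: lt_trans xQ'; rewrite ltr1n.
  by rewrite z0 // subrr !mulr0 subrr normr0 !mulr_ge0 // ltW.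
have := C11_taylor zD xQ xQ'; have := C11_glip vC xQ xQ'.
have -> : x + m *: evec R i - x = m *: evec R i by rewrite addrC addKr.
rewrite dotZr dot_evec => a1 a2.
set X := g (x + _) 0 i; set Y := z (x + _) - z x.
have b1 : `|X - g x 0 i| <= C * m.
  apply: le_trans (le_trans a1 _); last by rewrite ler_wpM2l.
  by apply: le_trans (coord_le_norm _ i); rewrite !mxE.
have b2 : `|Y - m * h x 0 i| <= D * m ^+ 2.
  by apply: le_trans a2 _; rewrite ler_wpM2l // ler_pXn2r ?nnegrE // ltW.
have b3 : `|X| <= C by apply: le_trans (coord_le_norm _ i) _.
have b4 : `|h x 0 i| <= D by apply: le_trans (coord_le_norm _ i) _; exact: (C11_grad zD).
rewrite (_ : _ - _ = - (X - g x 0 i) * h x 0 i - m^-1 * (X * (Y - m * h x 0 i))); last first.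
  by field; rewrite gt_eqF.
apply: le_trans (ler_normB _ _) _; rewrite !normrM normrN normfV (gtr0_norm m0).
have c1 : `|X - g x 0 i| * `|h x 0 i| <= C * m * D by rewrite ler_pM.
have c2 : m^-1 * (`|X| * `|Y - m * h x 0 i|) <= m^-1 * (C * (D * m ^+ 2)).
  by rewrite ler_wpM2l ?invr_ge0 ?(ltW m0) // ler_pM.
apply: le_trans (lerD c1 c2) _; rewrite le_eqVlt; apply/orP; left; apply/eqP.
by field; rewrite gt_eqF.
Qed.

Definition ae_laplacian (v : T -> R) (g : T -> T) (N : set T) (l : T -> R) :=
  forall x, `|x| <= 1 -> ~ N x -> exists d : 'I_n -> R,
    (forall i, (fun k => (g (x + mesh R k *: evec R i) 0 i - g x 0 i) / mesh R k)
       @ \oo --> d i) /\ \sum_i d i = l x.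

(** The sign [s] treats both inequalities at once. The positive part of [s * (diff_quot g k x - 1)]
    times z tends to 0 off [N]; bounded convergence makes its integral small for some k, and
    [diff_quot_weak] turns that into the weak inequality. *)
Lemma ae_weak_ineq C (v : T -> R) (g : T -> T) D (z : T -> R) (h : T -> T) N l (s : R) :
  `|s| = 1 -> C11 Q C v g -> (forall x, `|g x| <= C) -> C11 Q D z h ->
  (forall x, 1 < `|x| -> z x = 0) -> (forall x, 1 < `|x| -> h x = 0) ->
  (forall x, `|x| <= 2 -> 0 <= z x) -> lebesgue_null N -> ae_laplacian v g N l ->
  (forall x, `|x| <= 1 -> z x != 0 -> s * (l x - 1) <= 0) ->
  s * (- intQ (fun x => dot (g x) (h x)) - intQ z) <= 0.
Proof.
move=> s1 vC gC zD z0 h0 zge N0 lap sgn.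
have C0 := C11_ge0 vC; have D0 := C11_ge0 zD.
have bz := bnd_C11 zD.
pose nC := n%:R * C; have nC0 : 0 <= nC by rewrite mulr_ge0.
have x12 x : `|x| <= 1 -> `|x : T| <= 2 by move/le_trans; apply; rewrite ler1n.
have K x k (i : 'I_n) : `|x| <= 1 -> `|x + mesh R k *: evec R i| <= 2.
  move=> x1; apply: le_trans (ler_normD _ _) _.
  by have := norm_mesh_evec k i; have := mesh_le1 k; lra.
have dqb k x : `|x| <= 1 -> `|diff_quot g k x| <= nC.
  move=> x1; apply: le_trans (ler_norm_sum _ _ _) _; apply: sum_ord_le => i.
  rewrite normrM normfV (gtr0_norm (mesh_gt0 R k)) ler_pdivrMr ?mesh_gt0 //.
  have := C11_glip vC (x12 _ x1) (K _ k i x1).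
  have -> : x + mesh R k *: evec R i - x = mesh R k *: evec R i by rewrite addrC addKr.
  move=> a1; apply: le_trans (le_trans a1 _); last by rewrite ler_wpM2l ?norm_mesh_evec.
  by apply: le_trans (coord_le_norm _ i); rewrite !mxE.
pose F k x := Num.max 0 (s * (diff_quot g k x - 1)) * z x.
have Fb k x : `|x| <= 1 -> 0 <= F k x <= (nC + 1) * D.
  move=> x1; rewrite /F mulr_ge0 ?le_max ?lexx ?zge ?x12 //=.
  apply: ler_pM; rewrite ?le_max ?lexx ?zge ?x12 //; last first.
    by apply: le_trans (ler_norm _) _; apply: (C11_val zD); exact: x12.
  rewrite ge_max addr_ge0 //=; apply: le_trans (ler_norm _) _.
  rewrite normrM s1 mul1r; apply: le_trans (ler_normB _ _) _.
  by rewrite normr1 lerD2r dqb.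
have F0 k x : 1 < `|x| -> F k x = 0 by move=> /z0 e; rewrite /F e mulr0.
have maxlip (a b : R) : `|Num.max 0 a - Num.max 0 b| <= `|a - b|.
  case: (leP 0 a) => ha; case: (leP 0 b) => hb; rewrite ?subrr ?normr0 //.
  - by rewrite subr0 !ger0_norm //; lra.
  - by rewrite sub0r normrN (ger0_norm hb) ltr0_norm; lra.
have Flip k : exists L : R, forall x y, `|x| <= 1 -> `|y| <= 1 ->
    `|F k x - F k y| <= L * `|x - y|.
  exists (n%:R * (2 * C / mesh R k) * D + (nC + 1) * D) => x y x1 y1.
  have dql : `|diff_quot g k x - diff_quot g k y| <= n%:R * (2 * C / mesh R k) * `|x - y|.
    rewrite /diff_quot -sumrB; apply: le_trans (ler_norm_sum _ _ _) _.
    rewrite -mulrA; apply: sum_ord_le => i; rewrite -mulrBl normrM normfV.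
    rewrite (gtr0_norm (mesh_gt0 R k)) [leRHS]mulrAC ler_wpM2r ?invr_ge0 ?mesh_ge0 //.
    have a1 := C11_glip vC (K _ k i y1) (K _ k i x1).
    have a2 := C11_glip vC (x12 _ y1) (x12 _ x1).
    rewrite (_ : x + _ - (y + _) = x - y) in a1; last first.
      by rewrite opprD addrACA subrr addr0.
    rewrite (_ : _ - _ = (g (x + mesh R k *: evec R i) - g (y + mesh R k *: evec R i)) 0 i
       - (g x - g y) 0 i); last by rewrite !mxE; ring.
    apply: le_trans (ler_normB _ _) _.
    apply: le_trans (lerD (le_trans (coord_le_norm _ i) a1) (le_trans (coord_le_norm _ i) a2)) _.
    by rewrite -mulrDl ler_wpM2r //; lra.
  rewrite /F; set a := Num.max 0 _; set b := Num.max 0 _.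
  have ab : `|a - b| <= n%:R * (2 * C / mesh R k) * `|x - y|.
    apply: le_trans (maxlip _ _) _; rewrite -mulrBr normrM s1 mul1r.
    by rewrite opprB addrA subrK.
  have bb : `|b| <= nC + 1.
    rewrite ger0_norm ?le_max ?lexx // ge_max addr_ge0 //=; apply: le_trans (ler_norm _) _.
    rewrite normrM s1 mul1r; apply: le_trans (ler_normB _ _) _.
    by rewrite normr1 lerD2r dqb.
  rewrite (_ : _ - _ = (a - b) * z x + b * (z x - z y)); last by ring.
  rewrite [leRHS]mulrDl; apply: le_trans (ler_normD _ _) _; rewrite !normrM; apply: lerD.
    by rewrite mulrAC ler_pM //; apply: (C11_val zD); exact: x12.
  rewrite -mulrA ler_pM //; exact: (C11_lip zD (x12 _ y1) (x12 _ x1)).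
have Fcv x : `|x| <= 1 -> ~ N x -> forall e : R, 0 < e ->
    exists K, forall k, (K <= k)%N -> F k x <= e.
  move=> x1 Nx e e0; have [zx|zx] := eqVneq (z x) 0.
    by exists 0%N => k _; rewrite /F zx mulr0 ltW.
  have [d [dcv dl]] := lap x x1 Nx; have sg := sgn x x1 zx.
  have qcv : (fun k => diff_quot g k x) @ \oo --> l x.
    by rewrite -dl; apply: cvg_fin_sum => i; exact: dcv.
  have zp : 0 < z x by rewrite lt_neqAle eq_sym zx zge ?x12.
  have [M _ hM] := (cvgrPdist_lt _ _).1 qcv _ (divr_gt0 e0 zp).
  exists M => k Mk; rewrite /F -ler_pdivlMr // ge_max (ltW (divr_gt0 e0 zp)) /=.
  have := hM k Mk; rewrite /= => h1.
  rewrite (_ : s * _ = s * (l x - 1) + s * (diff_quot g k x - l x)); last by ring.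
  rewrite -[leRHS]add0r; apply: lerD => //; apply: le_trans (ler_norm _) _.
  by rewrite normrM s1 mul1r distrC ltW.
have bdq k : bnd (fun x => diff_quot g k x * z x).
  exists (nC * D) => x xQ; have [x1|/z0->] := leP `|x| 1; last first.
    by rewrite mulr0 normr0 mulr_ge0.
  by rewrite normrM ler_pM ?dqb //; apply: (C11_val zD).
have bF k : bnd (F k).
  exists ((nC + 1) * D) => x xQ; have [x1|/F0->] := leP `|x| 1; last first.
    by rewrite normr0 mulr_ge0 // addr_ge0.
  by have /andP[f0 f1] := Fb k x x1; rewrite ger0_norm.
apply/ler_addgt0Pr => e e0; rewrite add0r.
have c0 : 0 < 4 ^+ n * (n%:R * (2 * C * D) + 1) :> R.
  by rewrite mulr_gt0 ?exprn_gt0 // ltr_wpDl // !mulr_ge0.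
have e2 : 0 < e / 2 by rewrite divr_gt0.
have [k0 hk0] := mesh_small (divr_gt0 e2 c0).
(* The sequence is shifted by [k0] so that the index found also has a mesh small enough for
   [diff_quot_weak]. *)
have [k hk] := bounded_convergence N0 (f := fun k => F (k0 + k)%N)
  (fun k => Flip (k0 + k)%N) (fun k => Fb (k0 + k)%N) (fun k => F0 (k0 + k)%N)
  (fun x x1 Nx e e0 => let: ex_intro K hK := Fcv x x1 Nx e e0 in
     ex_intro _ K (fun k Kk => hK (k0 + k)%N (leq_trans Kk (leq_addl _ _)))) e2.
set j := (k0 + k)%N in hk.
have w1 := diff_quot_weak j vC gC zD z0 h0.
have {}w1 : `|intQ (fun x => diff_quot g j x * z x) + intQ (fun x => dot (g x) (h x))| <= e / 2.
  apply: le_trans w1 _; have := hk0 j (leq_addr _ _); rewrite (ltr_pdivlMr _ _ c0) => /ltW.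
  apply: le_trans; rewrite (_ : mesh R j * _ = 4 ^+ n * mesh R j * (n%:R * (2 * C * D) + 1)); last by ring.
  rewrite (_ : _ * (_ * mesh R j) = 4 ^+ n * mesh R j * (n%:R * (2 * C * D))); last by ring.
  by rewrite ler_wpM2l ?mulr_ge0 ?exprn_ge0 ?mesh_ge0 // lerDl.
have w2 : s * (intQ (fun x => diff_quot g j x * z x) - intQ z) <= e / 2.
  rewrite -intQB // -intQZ; last exact: bndB.
  apply: le_trans hk; apply: intQ_le; [by apply: bndM; [exact: bndC|exact: bndB]| exact: bF|].
  move=> x xQ; rewrite /F (_ : s * _ = s * (diff_quot g j x - 1) * z x); last by ring.
  by rewrite ler_wpM2r ?zge // le_max lexx orbT.
set I1 := intQ _ in w1 w2 *; set I2 := intQ _ in w1 *.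
have : s * (- I2 - I1) <= e / 2.
  apply: le_trans (ler_norm _) _; rewrite normrM s1 mul1r -opprD normrN addrC //.
by nra.
Qed.

Lemma obstacle_sol_of_ae C D (v : T -> R) (g : T -> T) N :
  C11 Q C v g -> (forall x, `|x| <= 2 -> 0 <= v x) ->
  (forall x, `|x| <= 2 -> `|v x| <= D * `|x| ^+ 2) -> lebesgue_null N ->
  ae_laplacian v g N (fun x => if 0 < v x then 1 else 0) -> obstacle_sol v g.
Proof.
move=> vC v0 vD N0 lap.
(* Truncation makes the gradient bounded everywhere, as [diff_quot_weak] demands: its shifted points
   can leave the cube. *)
pose g' x := if `|x| <= 2 then g x else 0.
have gg x : `|x| <= 2 -> g x = g' x by move=> xQ; rewrite /g' xQ.
have C0 := C11_ge0 vC.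
have vC' : C11 Q C v g' by apply: C11_ext vC => // x xQ; rewrite gg.
have gC x : `|g' x| <= C.
  by rewrite /g'; case: ifP => [xQ|_]; [exact: (C11_grad vC)|rewrite normr0].
have lap' : ae_laplacian v g' N (fun x => if 0 < v x then 1 else 0).
  move=> x x1 Nx; have [d [dcv dl]] := lap x x1 Nx; exists d; split => // i.
  under eq_fun => k do [rewrite -!gg;
    [|by apply: le_trans x1 _; rewrite ler1n|
      by apply: le_trans (ler_normD _ _) _; have := norm_mesh_evec k i; have := mesh_le1 k; lra]].
  exact: dcv.
have [Cp pC] := @C11_phi R n.
have bg : vbnd g' by exists C.
have vid := @vbnd_id R n; have bs := @bnd_psi R n; have bp := @bnd_phi R n.
have pairE E f h : C11 Q E f h ->
    intQ (fun x => dot (g' x) (f x *: gphi x + phi x *: h x)) = weak_pair g f h.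
  move=> fE; have bf := bnd_C11 fE; have vh := vbnd_C11 fE.
  have -> : weak_pair g f h = weak_pair g' f h.
    rewrite /weak_pair; congr (_ - _ * _).
      by apply: Iphi_ext => x xQ; rewrite gg.
    by apply: Ipsi_ext => x xQ _; rewrite gg.
  rewrite /weak_pair -mulNr -IpsiZ; last by apply: bndM => //; apply: bnd_dot.
  rewrite /Iphi /Ipsi -intQD; [|by apply: bndM => //; apply: bnd_dot
    |by apply: bndM => //; apply: bndM; [exact: bndC|apply: bndM => //; apply: bnd_dot]].
  by apply: intQ_ext => x _; rewrite dotDr !dotZr /gphi; ring.
have phiE f : intQ (fun x => f x * phi x) = Iphi f.
  by apply: intQ_ext => x _; rewrite mulrC.
have zout f (x : T) : 1 < `|x| -> f x * phi x = 0 by move=> /phi_out->; rewrite mulr0.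
have hout (f : T -> R) (h : T -> T) (x : T) : 1 < `|x| -> f x *: gphi x + phi x *: h x = 0.
  by move=> x1; rewrite /gphi psi_out // phi_out // !(mulr0, scale0r, scaler0, addr0).
have sup E f h : C11 Q E f h -> (forall x, `|x| <= 2 -> 0 <= f x) ->
    - Iphi f <= weak_pair g f h.
  move=> fE f0.
  have := @ae_weak_ineq C v g' _ _ _ N _ 1 _ vC' gC (C11M fE pC) (zout f) (hout f h) _ N0 lap' _.
  rewrite normr1 => /(_ erefl) h1; have {h1} := h1 _ _.
  rewrite (pairE _ _ _ fE) phiE mul1r => h1.
  have : - weak_pair g f h - Iphi f <= 0.
    apply: h1 => [x xQ|x _ _]; first by rewrite mulr_ge0 ?f0 ?phi_ge0.
    by rewrite mul1r; case: ifP => _; lra.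
  by lra.
split => //; [by exists C|by exists D|].
have := sup _ _ _ vC v0.
(* The reverse inequality holds against [v phi], which vanishes wherever the Laplacian is 0 instead
   of 1. *)
have := @ae_weak_ineq C v g' _ _ _ N _ (-1) _ vC' gC (C11M vC pC) (zout v) (hout v g) _ N0 lap' _.
rewrite normrN1 => /(_ erefl) h1; have {h1} := h1 _ _.
rewrite (pairE _ _ _ vC) phiE mulN1r => h1.
have : - (- weak_pair g v g - Iphi v) <= 0.
  apply: h1 => [x xQ|x x1]; first by rewrite mulr_ge0 ?v0 ?phi_ge0.
  have [vx _|] := ltP 0 (v x); first by rewrite subrr mulr0.
  move=> vx; have -> : v x = 0.
    by apply/eqP; rewrite eq_le vx v0 // (le_trans x1) // ler1n.
  by rewrite mul0r eqxx.
by move=> h2 h3; apply/eqP; rewrite eq_le; apply/andP; split; lra.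
Qed.

End WeakForm.

(** * Monotonicity formulas *)

(* A substitute for the sign of the derivative: an error quadratic in the step
   vanishes after subdividing [[a, b]]. *)
Lemma discrete_mono (R : realType) (f : R -> R) (a b K : R) : 0 < a -> a <= b -> 0 <= K ->
  (forall r t, a <= r -> 0 <= t <= 1 -> r * (1 + t) <= b ->
     f r - f (r * (1 + t)) <= K * t ^+ 2) -> f a <= f b.
Proof.
move=> a0 ab K0 step; have d0 : 0 <= b - a by lra.
have key (M : nat) : (b - a) / M.+1%:R <= a ->
    f a - f b <= K * ((b - a) / a) ^+ 2 / M.+1%:R.
  move=> hM; set h := (b - a) / M.+1%:R in hM *.
  have h0 : 0 <= h by rewrite divr_ge0.
  have hN : h * M.+1%:R = b - a by rewrite /h divfK // pnatr_eq0.
  have ind j : (j <= M.+1)%N -> f a - f (a + j%:R * h) <= j%:R * (K * (h / a) ^+ 2).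
    elim: j => [|j IH] jM; first by rewrite !mul0r addr0 subrr.
    have {}IH := IH (ltnW jM); have jh : 0 <= j%:R * h by rewrite mulr_ge0.
    set r := a + j%:R * h in IH *; have ra : a <= r by rewrite /r lerDl.
    have r0 : 0 < r by exact: lt_le_trans ra.
    have E : r * (1 + h / r) = a + j.+1%:R * h.
      by rewrite mulrDr mulr1 mulrC divfK ?gt_eqF // /r -natr1; ring.
    have := step r (h / r) ra; rewrite E => /(_ _ _) st.
    have {}st : f r - f (a + j.+1%:R * h) <= K * (h / r) ^+ 2.
      apply: st; first by rewrite divr_ge0 ?(ltW r0) //= ler_pdivrMr // mul1r; lra.
      rewrite -lerBrDl -hN mulrC ler_wpM2l // ler_nat //.
    have : K * (h / r) ^+ 2 <= K * (h / a) ^+ 2.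
      rewrite ler_wpM2l // ler_pXn2r ?nnegrE ?divr_ge0 ?(ltW r0) ?(ltW a0) //.
      by rewrite ler_wpM2l // lef_pV2 ?posrE.
    have -> : j.+1%:R * (K * (h / a) ^+ 2) = j%:R * (K * (h / a) ^+ 2) + K * (h / a) ^+ 2.
      by rewrite -natr1; ring.
    by lra.
  have Eb : a + M.+1%:R * h = b by rewrite mulrC hN addrC subrK.
  have := ind M.+1 (leqnn _); rewrite Eb => /le_trans; apply.
  rewrite /h le_eqVlt; apply/orP; left; apply/eqP.
  have aN : a != 0 by rewrite gt_eqF.
  have MN : M.+1%:R != 0 :> R by rewrite pnatr_eq0.
  by move: (M.+1%:R) MN => p pN; field; rewrite aN pN.
rewrite -subr_le0; apply/ler_addgt0Pr => e e0; rewrite add0r.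
set c := K * ((b - a) / a) ^+ 2 in key.
have c0 : 0 <= c by rewrite mulr_ge0 ?exprn_ge0 ?divr_ge0 // ltW.
pose M := Num.bound ((b - a) / a + c / e).
have hM : (b - a) / a + c / e < M.+1%:R.
  apply: lt_trans (_ : M%:R < _); last by rewrite ltr_nat.
  by apply: archi_boundP; rewrite addr_ge0 ?divr_ge0 // ltW.
have q1 : 0 <= (b - a) / a by rewrite divr_ge0 // ltW.
have q2 : 0 <= c / e by rewrite divr_ge0 // ltW.
apply: le_trans (key M _) _.
  rewrite ler_pdivrMr ?ltr0Sn // mulrC -ler_pdivrMr //; lra.
by rewrite ler_pdivrMr ?ltr0Sn // mulrC -ler_pdivrMr //; lra.
Qed.

Section Dilation.
Variables (R : realType) (n : nat).
Local Notation T := 'rV[R]_n.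
Local Notation Q := (fun x : T => is_true (`|x| <= 2)).

(** For v the rescaling at scale r this is r times its derivative in r; it vanishes for functions
    homogeneous of degree 2. *)
Definition euler_defect (v : T -> R) (g : T -> T) (x : T) : R := dot (g x) x - 2 * v x.

(** The passage from scale r to r (1 + t), expressed by the rescaled function alone; see
    [resc_dilate]. *)
Definition dilate (t : R) (v : T -> R) (x : T) : R := v ((1 + t) *: x) / (1 + t) ^+ 2.

Lemma norm_le1_le2 (x : T) : `|x| <= 1 -> `|x| <= 2.
Proof. by move/le_trans; apply; rewrite ler1n. Qed.

Lemma euler_defect_bound C v g x : C11 Q C v g -> `|x| <= 1 ->
  `|euler_defect v g x| <= (n%:R + 2) * C.
Proof.
move=> vC x1; have xQ := norm_le1_le2 x1; apply: le_trans (ler_normB _ _) _.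
rewrite [leRHS]mulrDl; apply: lerD; last by rewrite normrM ger0_norm // ler_wpM2l // (C11_val vC).
by apply: le_trans (dot_le (C11_grad vC xQ) x1) _; rewrite mulr1.
Qed.

Lemma dilate_expand C v g (t : R) x : C11 Q C v g -> 0 <= t <= 1 -> `|x| <= 1 ->
  `|dilate t v x - v x - t / (1 + t) ^+ 2 * euler_defect v g x| <= 2 * C * t ^+ 2.
Proof.
move=> vC /andP[t0 t1] x1; have xQ := norm_le1_le2 x1; have C0 := C11_ge0 vC.
have t10 : 0 < 1 + t by lra.
have sxQ : `|(1 + t) *: x| <= 2.
  by rewrite normrZ gtr0_norm //; have := normr_ge0 x; nra.
have := C11_taylor vC xQ sxQ.
have -> : (1 + t) *: x - x = t *: x by rewrite scalerDl scale1r addrC addKr.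
rewrite dotZr.
rewrite normrZ (ger0_norm t0) => h.
have {}h : `|v ((1 + t) *: x) - v x - t * dot (g x) x| <= C * t ^+ 2.
  apply: le_trans h _; rewrite ler_wpM2l // exprMn ler_piMr ?exprn_ge0 //.
  by rewrite exprn_ile1.
rewrite (_ : _ - _ = (1 + t) ^- 2 * ((v ((1 + t) *: x) - v x - t * dot (g x) x) - t ^+ 2 * v x)); last first.
  by rewrite /dilate /euler_defect; field; rewrite gt_eqF.
rewrite normrM ger0_norm ?invr_ge0 ?exprn_ge0 ?(ltW t10) //.
apply: (@le_trans _ _ (1 * (2 * C * t ^+ 2))); last by rewrite mul1r.
apply: ler_pM; rewrite ?invr_ge0 ?exprn_ge0 ?(ltW t10) //.
  by rewrite invf_le1 ?exprn_gt0 // exprn_ege1 //; lra.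
apply: le_trans (ler_normB _ _) _; rewrite normrM (ger0_norm (exprn_ge0 2 t0)).
have : t ^+ 2 * `|v x| <= t ^+ 2 * C by rewrite ler_wpM2l ?exprn_ge0 // (C11_val vC).
lra.
Qed.

Ltac bt := repeat first
  [ assumption | apply: bndC | apply: bndB | apply: bndN | apply: bndD
  | apply: bndM | apply: bndX | apply: bnd_dot | apply: vbndB | apply: vbnd_id ].

Definition psi_mass : R := 4 ^+ n * 2.

Lemma psi_mass_ge0 : 0 <= psi_mass.
Proof. by rewrite mulr_ge0 // exprn_ge0. Qed.

Lemma Ipsi_cst (c : R) : `|Ipsi (fun _ : T => c)| <= psi_mass * `|c|.
Proof. by rewrite /psi_mass -mulrA; apply: Ipsi_abs. Qed.

Lemma t_over_sq (t : R) : 0 <= t <= 1 -> t / 4 <= t / (1 + t) ^+ 2 <= t.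
Proof.
move=> /andP[t0 t1]; have h : 0 < (1 + t) ^+ 2 by rewrite exprn_gt0 //; lra.
apply/andP; split.
  by rewrite ler_wpM2l // lef_pV2 ?posrE // expr2; nra.
by rewrite ler_pdivrMr // ler_peMr // expr2; nra.
Qed.

(** [weiss_step] with w the dilation of v, where w - v is t / (1 + t)^2 times the defect up to order
    t^2. Since t / (1 + t)^2 >= t / 4, the factor 4 in [weiss_step] leaves t times the squared
    defect. [K] depends only on [C], so it is the same at every scale. *)
Lemma weiss_dilate C : 0 <= C -> exists K : R, 0 <= K /\ forall v g w h (t : R),
  C11 Q C v g -> obstacle_sol v g -> obstacle_sol w h -> 0 <= t <= 1 ->
  (forall x, `|x| <= 2 -> w x = dilate t v x) ->
  t * Ipsi (fun x => euler_defect v g x ^+ 2) - K * t ^+ 2 <= weiss w h - weiss v g.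
Proof.
move=> C0; pose Z := (n%:R + 2) * C; have Z0 : 0 <= Z by rewrite mulr_ge0 // addr_ge0.
pose K := 2 * C * Z + 2 * Z ^+ 2 + 8 * C ^+ 2.
have K0 : 0 <= K by rewrite !addr_ge0 ?mulr_ge0 ?exprn_ge0.
exists (4 * (psi_mass * K)); split; first by rewrite !mulr_ge0 // psi_mass_ge0.
move=> v g w h t vC vs ws t01 wE; have t01' := t01; case/andP: t01' => t0 t1.
apply: le_trans (weiss_step vs ws).
have bv := bnd_C11 vC; have bg := vbnd_C11 vC.
have [Cw wC] := sol_C11 ws; have bw := bnd_C11 wC.
have bZ : bnd (euler_defect v g) by rewrite /euler_defect; bt.
pose t' := t / (1 + t) ^+ 2; have /andP[t'1 t'2] := t_over_sq t01; rewrite -/t' in t'1 t'2.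
have low x : `|x| <= 1 -> t' * euler_defect v g x ^+ 2 - K * t ^+ 2 <=
    (w x - v x) * (dot (g x) x - 2 * v x) + (-1) * (w x - v x) ^+ 2.
  move=> x1; have := dilate_expand vC t01 x1; rewrite -/t' -wE ?norm_le1_le2 //.
  rewrite -/(euler_defect v g x); have := euler_defect_bound vC x1; rewrite -/Z.
  set z := euler_defect v g x; set d := w x - v x; move=> hz he.
  set e := d - t' * z in he; have -> : d = t' * z + e by rewrite /e; ring.
  have h1 : `|e * z| <= 2 * C * t ^+ 2 * Z by rewrite normrM ler_pM.
  have h2 : e ^+ 2 <= 4 * C ^+ 2 * t ^+ 2.
    rewrite -(real_normK (num_real e)).
    apply: (@le_trans _ _ ((2 * C * t ^+ 2) ^+ 2)).
      by rewrite ler_pXn2r ?nnegrE ?mulr_ge0 ?exprn_ge0.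
    rewrite (_ : (2 * C * t ^+ 2) ^+ 2 = 4 * C ^+ 2 * t ^+ 2 * t ^+ 2); last by ring.
    by rewrite ler_piMr ?mulr_ge0 ?exprn_ge0 // exprn_ile1.
  have h3 : (t' * z) ^+ 2 <= Z ^+ 2 * t ^+ 2.
    rewrite exprMn mulrC; apply: ler_pM; rewrite ?sqr_ge0 //.
      by rewrite -(real_normK (num_real z)) ler_pXn2r ?nnegrE.
    by rewrite ler_pXn2r ?nnegrE //; lra.
  have h4 : (t' * z + e) ^+ 2 <= 2 * (t' * z) ^+ 2 + 2 * e ^+ 2.
    by have := sqr_ge0 (t' * z - e); nra.
  move: h1; rewrite ler_norml => /andP[h1 _].
  rewrite /K; nra.
have [c cE] : exists c, c = - K * t ^+ 2 by exists (- K * t ^+ 2).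
have bl : bnd (fun x => t' * euler_defect v g x ^+ 2 + c) by bt.
have := @Ipsi_le _ _ (fun x => t' * euler_defect v g x ^+ 2 + c)
  (fun x => (w x - v x) * (dot (g x) x - 2 * v x) + (-1) * (w x - v x) ^+ 2) bl.
move=> /(_ _ _) hle.
have {}hle : Ipsi (fun x => t' * euler_defect v g x ^+ 2 + c) <=
  Ipsi (fun x => (w x - v x) * (dot (g x) x - 2 * v x) + (-1) * (w x - v x) ^+ 2).
  by apply: hle => [|x x1]; [by bt|have := low x x1; rewrite cE; lra].
rewrite IpsiD in hle; [|by bt..]. rewrite IpsiZ in hle; [|by bt..].
rewrite IpsiD in hle; [|by bt..]. rewrite IpsiZ in hle; [|by bt..].
have := Ipsi_cst c; rewrite ler_norml => /andP[hc _].
rewrite {1}cE normrM normrN (ger0_norm K0) (ger0_norm (exprn_ge0 2 t0)) in hc.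
have : 0 <= Ipsi (fun x => euler_defect v g x ^+ 2).
  by apply: Ipsi_ge0 => [|x _]; [by bt|exact: sqr_ge0].
nra.
Qed.

(** The difference of the squares is at least 2 (v - U) (w - v), to first order a positive multiple
    of the integrand in [monneau_deriv], whose integral is nonnegative because the energy of v is at
    least that of U. *)
Lemma monneau_dilate C D : 0 <= C -> 0 <= D -> exists K : R, 0 <= K /\ forall v g w h U G (t : R),
  C11 Q C v g -> obstacle_sol v g -> obstacle_sol w h -> homog_sol U G -> C11 Q D U G ->
  weiss U G <= weiss v g -> 0 <= t <= 1 ->
  (forall x, `|x| <= 2 -> w x = dilate t v x) ->
  - (K * t ^+ 2) <= Ipsi (fun x => (w x - U x) ^+ 2) - Ipsi (fun x => (v x - U x) ^+ 2).
Proof.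
move=> C0 D0; pose K := 4 * (C + D) * C.
have K0 : 0 <= K by rewrite !mulr_ge0 // addr_ge0.
exists (psi_mass * K); split; first by apply: mulr_ge0 => //; exact: psi_mass_ge0.
move=> v g w h U G t vC vs ws Us UC le t01 wE; have t01' := t01; case/andP: t01' => t0 t1.
have bv := bnd_C11 vC; have bg := vbnd_C11 vC; have bU := bnd_C11 UC.
have [Cw wC] := sol_C11 ws; have bw := bnd_C11 wC.
have bZ : bnd (euler_defect v g) by rewrite /euler_defect; bt.
pose t' := t / (1 + t) ^+ 2; have /andP[t'1 t'2] := t_over_sq t01; rewrite -/t' in t'1 t'2.
have low x : `|x| <= 1 -> 2 * t' * ((v x - U x) * euler_defect v g x) - K * t ^+ 2 <=
    (w x - U x) ^+ 2 + (-1) * (v x - U x) ^+ 2.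
  move=> x1; have := dilate_expand vC t01 x1; rewrite -/t' -wE ?norm_le1_le2 //.
  set z := euler_defect v g x; set d := w x - v x => he.
  set e := d - t' * z in he.
  have h1 : `|(v x - U x) * e| <= (C + D) * (2 * C * t ^+ 2).
    rewrite normrM ler_pM //; apply: le_trans (ler_normB _ _) _.
    by rewrite lerD ?(C11_val vC) ?(C11_val UC) // norm_le1_le2.
  move: h1; rewrite ler_norml => /andP[h1 _].
  rewrite (_ : w x - U x = (v x - U x) + d); last by rewrite /d; ring.
  have := sqr_ge0 d; rewrite (_ : (v x - U x) * e = (v x - U x) * d - t' * ((v x - U x) * z)) in h1; last by rewrite /e; ring.
  rewrite /K; nra.
have [c cE] : exists c, c = - K * t ^+ 2 by exists (- K * t ^+ 2).
have hle : Ipsi (fun x => 2 * t' * ((v x - U x) * euler_defect v g x) + c) <=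
  Ipsi (fun x => (w x - U x) ^+ 2 + (-1) * (v x - U x) ^+ 2).
  by apply: Ipsi_le => [||x x1]; [by bt|by bt|have := low x x1; rewrite cE; lra].
rewrite IpsiD in hle; [|by bt..]. rewrite IpsiZ in hle; [|by bt..].
rewrite IpsiD in hle; [|by bt..]. rewrite IpsiZ in hle; [|by bt..].
have := Ipsi_cst c; rewrite ler_norml => /andP[hc _].
rewrite {1}cE normrM normrN (ger0_norm K0) (ger0_norm (exprn_ge0 2 t0)) in hc.
have := monneau_deriv vs Us; rewrite -/(euler_defect v g).
set I := Ipsi _ in hle *; move=> hI.
have I1 : 0 <= I by lra.
have : 0 <= t' * I by rewrite mulr_ge0 //; lra.
nra.
Qed.

End Dilation.

(** * Rescalings at contact points *)

Section Rescaling.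
Variables (R : realType) (n : nat).
Local Notation T := 'rV[R]_n.
Local Notation Q := (fun x : T => is_true (`|x| <= 2)).
Implicit Types (u : T -> R) (x y : T) (rho L r : R).

Definition grad u x : T := \row_i partial i u x.

Record regular u x0 rho L : Prop := MkRegular {
  reg_rho : 0 < rho;
  reg_L : 0 <= L;
  reg_taylor : forall x y, `|x - x0| < rho -> `|y - x0| < rho ->
    `|u y - u x - dot (grad u x) (y - x)| <= L * `|y - x| ^+ 2;
  reg_glip : forall x y, `|x - x0| < rho -> `|y - x0| < rho ->
    `|grad u y - grad u x| <= L * `|y - x| }.

Record local_sol u x0 rho L : Prop := MkLocal {
  loc_reg : regular u x0 rho L;
  loc_ge0 : forall x, `|x - x0| < rho -> 0 <= u x;
  loc_ae : exists N : set T, lebesgue_null N /\ forall x, `|x - x0| < rho -> ~ N x ->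
    (forall i : 'I_n, derivable (partial i u) x (evec R i)) /\
    \sum_(i < n) partial i (partial i u) x = (if 0 < u x then 1 else 0) }.

(* [y] is kept in the half ball so that the rescalings [resc u y r], [r <= rho / 8], are
   controlled on [|x| <= 2]. *)
Definition contact u x0 rho y := [/\ `|y - x0| <= rho / 2, u y = 0 & grad u y = 0].

Definition gresc u y r (x : T) : T := r^-1 *: grad u (y + r *: x).

Definition Kreg L : R := (2 * n%:R + 4) * L.

Lemma resc_in x0 rho y r x : `|y - x0| <= rho / 2 -> 0 < r <= rho / 8 -> `|x| <= 2 ->
  `|y + r *: x - x0| < rho.
Proof.
move=> yx /andP[r0 r1] xQ; rewrite addrAC; apply: le_lt_trans (ler_normD _ _) _.
rewrite normrZ (gtr0_norm r0); have : r * `|x| <= rho / 8 * 2 by rewrite ler_pM // ltW.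
lra.
Qed.

Lemma resc_quad u x0 rho L y r x : regular u x0 rho L -> contact u x0 rho y ->
  0 < r <= rho / 8 -> `|x| <= 2 -> `|resc u y r x| <= L * `|x| ^+ 2.
Proof.
move=> ur [yx uy gy] rr xQ; have /andP[r0 _] := rr.
have yin : `|y - x0| < rho by have := reg_rho ur; lra.
have := reg_taylor ur yin (resc_in yx rr xQ).
have -> : y + r *: x - y = r *: x by rewrite addrC addKr.
rewrite uy gy dot0l !subr0 normrZ (gtr0_norm r0) => h.
rewrite /resc normrM normfV (ger0_norm (exprn_ge0 2 (ltW r0))) ler_pdivrMr ?exprn_gt0 //.
by apply: le_trans h _; rewrite exprMn; lra.
Qed.

(** Since u and its gradient vanish at y, the Taylor and Lipschitz bounds scale into bounds
    independent of y and r. *)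
Lemma resc_C11 u x0 rho L y r : regular u x0 rho L -> contact u x0 rho y ->
  0 < r <= rho / 8 -> C11 Q (Kreg L) (resc u y r) (gresc u y r).
Proof.
move=> ur uc rr; have [yx uy gy] := uc; have /andP[r0 _] := rr; have L0 := reg_L ur.
have yin : `|y - x0| < rho by have := reg_rho ur; lra.
have n0 : 0 <= n%:R * L by rewrite mulr_ge0.
have r2 : 0 < r ^+ 2 by rewrite exprn_gt0.
have E x z : y + r *: z - (y + r *: x) = r *: (z - x).
  by rewrite opprD addrACA subrr add0r scalerBr.
have gb x : `|x| <= 2 -> `|gresc u y r x| <= 2 * L.
  move=> xQ; have := reg_glip ur yin (resc_in yx rr xQ).
  have -> : y + r *: x - y = r *: x by rewrite addrC addKr.
  rewrite gy subr0 normrZ (gtr0_norm r0) => h.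
  rewrite /gresc normrZ normfV (gtr0_norm r0) mulrC ler_pdivrMr //.
  apply: le_trans h _; rewrite mulrCA mulrC ler_pM2r //; nra.
have ty x z : `|x| <= 2 -> `|z| <= 2 ->
    `|resc u y r z - resc u y r x - dot (gresc u y r x) (z - x)| <= L * `|z - x| ^+ 2.
  move=> xQ zQ; have := reg_taylor ur (resc_in yx rr xQ) (resc_in yx rr zQ).
  rewrite E dotZr normrZ (gtr0_norm r0) => h.
  rewrite (_ : _ - _ = (u (y + r *: z) - u (y + r *: x) -
      r * dot (grad u (y + r *: x)) (z - x)) / r ^+ 2); last first.
    by rewrite /resc /gresc dotZl; field; rewrite gt_eqF.
  rewrite normrM normfV (gtr0_norm r2) ler_pdivrMr //.
  by apply: le_trans h _; rewrite exprMn; lra.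
have dd x z : `|x| <= 2 -> `|z| <= 2 -> `|z - x| <= 4.
  by move=> xQ zQ; apply: le_trans (ler_normB _ _) _; lra.
split.
- by rewrite /Kreg mulrDl; lra.
- move=> x xQ; apply: le_trans (resc_quad ur uc rr xQ) _; rewrite /Kreg mulrDl.
  have : `|x| ^+ 2 <= 2 ^+ 2 by rewrite ler_pXn2r ?nnegrE.
  have := sqr_ge0 `|x|; nra.
- by move=> x xQ; apply: le_trans (gb x xQ) _; rewrite /Kreg mulrDl; lra.
- move=> x z xQ zQ; have h1 := ty _ _ xQ zQ.
  have h2 := dot_le (gb x xQ) (lexx `|z - x|); have h3 := dd _ _ xQ zQ.
  have h4 := normr_ge0 (z - x).
  rewrite (_ : _ - _ = (resc u y r z - resc u y r x - dot (gresc u y r x) (z - x))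
    + dot (gresc u y r x) (z - x)); last by ring.
  apply: le_trans (ler_normD _ _) _; rewrite /Kreg mulrDl.
  have h5 : L * `|z - x| ^+ 2 <= L * (4 * `|z - x|).
    by rewrite ler_wpM2l // expr2 ler_wpM2r.
  lra.
- move=> x z xQ zQ; have := reg_glip ur (resc_in yx rr xQ) (resc_in yx rr zQ).
  rewrite E normrZ (gtr0_norm r0) => h.
  rewrite /gresc -scalerBr normrZ normfV (gtr0_norm r0) mulrC ler_pdivrMr //.
  apply: le_trans h _; rewrite mulrCA mulrC ler_pM2r // ler_wpM2r //.
  by rewrite /Kreg mulrDl; lra.
- move=> x z xQ zQ; apply: le_trans (ty _ _ xQ zQ) _; rewrite ler_wpM2r ?exprn_ge0 //.
  by rewrite /Kreg mulrDl; lra.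
Qed.

Lemma lebesgue_null_affine (N : set T) y r : 0 < r -> lebesgue_null N ->
  lebesgue_null [set x | N (y + r *: x)].
Proof.
move=> r0 N0 e e0; have rn : 0 < r ^+ n by rewrite exprn_gt0.
have [a [b [ab [Nab vab]]]] := N0 _ (mulr_gt0 e0 rn).
exists (fun k => r^-1 *: (a k - y)), (fun k => r^-1 *: (b k - y)); split; [|split].
- by move=> k i; rewrite !mxE ler_pM2l ?invr_gt0 // lerD2r.
- move=> x /Nab[k _ xk]; exists k => // i; have := xk i; rewrite !mxE => /andP[h1 h2].
  rewrite [r^-1 * _]mulrC ler_pdivrMr // [r^-1 * _]mulrC ler_pdivlMr //.
  by apply/andP; split; lra.
- move=> K; apply: (@le_trans _ _ ((\sum_(k < K) box_vol (a k) (b k)) / r ^+ n)); last first.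
    by rewrite ler_pdivrMr.
  rewrite mulr_suml le_eqVlt; apply/orP; left; apply/eqP; apply: eq_bigr => k _.
  rewrite /box_vol -exprVn -[in r^-1 ^+ n](card_ord n) -prodr_const -big_split /=.
  by apply: eq_bigr => i _; rewrite !mxE; ring.
Qed.

Lemma resc_sol u x0 rho L y r : local_sol u x0 rho L -> contact u x0 rho y ->
  0 < r <= rho / 8 -> obstacle_sol (resc u y r) (gresc u y r).
Proof.
move=> us uc rr; have ur := loc_reg us; have [yx uy gy] := uc; have /andP[r0 _] := rr.
have [N [N0 Nae]] := loc_ae us.
apply: (obstacle_sol_of_ae (resc_C11 ur uc rr) _ _ (lebesgue_null_affine y r0 N0)).
- move=> x xQ; rewrite /resc divr_ge0 ?exprn_ge0 ?(ltW r0) //.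
  by apply: (loc_ge0 us); exact: resc_in.
- by move=> x xQ; exact: (resc_quad ur uc rr).
move=> x x1 /= Nx; have xin := resc_in yx rr (norm_le1_le2 x1).
have [der lap] := Nae _ xin Nx; exists (fun i => partial i (partial i u) (y + r *: x)).
split; last first.
  rewrite lap /resc; congr (if _ then _ else _).
  by rewrite pmulr_lgt0 // invr_gt0 exprn_gt0.
move=> i; have /cvg_ex [l hl] := der i.
have -> : partial i (partial i u) (y + r *: x) = l by apply: cvg_lim hl.
(* The difference quotients of the rescaled gradient with step [mesh R k] are those of [grad u] with
   step [r * mesh R k]: second derivatives are invariant under this scaling. *)
have h0 : (fun k => r * mesh R k) @ \oo --> (0 : R)^'.
  move=> A /=; rewrite /dnbhs /within /= => /nbhs_ballP[e /= e0 he].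
  have [N1 hN1] := mesh_small (divr_gt0 e0 r0).
  exists N1 => // k /= /hN1; rewrite ltr_pdivlMr // mulrC => hk.
  have rk : 0 < r * mesh R k by rewrite mulr_gt0 // mesh_gt0.
  apply: he; last by rewrite gt_eqF.
  by rewrite /ball /= sub0r normrN gtr0_norm.
have := cvg_comp _ _ h0 hl; apply: cvg_trans; apply: near_eq_cvg; near=> k => /=.
have mk : mesh R k != 0 by rewrite gt_eqF // mesh_gt0.
have rN : r != 0 by rewrite gt_eqF.
rewrite /gresc.
have -> : y + r *: (x + mesh R k *: evec R i) = (r * mesh R k) *: evec R i + (y + r *: x).
  by rewrite scalerDr scalerA addrA addrC.
by rewrite ![(_ *: grad _ _) 0 i]mxE ![grad _ _ 0 i]mxE /GRing.scale /=; field; rewrite mk.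
Unshelve. all: by end_near. Qed.

Lemma resc_dilate u y r t x : 0 < r -> resc u y (r * (1 + t)) x = dilate t (resc u y r) x.
Proof.
by move=> r0; rewrite /dilate /resc scalerA exprMn invfM mulrA.
Qed.

Definition weiss_at u y r := weiss (resc u y r) (gresc u y r).

Lemma in_range rho r t (b : R) : 0 < r -> 0 <= t -> r * (1 + t) <= b -> b <= rho / 8 ->
  0 < r <= rho / 8 /\ 0 < r * (1 + t) <= rho / 8.
Proof.
move=> r0 t0 h hb; have h1 : r * 1 <= r * (1 + t) by rewrite ler_pM2l // lerDl.
have h2 : 0 < r * (1 + t) by apply: lt_le_trans h1; rewrite mulr1.
rewrite r0 h2 /=; split; lra.
Qed.

(** Besides monotonicity this keeps the defect term, which forces blow-ups to be homogeneous in
    [blowup_homog]. *)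
Lemma weiss_at_defect u x0 rho L y : local_sol u x0 rho L -> contact u x0 rho y ->
  exists K : R, 0 <= K /\ forall r t, 0 < r -> 0 <= t <= 1 -> r * (1 + t) <= rho / 8 ->
  t * Ipsi (fun x => euler_defect (resc u y r) (gresc u y r) x ^+ 2) - K * t ^+ 2
    <= weiss_at u y (r * (1 + t)) - weiss_at u y r.
Proof.
move=> us uc; have ur := loc_reg us.
have K0 : 0 <= Kreg L by rewrite mulr_ge0 ?(reg_L ur) // addr_ge0 // mulr_ge0.
have [K [Kge hK]] := weiss_dilate n K0; exists K; split => // r t r0 t01 rt.
have /andP[t0 t1] := t01; have [rr rr'] := in_range r0 t0 rt (lexx _).
apply: hK => //.
- exact: (resc_C11 ur uc rr).
- exact: (resc_sol us uc rr).
- exact: (resc_sol us uc rr').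
- by move=> x _; exact: resc_dilate.
Qed.

Lemma weiss_at_mono u x0 rho L y a b : local_sol u x0 rho L -> contact u x0 rho y ->
  0 < a -> a <= b -> b <= rho / 8 -> weiss_at u y a <= weiss_at u y b.
Proof.
move=> us uc a0 ab hb; have [K [K0 hK]] := weiss_at_defect us uc.
apply: (discrete_mono a0 ab K0) => r t ar t01 rt.
have r0 := lt_le_trans a0 ar; have := hK r t r0 t01 (le_trans rt hb).
have : 0 <= t * Ipsi (fun x => euler_defect (resc u y r) (gresc u y r) x ^+ 2); last by lra.
have /andP[t0 _] := t01; have [rr _] := in_range r0 t0 rt hb.
rewrite mulr_ge0 //; apply: Ipsi_ge0 => [|x _]; last exact: sqr_ge0.
have vC := resc_C11 (loc_reg us) uc rr.
apply: bndX; apply: bndB; first by apply: bnd_dot (vbnd_C11 vC) (@vbnd_id R n).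
by apply: bndM; [exact: bndC|exact: bnd_C11 vC].
Qed.

Lemma monneau_mono u x0 rho L y a b U G : local_sol u x0 rho L -> contact u x0 rho y ->
  homog_sol U G -> (forall r, 0 < r -> r <= rho / 8 -> weiss U G <= weiss_at u y r) ->
  0 < a -> a <= b -> b <= rho / 8 ->
  Ipsi (fun x => (resc u y a x - U x) ^+ 2) <= Ipsi (fun x => (resc u y b x - U x) ^+ 2).
Proof.
move=> us uc Us hW a0 ab hb; have ur := loc_reg us; have [D UD] := homog_C11 Us.
have K0 : 0 <= Kreg L by rewrite mulr_ge0 ?(reg_L ur) // addr_ge0 // mulr_ge0.
have [K [Kge hK]] := monneau_dilate n K0 (C11_ge0 UD).
apply: (discrete_mono (f := fun r => Ipsi (fun x => (resc u y r x - U x) ^+ 2)) a0 ab Kge).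
move=> r t ar t01 rt; have r0 := lt_le_trans a0 ar; have /andP[t0 _] := t01.
have [rr rr'] := in_range r0 t0 rt hb.
have /andP[_ rr1] := rr.
have := hK _ _ _ _ _ _ t (resc_C11 ur uc rr) (resc_sol us uc rr) (resc_sol us uc rr') Us UD
  (hW r r0 rr1) t01 (fun x _ => resc_dilate u y t x r0).
lra.
Qed.

End Rescaling.

(** * Compactness and blow-ups *)

Section UlimMore.
Variable R : realType.

Lemma ulim_abs (a : nat -> R) (c : R) : (forall k, `|a k| <= c) -> `|ulim a| <= c.
Proof.
move=> ac; have ba : bounded_seq a by exists c.
have bc (d : R) : bounded_seq (fun _ => d) by exists `|d|.
have h1 : ulim (fun _ => - c) <= ulim a.
  by apply: ulim_le => // k; have := ac k; rewrite ler_norml => /andP[].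
have h2 : ulim a <= ulim (fun _ => c).
  by apply: ulim_le => // k; have := ac k; rewrite ler_norml => /andP[].
by rewrite !ulim_cst in h1 h2; rewrite ler_norml h1.
Qed.

Lemma ulimB (a b : nat -> R) : bounded_seq a -> bounded_seq b ->
  ulim (fun k => a k - b k) = ulim a - ulim b.
Proof.
move=> ba bb; rewrite -mulN1r -ulimZ // -ulimD //.
  by congr ulim; apply/funext => k; rewrite mulN1r.
by case: bb => C bC; exists C => k; rewrite mulN1r normrN.
Qed.

Lemma ulim_sum (J : Type) (s : seq J) (a : J -> nat -> R) :
  (forall j, bounded_seq (a j)) ->
  bounded_seq (fun k => \sum_(j <- s) a j k) /\
  ulim (fun k => \sum_(j <- s) a j k) = \sum_(j <- s) ulim (a j).
Proof.
move=> ba; elim: s => [|j s [IHb IH]].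
  under eq_fun do rewrite big_nil; rewrite big_nil ulim_cst; split => //.
  by exists 0 => _; rewrite normr0.
under eq_fun do rewrite big_cons; rewrite big_cons -IH -ulimD //; split => //.
case: (ba j) IHb => C aC [D bD]; exists (C + D) => k.
by apply: le_trans (ler_normD _ _) _; rewrite lerD.
Qed.

End UlimMore.

Section Compactness.
Variables (R : realType) (n : nat).
Local Notation T := 'rV[R]_n.
Local Notation Q := (fun x : T => is_true (`|x| <= 2)).

Definition close (e : R) (v : T -> R) (g : T -> T) (w : T -> R) (h : T -> T) :=
  forall x, `|x| <= 2 -> `|v x - w x| <= e /\ `|g x - h x| <= e.

(** Pointwise ultralimits inherit every clause of [C11]. If closeness failed for all k >= K, bad
    points would have an ultralimit y; for some k both the values at y and the k-th bad point are
    close to their limits, and the Lipschitz bounds carry the closeness from y to that point. *)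
Lemma C11_compact C (v : nat -> T -> R) (g : nat -> T -> T) :
  (forall k, C11 Q C (v k) (g k)) ->
  exists U G, C11 Q C U G /\
    forall e : R, 0 < e -> forall K, exists k, (K <= k)%N /\ close e (v k) (g k) U G.
Proof.
move=> vC; have C0 := C11_ge0 (vC 0%N).
pose U x := ulim (fun k => v k x); pose G x : T := \row_i ulim (fun k => g k x 0 i).
have bv x : `|x| <= 2 -> bounded_seq (fun k => v k x).
  by move=> xQ; exists C => k; exact: (C11_val (vC k)).
have bg x i : `|x| <= 2 -> bounded_seq (fun k => g k x 0 i).
  by move=> xQ; exists C => k; apply: le_trans (coord_le_norm _ i) _; exact: (C11_grad (vC k)).
have UC : C11 Q C U G.
  split => //.
  - by move=> x xQ; apply: ulim_abs => k; exact: (C11_val (vC k)).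
  - move=> x xQ; apply: row_norm_le => // i; apply: ulim_abs => k.
    by apply: le_trans (coord_le_norm _ i) _; exact: (C11_grad (vC k)).
  - move=> x y xQ yQ; rewrite -(ulimB (bv _ yQ) (bv _ xQ)); apply: ulim_abs => k.
    exact: (C11_lip (vC k)).
  - move=> x y xQ yQ; apply: norm_le_coord; first by rewrite mulr_ge0.
    move=> i; rewrite !mxE -(ulimB (bg _ i yQ) (bg _ i xQ)); apply: ulim_abs => k.
    have := C11_glip (vC k) xQ yQ; apply: le_trans.
    by apply: le_trans (coord_le_norm _ i); rewrite !mxE.
  - move=> x y xQ yQ.
    have -> : dot (G x) (y - x) = ulim (fun k => dot (g k x) (y - x)).
      have bgy i : bounded_seq (fun k => g k x 0 i * (y - x) 0 i).
        have [E hE] := bg x i xQ; exists (E * `|(y - x) 0 i|) => k.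
        by rewrite normrM ler_wpM2r.
      have [_ ->] := ulim_sum (index_enum 'I_n) bgy.
      apply: eq_bigr => i _; rewrite [G x _ _]mxE mulrC -(ulimZ _ (bg _ i xQ)).
      by congr ulim; apply/funext => k; rewrite mulrC.
    rewrite -(ulimB (bv _ yQ) (bv _ xQ)) -ulimB.
    + by apply: ulim_abs => k; exact: (C11_taylor (vC k)).
    + exists (C * `|y - x|) => k; exact: (C11_lip (vC k)).
    + exists (n%:R * (C * `|y - x|)) => k; apply: dot_le => //; exact: (C11_grad (vC k)).
exists U, G; split => // e e0 K; apply: contrapT => /forallNP nk.
have bad k : exists x, (K <= k)%N -> `|x| <= 2 /\ (e < `|v k x - U x| \/ e < `|g k x - G x|).
  have [Kk|] := boolP (K <= k)%N; last by exists 0.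
  have := nk k; rewrite Kk => /not_andP[//|] /existsNP[x /not_implyP[xQ /not_andP h]].
  exists x => _; split => //; case: h => /negP; rewrite -ltNge => h; by [left|right].
have [x0 x0P] := choice bad.
(* The value 0 below [K] keeps the whole sequence in the cube, so that its ultralimit exists. *)
pose x k := if (K <= k)%N then x0 k else 0.
have xQ k : `|x k| <= 2.
  by rewrite /x; case: ifP => [/(x0P k)[]//|_]; rewrite normr0.
have bx i : bounded_seq (fun k => x k 0 i).
  by exists 2 => k; apply: le_trans (coord_le_norm _ i) _.
pose y : T := \row_i ulim (fun k => x k 0 i).
have yQ : `|y| <= 2.
  by apply: row_norm_le => // i; apply: ulim_abs => k; apply: le_trans (coord_le_norm _ i) _.
pose d := e / (4 * (C + 1)).
have C10 : 0 < 4 * (C + 1) by rewrite mulr_gt0 // ltr_wpDl.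
have d0 : 0 < d by rewrite divr_gt0.
have hC : C * d <= e / 4.
  rewrite /d mulrCA ler_wpM2l ?(ltW e0) // ler_pdivrMr //; lra.
have e4 : 0 < e / 4 by rewrite divr_gt0.
have n1 : \forall k \near free_ultrafilter, forall i : 'I_n, `|ulim (fun k => x k 0 i) - x k 0 i| < d.
  by apply: filter_forall => i; apply: (cvgrPdist_lt _ _).1 => //; apply: ulim_cvg.
have n2 : \forall k \near free_ultrafilter, `|U y - v k y| < e / 4.
  by apply: (cvgrPdist_lt _ _).1 => //; apply: ulim_cvg; exact: bv.
have n3 : \forall k \near free_ultrafilter, forall i : 'I_n, `|ulim (fun k => g k y 0 i) - g k y 0 i| < e / 4.
  by apply: filter_forall => i; apply: (cvgrPdist_lt _ _).1 => //; apply: ulim_cvg; exact: bg.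
have n4 : free_ultrafilter [set k | (K <= k)%N] by apply: free_ultrafilter_sub; exists K.
have [k [[[k1 k2] k3] k4]] := filter_ex (filterI (filterI (filterI n1 n2) n3) n4).
have xyd : `|x k - y| <= d.
  apply: norm_le_coord; first exact: ltW.
  by move=> i; rewrite !mxE -normrN opprB ltW // k1.
have [_ h] := x0P k k4; have xk : x k = x0 k by rewrite /x k4.
rewrite -xk in h.
have Cxy : C * `|x k - y| <= e / 4 by apply: le_trans hC; rewrite ler_wpM2l.
case: h; apply/negP; rewrite -leNgt.
  have a1 := C11_lip (vC k) yQ (xQ k); have a2 := C11_lip UC yQ (xQ k).
  rewrite (_ : _ - _ = (v k (x k) - v k y) - (U y - v k y) - (U (x k) - U y)); last by ring.
  apply: le_trans (ler_normB _ _) _; apply: le_trans (lerD (ler_normB _ _) (lexx _)) _.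
  by have := ltW k2; lra.
have a1 := C11_glip (vC k) yQ (xQ k); have a2 := C11_glip UC yQ (xQ k).
have a3 : `|G y - g k y| <= e / 4.
  by apply: norm_le_coord => [|i]; [exact: ltW|rewrite !mxE ltW // k3].
rewrite (_ : _ - _ = (g k (x k) - g k y) - (G y - g k y) - (G (x k) - G y)); last first.
  by apply/rowP => i; rewrite !mxE; ring.
apply: le_trans (ler_normB _ _) _; apply: le_trans (lerD (ler_normB _ _) (lexx _)) _.
lra.
Qed.

Ltac bt := repeat first
  [ assumption | apply: bndC | apply: bndB | apply: bndN | apply: bndD
  | apply: bndM | apply: bndX | apply: bnd_dot | apply: vbndB | apply: vbnd_id ].

Lemma Iphi_close (f f' : T -> R) (c : R) : bnd f -> bnd f' ->
  (forall x, `|x| <= 1 -> `|f x - f' x| <= c) -> `|Iphi f - Iphi f'| <= 4 ^+ n * c.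
Proof.
move=> bf bf' h; rewrite -mulN1r -IphiZ // -IphiD //; last by bt.
by apply: Iphi_abs => x x1; rewrite mulN1r; exact: h.
Qed.

Lemma Ipsi_close (f f' : T -> R) (c : R) : bnd f -> bnd f' ->
  (forall x, `|x| <= 1 -> `|f x - f' x| <= c) -> `|Ipsi f - Ipsi f'| <= 4 ^+ n * (2 * c).
Proof.
move=> bf bf' h; rewrite -mulN1r -IpsiZ // -IpsiD //; last by bt.
by apply: Ipsi_abs => x x1; rewrite mulN1r; exact: h.
Qed.

Section Close.
Variables (C e : R) (v w : T -> R) (g h : T -> T).
Hypotheses (vC : C11 Q C v g) (wC : C11 Q C w h) (vw : close e v g w h).

Lemma close_ge0 : 0 <= e.
Proof. by have [|+ _] := @vw 0; rewrite ?normr0 //; exact: le_trans. Qed.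

Lemma close_val x : `|x| <= 1 -> `|v x - w x| <= e.
Proof. by move=> /norm_le1_le2/vw[]. Qed.

Lemma close_grad x : `|x| <= 1 -> `|g x - h x| <= e.
Proof. by move=> /norm_le1_le2/vw[]. Qed.

Lemma close_dot (k : T -> T) (K : R) x : `|x| <= 1 -> `|k x| <= K ->
  `|dot (g x) (k x) - dot (h x) (k x)| <= n%:R * (e * K).
Proof. by move=> x1 kK; rewrite -dotBl; apply: dot_le => //; exact: close_grad. Qed.

Lemma close_dotxx x : `|x| <= 1 -> `|dot (g x) (g x) - dot (h x) (h x)| <= n%:R * (2 * C * e).
Proof.
move=> x1; have xQ := norm_le1_le2 x1.
rewrite (_ : _ - _ = dot (g x + h x) (g x - h x)); last first.
  by rewrite !(dotDl, dotDr, dotNl, dotNr) (dotC (h x) (g x)); ring.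
apply: dot_le; last exact: close_grad.
apply: le_trans (ler_normD _ _) _.
by have := C11_grad vC xQ; have := C11_grad wC xQ; lra.
Qed.

Lemma close_sq (U : T -> R) (D : R) x : 0 <= D -> `|x| <= 1 -> `|U x| <= D ->
  `|(v x - U x) ^+ 2 - (w x - U x) ^+ 2| <= 2 * (C + D) * e.
Proof.
move=> D0 x1 UD; have xQ := norm_le1_le2 x1.
rewrite subr_sqr (_ : v x - U x - (w x - U x) = v x - w x); last by ring.
rewrite normrM mulrC ler_pM ?close_val //.
have := C11_val vC xQ; have := C11_val wC xQ; move: UD; rewrite !ler_norml.
move=> /andP[? ?] /andP[? ?] /andP[? ?]; apply/andP; split; lra.
Qed.

Lemma close_vdot x : `|x| <= 1 -> `|v x * dot (g x) x - w x * dot (h x) x| <= n%:R * (2 * C * e).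
Proof.
move=> x1; have xQ := norm_le1_le2 x1; have C0 := C11_ge0 vC; have e0 := close_ge0.
rewrite (_ : _ - _ = dot (v x *: g x - w x *: h x) x); last first.
  by rewrite !(dotBl, dotZl).
rewrite -[2 * C * e]mulr1; apply: dot_le => //.
rewrite (_ : _ - _ = (v x - w x) *: g x + w x *: (g x - h x)); last first.
  by apply/rowP => i; rewrite !mxE; ring.
apply: le_trans (ler_normD _ _) _; rewrite !normrZ.
have := ler_pM (normr_ge0 _) (normr_ge0 _) (close_val x1) (C11_grad vC xQ).
have := ler_pM (normr_ge0 _) (normr_ge0 _) (C11_val wC xQ) (close_grad x1).
lra.
Qed.

Let bv : bnd v := bnd_C11 vC.
Let bw : bnd w := bnd_C11 wC.
Let bg : vbnd g := vbnd_C11 vC.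
Let bh : vbnd h := vbnd_C11 wC.

Lemma Iphi_close_val : `|Iphi v - Iphi w| <= 4 ^+ n * e.
Proof. by apply: Iphi_close => //; exact: close_val. Qed.

Lemma weiss_close : `|weiss v g - weiss w h| <= 4 ^+ n * (n%:R * (2 * C) + 2 + 16 * C) * e.
Proof.
have bg2 : bnd (fun x => dot (g x) (g x)) by bt.
have bh2 : bnd (fun x => dot (h x) (h x)) by bt.
have h1 := Iphi_close bg2 bh2 close_dotxx.
have h2 := Iphi_close_val.
have h3 : `|Ipsi (fun x => v x ^+ 2) - Ipsi (fun x => w x ^+ 2)| <= 4 ^+ n * (2 * (2 * C * e)).
  apply: Ipsi_close => [||x x1]; [by bt|by bt|].
  have := @close_sq (fun _ => 0) 0 x (lexx _) x1; rewrite normr0 => /(_ (lexx _)).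
  by rewrite !subr0 addr0.
rewrite /weiss; move: h1 h2 h3; rewrite !ler_norml.
move=> /andP[? ?] /andP[? ?] /andP[? ?]; apply/andP; split; lra.
Qed.

Lemma weak_pair_close (f : T -> R) (k : T -> T) (K : R) : C11 Q K f k ->
  `|weak_pair g f k - weak_pair h f k| <= 4 ^+ n * (5 * n%:R * K) * e.
Proof.
move=> fK; have bf := bnd_C11 fK; have bk := vbnd_C11 fK; have K0 := C11_ge0 fK.
have e0 := close_ge0.
have h1 : `|Iphi (fun x => dot (g x) (k x)) - Iphi (fun x => dot (h x) (k x))|
    <= 4 ^+ n * (n%:R * (e * K)).
  apply: Iphi_close => [||x x1]; [by bt|by bt|]; apply: close_dot => //.
  by apply: (C11_grad fK); exact: norm_le1_le2.
have h2 : `|Ipsi (fun x => f x * dot (g x) x) - Ipsi (fun x => f x * dot (h x) x)|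
    <= 4 ^+ n * (2 * (K * (n%:R * (e * 1)))).
  apply: Ipsi_close => [||x x1]; [by bt|by bt|]; rewrite -mulrBr normrM ler_pM //.
    by apply: (C11_val fK); exact: norm_le1_le2.
  exact: (@close_dot (fun x => x)).
rewrite /weak_pair; move: h1 h2; rewrite !ler_norml.
move=> /andP[? ?] /andP[? ?]; apply/andP; split; lra.
Qed.

Lemma weak_pair_self_close :
  `|weak_pair g v g - weak_pair h w h| <= 4 ^+ n * (10 * n%:R * C) * e.
Proof.
have bg2 : bnd (fun x => dot (g x) (g x)) by bt.
have bh2 : bnd (fun x => dot (h x) (h x)) by bt.
have h1 := Iphi_close bg2 bh2 close_dotxx.
have b1 : bnd (fun x => v x * dot (g x) x) by bt.
have b2 : bnd (fun x => w x * dot (h x) x) by bt.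
have h2 := Ipsi_close b1 b2 close_vdot.
rewrite /weak_pair; move: h1 h2; rewrite !ler_norml.
move=> /andP[? ?] /andP[? ?]; apply/andP; split; lra.
Qed.

Lemma defect_close : `|Ipsi (fun x => euler_defect v g x ^+ 2) - Ipsi (fun x => euler_defect w h x ^+ 2)|
  <= 4 ^+ n * (4 * (n%:R + 2) ^+ 2 * C) * e.
Proof.
have b1 : bnd (fun x => euler_defect v g x ^+ 2) by rewrite /euler_defect; bt.
have b2 : bnd (fun x => euler_defect w h x ^+ 2) by rewrite /euler_defect; bt.
have := @Ipsi_close _ _ (((n%:R + 2) * e) * (2 * ((n%:R + 2) * C))) b1 b2.
move=> hh; apply: le_trans (hh _) _; last by rewrite le_eqVlt; apply/orP; left; apply/eqP; ring.
move=> x x1; rewrite subr_sqr normrM; apply: ler_pM => //.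
  rewrite /euler_defect (_ : _ - _ = dot (g x) x - dot (h x) x - 2 * (v x - w x)); last by ring.
  apply: le_trans (ler_normB _ _) _; rewrite normrM (@ger0_norm _ 2) // mulrDl.
  have := @close_dot (fun x => x) 1 x x1 x1; have := close_val x1; lra.
apply: le_trans (ler_normD _ _) _.
by have := euler_defect_bound vC x1; have := euler_defect_bound wC x1; lra.
Qed.

End Close.

End Compactness.

(** * From integral bounds to pointwise bounds *)

Section SupBound.
Variables (R : realType) (n : nat).
Local Notation T := 'rV[R]_n.
Local Notation Q := (fun x : T => is_true (`|x| <= 2)).

(** A Lipschitz function with modulus at least eta at x keeps at least eta / 2 on a small cube about
    x, where moreover [psi] is at least kap; this bounds the weighted integral from below. *)
Lemma Ipsi_sup (L eta kap : R) : 0 <= L -> 0 < eta -> 0 < kap -> exists e : R, 0 < e /\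
  forall f : T -> R, bnd f ->
    (forall x y, `|x| <= 2 -> `|y| <= 2 -> `|f x - f y| <= L * `|x - y|) ->
    Ipsi (fun x => f x ^+ 2) <= e -> forall x, dot x x <= 1 - kap -> `|f x| < eta.
Proof.
move=> L0 eta0 kap0.
have a0 : 0 < eta / (2 * (L + 1)) by rewrite divr_gt0 // mulr_gt0 // ltr_wpDl.
have b0 : 0 < kap / (6 * n%:R + 6) by rewrite divr_gt0 // ltr_wpDl // mulr_ge0.
(* On the cube of radius [s], f varies by at most eta / 2 and [dot z z] grows by at most kap / 2. *)
pose s := Num.min 1 (Num.min (eta / (2 * (L + 1))) (kap / (6 * n%:R + 6))).
have s0 : 0 < s by rewrite !lt_min ltr01 a0 b0.
have s1 : s <= 1 by rewrite ge_min lexx.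
have s2 : L * s <= eta / 2.
  have : s <= eta / (2 * (L + 1)) by rewrite !ge_min lexx !orbT.
  rewrite ler_pdivlMr ?mulr_gt0 ?ltr_wpDl //; nra.
have s3 : 3 * n%:R * s <= kap / 2.
  have : s <= kap / (6 * n%:R + 6) by rewrite !ge_min lexx !orbT.
  rewrite ler_pdivlMr ?ltr_wpDl ?mulr_ge0 //; nra.
pose c := kap * (eta / 2) ^+ 2; have c0 : 0 < c by rewrite mulr_gt0 ?exprn_gt0 ?divr_gt0.
exists (c * s ^+ n / 2); split; first by rewrite divr_gt0 // mulr_gt0 ?exprn_gt0.
move=> f bf fL If x xx; rewrite ltNge; apply/negP => fx.
have x1 : `|x| <= 1.
  have := norm_sq_le_dot x; rewrite -[`|x| <= 1](@ler_pXn2r _ 2) ?nnegrE // expr1n; lra.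
suff : c * s ^+ n <= Ipsi (fun x => f x ^+ 2).
  have : 0 < c * s ^+ n by rewrite mulr_gt0 ?exprn_gt0.
  lra.
have s01 : 0 < s <= 1 by rewrite s0 s1.
have := @intQ_cube_ge R n x s x1 s01; rewrite -(ler_pM2l c0) => /le_trans; apply.
rewrite -intQZ; last exact: bnd_box_ind.
apply: intQ_le; [by apply: bndM; [exact: bndC|exact: bnd_box_ind]|by apply: bndpsi; exact: bndX|].
move=> z zQ; have [zx|zx] := pselect (box (x - const_mx s) (x + const_mx s) z); last first.
  by rewrite box_ind_out // mulr0 mulr_ge0 ?psi_ge0 ?sqr_ge0.
rewrite box_ind_in // mulr1.
have zxs : `|z - x| <= s.
  apply: norm_le_coord; first exact: ltW.
  by move=> i; have := zx i; rewrite !mxE ler_norml => /andP[? ?]; apply/andP; split; lra.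
have fz : eta / 2 <= `|f z|.
  have h1 : `|f z - f x| <= eta / 2.
    apply: le_trans (fL _ _ zQ (norm_le1_le2 x1)) _; apply: le_trans s2.
    by rewrite ler_wpM2l.
  have := ler_normD (f z) (f x - f z).
  by rewrite addrC subrK -[`|f x - f z|]normrN opprB; lra.
have fz2 : (eta / 2) ^+ 2 <= f z ^+ 2.
  by rewrite -(real_normK (num_real (f z))) ler_pXn2r ?nnegrE // divr_ge0 // ltW.
have pz : kap <= psi z.
  have : dot z z - dot x x <= 3 * n%:R * s.
    rewrite (_ : _ - _ = dot (z + x) (z - x)); last first.
      by rewrite !(dotDl, dotDr, dotNl, dotNr) (dotC z x); ring.
    apply: le_trans (ler_norm _) _; rewrite [3 * _]mulrC -mulrA; apply: dot_le => //.
    by apply: le_trans (ler_normD _ _) _; lra.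
  have : 1 - dot z z <= hat z by rewrite /hat le_max lexx orbT.
  by rewrite /psi; lra.
by apply: ler_pM => //; rewrite ?exprn_ge0 ?divr_ge0 // ltW.
Qed.

End SupBound.

(** * Blow-ups at points with a lower energy bound *)

Section Blowup.
Variables (R : realType) (n : nat).
Hypothesis n_gt0 : (0 < n)%N.
Local Notation T := 'rV[R]_n.
Local Notation Q := (fun x : T => is_true (`|x| <= 2)).

Implicit Types (U v f u : T -> R) (G g h : T -> T) (x y : T).

(** The reference polynomial |x|^2 / (2 n) of P fixes the energy level [WP] and dominates, up to a
    factor, every test function vanishing quadratically at 0. *)
Definition qmat : 'M[R]_n := (n%:R^-1)%:M.
Definition qpol : T -> R := pA qmat.
Definition gqpol (x : T) : T := x *m qmat.

Lemma qpolE x : qpol x = (2 * n%:R)^-1 * dot x x.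
Proof. by rewrite /qpol pA_dot /qmat mul_mx_scalar dotZl invfM mulrA. Qed.

Lemma nR_gt0 : 0 < n%:R :> R. Proof. by rewrite ltr0n. Qed.

Lemma Pmat_qmat : Pmat qmat.
Proof.
have nN : n%:R != 0 :> R by rewrite gt_eqF // nR_gt0.
split; first by rewrite /qmat tr_scalar_mx.
split; last by rewrite /qmat mxtrace_scalar -[_ *+ n]mulr_natl mulfV.
move=> v; have := dotxx_ge0 v => v0; have := qpolE v; rewrite /qpol /pA => E.
suff : 0 <= 2^-1 * (v *m qmat *m v^T) 0 0 by rewrite pmulr_rge0.
by rewrite E mulr_ge0 // invr_ge0 mulr_ge0.
Qed.

Lemma qpol_homog : homog_sol qpol gqpol.
Proof. exact: pA_homog Pmat_qmat. Qed.

Definition WP : R := Iphi qpol.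

Lemma weiss_homogE U G : homog_sol U G -> weiss U G = WP.
Proof. by move=> Us; rewrite (homog_weiss Us) (homog_Iphi_eq Us qpol_homog). Qed.

Lemma quad_le_qpol (x : T) : `|x| ^+ 2 <= 2 * n%:R * qpol x.
Proof.
rewrite qpolE mulrA mulfV ?mul1r ?norm_sq_le_dot //.
by rewrite mulf_neq0 // gt_eqF // nR_gt0.
Qed.

Ltac bt := repeat first
  [ assumption | apply: bndC | apply: bndB | apply: bndN | apply: bndD
  | apply: bndM | apply: bndX | apply: bnd_dot | apply: vbndB | apply: vbnd_id ].

Lemma weak_pair_lin (g : T -> T) (c : R) C C' f h f' h' : vbnd g ->
  C11 Q C f h -> C11 Q C' f' h' ->
  weak_pair g (fun x => c * f x + f' x) (fun x => c *: h x + h' x) =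
  c * weak_pair g f h + weak_pair g f' h'.
Proof.
move=> bg fC fC'; have bf := bnd_C11 fC; have bf' := bnd_C11 fC'.
have bh := vbnd_C11 fC; have bh' := vbnd_C11 fC'.
rewrite /weak_pair.
have -> : Iphi (fun x => dot (g x) (c *: h x + h' x)) =
   c * Iphi (fun x => dot (g x) (h x)) + Iphi (fun x => dot (g x) (h' x)).
  rewrite -IphiZ; [|by bt]. rewrite -IphiD; [|by bt..].
  by apply: Iphi_ext => x _; rewrite dotDr dotZr.
have -> : Ipsi (fun x => (c * f x + f' x) * dot (g x) x) =
   c * Ipsi (fun x => f x * dot (g x) x) + Ipsi (fun x => f' x * dot (g x) x).
  rewrite -IpsiZ; [|by bt]. rewrite -IpsiD; [|by bt..].
  by apply: Ipsi_ext => x _ _; ring.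
ring.
Qed.

(** By Euler's identity the energy of U is [Iphi U]. Testing Laplacian U <= 1 with [qpol] gives
    [Iphi U <= WP], so equality holds for [qpol]. For |f| <= c qpol, the tests c qpol + f and c qpol
    - f then give the two inequalities for f. *)
Lemma homog_of_sol U G : obstacle_sol U G ->
  (forall x, `|x| <= 2 -> psi x != 0 -> dot (G x) x = 2 * U x) ->
  WP <= weiss U G -> homog_sol U G.
Proof.
move=> Us euler hW; have [C UC] := sol_C11 Us.
have bU := bnd_C11 UC; have bG := vbnd_C11 UC.
have [D UD] := sol_quad Us.
have [Cq qC] := homog_C11 qpol_homog; have bq := bnd_C11 qC; have bgq := vbnd_C11 qC.
have WU : weiss U G = Iphi U.
  have := sol_eq Us; rewrite /weak_pair /weiss.
  rewrite (_ : Ipsi (fun x => U x * dot (G x) x) = 2 * Ipsi (fun x => U x ^+ 2)); first by lra.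
  rewrite -IpsiZ; last by bt.
  by apply: Ipsi_ext => x xQ px; rewrite euler //; ring.
have E1 : weak_pair G qpol gqpol = - Iphi U.
  have := homog_weak qpol_homog UC UD; rewrite /weak_pair.
  rewrite (_ : Iphi (fun x => dot (gqpol x) (G x)) = Iphi (fun x => dot (G x) (gqpol x))); last first.
    by apply: Iphi_ext => x _; rewrite dotC.
  rewrite (_ : Ipsi (fun x => U x * dot (gqpol x) x) = 2 * Ipsi (fun x => qpol x * U x)); last first.
    rewrite -IpsiZ; last by bt.
    by apply: Ipsi_ext => x xQ px; rewrite (homog_euler qpol_homog) //; ring.
  rewrite (_ : Ipsi (fun x => qpol x * dot (G x) x) = 2 * Ipsi (fun x => qpol x * U x)); first by lra.
  rewrite -IpsiZ; last by bt.
  by apply: Ipsi_ext => x xQ px; rewrite euler //; ring.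
have E2 : Iphi U = WP.
  apply/eqP; rewrite eq_le -{2}WU hW andbT.
  by have := sol_sup Us qC (homog_ge0 qpol_homog); rewrite E1 -/WP; lra.
split; [by exists C|exact: sol_ge0 Us|by exists D|exact: euler|].
move=> C' D' f h fC fD; have bf := bnd_C11 fC.
pose c := `|D'| * (2 * n%:R).
have fq x : `|x| <= 2 -> `|f x| <= c * qpol x.
  move=> xQ; apply: le_trans (fD x xQ) _; rewrite /c -mulrA.
  apply: le_trans (ler_wpM2l (normr_ge0 D') (quad_le_qpol x)).
  by rewrite ler_wpM2r ?exprn_ge0 ?ler_norm.
have fN := C11N fC.
have s1 := sol_sup Us (C11D (C11Z c qC) fC) _.
have s2 := sol_sup Us (C11D (C11Z c qC) fN) _.
rewrite (weak_pair_lin c bG qC fC) in s1; rewrite (weak_pair_lin c bG qC fN) in s2.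
have fN1 : weak_pair G (fun x => - f x) (fun x => - h x) = - weak_pair G f h.
  have := weak_pair_lin (-2) bG fC fC.
  rewrite (_ : (fun x => -2 * f x + f x) = (fun x => - f x)); last by apply/funext => x; ring.
  rewrite (_ : (fun x => -2 *: h x + h x) = (fun x => - h x)); first by move=> ->; ring.
  by apply/funext => x; apply/rowP => i; rewrite !mxE; ring.
rewrite fN1 in s2.
rewrite IphiD in s1; [|by bt..]. rewrite IphiZ in s1; last by [].
rewrite IphiD in s2; [|by bt..]. rewrite IphiZ in s2; last by [].
have bN : Iphi (fun x => - f x) = - Iphi f.
  by rewrite -mulN1r -IphiZ //; apply: Iphi_ext => x _; rewrite mulN1r.
rewrite bN in s2; rewrite E1 E2 -/WP in s1 s2.
have t1 : - (c * WP + Iphi f) <= c * - WP + weak_pair G f h.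
  by apply: s1 => x xQ; have := fq x xQ; rewrite ler_norml => /andP[? ?]; lra.
have t2 : - (c * WP - Iphi f) <= c * - WP - weak_pair G f h.
  by apply: s2 => x xQ; have := fq x xQ; rewrite ler_norml => /andP[? ?]; lra.
by apply/eqP; rewrite eq_le; apply/andP; split; lra.
Qed.

Lemma sol_limit C D U G : C11 Q C U G ->
  (forall e : R, 0 < e -> exists v g, [/\ obstacle_sol v g, C11 Q C v g,
     forall x, `|x| <= 2 -> `|v x| <= D * `|x| ^+ 2 & close e v g U G]) ->
  obstacle_sol U G.
Proof.
move=> UC lim; have C0 := C11_ge0 UC.
have small (a K : R) : 0 <= K -> (forall e : R, 0 < e -> a <= K * e) -> a <= 0.
  move=> K0 h; apply/ler_addgt0Pr => e e0; rewrite add0r.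
  have K1 : 0 < K + 1 by rewrite ltr_wpDl.
  apply: le_trans (h _ (divr_gt0 e0 K1)) _; rewrite mulrCA ler_piMr ?(ltW e0) //.
  by rewrite ler_pdivrMr // mul1r lerDl.
have c4 : 0 <= 4 ^+ n :> R by rewrite exprn_ge0.
split.
- by exists C.
- move=> x xQ; rewrite -oppr_le0; apply: (small _ 1) => // e e0.
  have [v [g [vs vC vD vU]]] := lim e e0; have [h _] := vU x xQ.
  by have := sol_ge0 vs xQ; move: h; rewrite ler_norml => /andP[? ?]; lra.
- exists D => x xQ; rewrite -subr_le0; apply: (small _ 1) => // e e0.
  have [v [g [vs vC vD vU]]] := lim e e0; have [h _] := vU x xQ.
  have := vD x xQ; have := ler_normD (v x) (U x - v x).
  by rewrite addrC subrK -[`|U x - v x|]normrN opprB; lra.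
- move=> E f h fE f0; rewrite -subr_le0; have E0 := C11_ge0 fE.
  apply: (small _ (4 ^+ n * (5 * n%:R * E))) => [|e e0]; first by rewrite !mulr_ge0.
  have [v [g [vs vC vD vU]]] := lim e e0; have := sol_sup vs fE f0.
  by have := weak_pair_close vC UC vU fE; rewrite ler_norml => /andP[? ?]; lra.
- apply/eqP; rewrite -subr_eq0 opprK -normr_le0.
  apply: (small _ (4 ^+ n * (10 * n%:R * C) + 4 ^+ n)) => [|e e0].
    by rewrite addr_ge0 ?mulr_ge0.
  have [v [g [vs vC vD vU]]] := lim e e0; have := sol_eq vs.
  have := weak_pair_self_close vC UC vU; have := Iphi_close_val vC UC vU.
  rewrite !ler_norml mulrDl => /andP[? ?] /andP[? ?] ?; apply/andP; split; lra.
Qed.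

Lemma blowup_homog u x0 rho L y : local_sol u x0 rho L -> contact u x0 rho y ->
  (forall r, 0 < r -> r <= rho / 8 -> WP <= weiss_at u y r) ->
  exists U G, homog_sol U G /\ forall e : R, 0 < e -> exists r, 0 < r <= rho / 8 /\
    forall x, `|x| <= 2 -> `|resc u y r x - U x| <= e.
Proof.
move=> us uc hW; have ur := loc_reg us; have r80 : 0 < rho / 8 by rewrite divr_gt0 ?(reg_rho ur).
pose rk k := rho / 8 * mesh R k.
have rk0 k : 0 < rk k by rewrite mulr_gt0 ?mesh_gt0.
have rkle k : rk k <= rho / 8 by rewrite ler_piMr ?(ltW r80) ?mesh_le1.
have rkr k : 0 < rk k <= rho / 8 by rewrite rk0 rkle.
have vC k := resc_C11 ur uc (rkr k).
have [U [G [UC Ucl]]] := C11_compact vC.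
move: (Kreg n L) vC UC => C vC UC; have C0 := C11_ge0 UC.
have Us : obstacle_sol U G.
  apply: (sol_limit (D := L) UC) => e e0; have [k [_ kcl]] := Ucl e e0 0%N.
  exists (resc u y (rk k)), (gresc u y (rk k)); split => //; first exact: resc_sol us uc (rkr k).
  by move=> x xQ; exact: (resc_quad ur uc (rkr k)).
have c4 : 0 <= 4 ^+ n :> R by rewrite exprn_ge0.
have WU : WP <= weiss U G.
  pose K := 4 ^+ n * (n%:R * (2 * C) + 2 + 16 * C).
  have K0 : 0 <= K by rewrite mulr_ge0 // !addr_ge0 // !mulr_ge0.
  have K1 : 0 < K + 1 by rewrite ltr_wpDl.
  apply/ler_addgt0Pr => e e0; have [k [_ kcl]] := Ucl _ (divr_gt0 e0 K1) 0%N.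
  have := weiss_close (vC k) UC kcl; rewrite -/K ler_norml => /andP[h1 h2].
  have h3 : K * (e / (K + 1)) <= e.
    by rewrite mulrCA ler_piMr ?(ltW e0) // ler_pdivrMr // mul1r lerDl.
  by have := hW _ (rk0 k) (rkle k); rewrite /weiss_at; lra.
have bd (v : T -> R) (g : T -> T) : C11 Q C v g -> bnd (fun x => euler_defect v g x ^+ 2).
  move=> vC'; have := bnd_C11 vC'; have := vbnd_C11 vC' => ? ?; rewrite /euler_defect; bt.
have def0 : Ipsi (fun x => euler_defect U G x ^+ 2) <= 0.
  have [K [K0 hK]] := weiss_at_defect us uc.
  pose K2 := 4 ^+ n * (4 * (n%:R + 2) ^+ 2 * C).
  have K20 : 0 <= K2 by rewrite !mulr_ge0 // exprn_ge0 // addr_ge0.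
  apply/ler_addgt0Pr => e e0; rewrite add0r.
  have K21 : 0 < K2 + 1 by rewrite ltr_wpDl.
  have K31 : 0 < 3 * (K + 1) by rewrite mulr_gt0 // ltr_wpDl.
  have e3 : 0 < e / 3 by rewrite divr_gt0.
  pose t := Num.min 1 (e / (3 * (K + 1))).
  have t0 : 0 < t by rewrite lt_min ltr01 divr_gt0.
  have t1 : t <= 1 by rewrite ge_min lexx.
  have tK : K * t <= e / 3.
    have : t <= e / (3 * (K + 1)) by rewrite ge_min lexx orbT.
    rewrite ler_pdivlMr //; nra.
  (* At a scale r0 whose energy is within t e / 3 of the infimum, monotonicity leaves at most that
     gain between [rk k] and [rk k * (1 + t)] once the latter is below r0. Dividing by t bounds the
     integrated squared defect by e / 3 + K t. *)
  pose S := [set weiss_at u y r | r in [set r | 0 < r <= rho / 8]].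
  have S0 : S !=set0 by exists (weiss_at u y (rho / 8)), (rho / 8) => //=; rewrite r80 lexx.
  have Slb : has_lbound S by exists WP => _ [r /andP[? ?] <-]; exact: hW.
  have te : 0 < t * (e / 3) by rewrite mulr_gt0.
  have [_ [r0 /andP[r00 r01] <-] hr0] := inf_adherent te (conj S0 Slb).
  have [k0 hk0] := mesh_small (divr_gt0 (divr_gt0 r00 (ltr0n _ 2)) r80).
  have [k [kk kcl]] := Ucl _ (divr_gt0 e3 K21) k0.
  have rkt : rk k * (1 + t) <= r0.
    have := hk0 k kk; rewrite ltr_pdivlMr // mulrC -/(rk k) => h.
    have : rk k * (1 + t) <= rk k * 2 by rewrite ler_pM2l ?rk0 //; lra.
    by lra.
  have t01 : 0 <= t <= 1 by rewrite t1 (ltW t0).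
  have h1 := hK (rk k) t (rk0 k) t01 (le_trans rkt r01).
  have rkt0 : 0 < rk k * (1 + t) by rewrite mulr_gt0 ?rk0 // ltr_wpDl // ltW.
  have h2 := weiss_at_mono us uc rkt0 rkt r01.
  have h3 : inf S <= weiss_at u y (rk k).
    by apply: ge_inf => //; exists (rk k) => //; exact: rkr.
  have h4 := defect_close (vC k) UC kcl; rewrite -/K2 in h4.
  have h5 : K2 * (e / 3 / (K2 + 1)) <= e / 3.
    by rewrite mulrCA ler_piMr ?(ltW e3) // ler_pdivrMr // mul1r lerDl.
  move: h4 h1; rewrite ler_norml; set I1 := Ipsi _; set I2 := Ipsi _ => /andP[h4 h4'] h1.
  have h6 : t * I1 <= t * (e / 3 + K * t) by rewrite expr2 in h1; lra.
  rewrite ler_pM2l // in h6; lra.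
exists U, G; split; last first.
  move=> e e0; have [k [_ kcl]] := Ucl e e0 0%N; exists (rk k); split => // x /kcl[] //.
apply: homog_of_sol => // x xQ px.
have hx : 0 < 1 - dot x x.
  rewrite ltNge; apply/negP => h; case/negP: px.
  by rewrite /psi /hat (max_idPl h) mulr0.
(* The defect is Lipschitz with vanishing weighted square integral; by [Ipsi_sup] it cannot exceed
   its own value at x. *)
apply/eqP; rewrite -subr_eq0 -normr_eq0; apply/negPn/negP => ne.
have eta0 : 0 < `|dot (G x) x - 2 * U x| by rewrite lt_neqAle eq_sym ne normr_ge0.
pose Ld := n%:R * (2 * C + C) + 2 * C.
have Ld0 : 0 <= Ld by rewrite !addr_ge0 // !mulr_ge0 // addr_ge0 // mulr_ge0.
have [e [e0 he]] := Ipsi_sup n Ld0 eta0 hx.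
have bU := bnd_C11 UC; have bG := vbnd_C11 UC.
have := he (euler_defect U G) _ _ (le_trans def0 (ltW e0)) x.
rewrite /euler_defect ltxx => h; suff : is_true false by []; apply: h; last by lra.
- by bt.
- move=> z w zQ wQ; have h1 := C11_glip UC wQ zQ; have h2 := C11_lip UC wQ zQ.
  rewrite (_ : _ - _ = dot (G z - G w) z + dot (G w) (z - w) - 2 * (U z - U w)); last first.
    by rewrite dotBl dotBr; ring.
  apply: le_trans (ler_normB _ _) _; apply: le_trans (lerD (ler_normD _ _) (lexx _)) _.
  have h3 := dot_le h1 zQ; have h4 := dot_le (C11_grad UC wQ) (lexx `|z - w|).
  rewrite normrM (@ger0_norm _ 2) // /Ld; lra.
Qed.

End Blowup.

Lemma derive_of_taylor (R : realType) (n : nat) (f : 'rV[R]_n -> R) (x v : 'rV[R]_n) (l C r : R) :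
  0 < r -> (forall h : R, `|h| < r -> `|f (x + h *: v) - f x - h * l| <= C * h ^+ 2) ->
  'D_v f x = l.
Proof.
move=> r0 hT; apply: cvg_lim => //; apply/cvgrPdist_le => e e0.
have C1 : 0 < `|C| + 1 by rewrite ltr_wpDl.
have d0 : 0 < Num.min r (e / (`|C| + 1)) by rewrite lt_min r0 divr_gt0.
rewrite /dnbhs /within /=; apply/nbhs_ballP; exists (Num.min r (e / (`|C| + 1))) => // h.
rewrite /ball /= sub0r normrN lt_min => /andP[hr he] hN /=.
have h0 : 0 < `|h| by rewrite normr_gt0.
rewrite distrC /GRing.scale /= [h *: v + x]addrC.
rewrite (_ : _ - l = h^-1 * (f (x + h *: v) - f x - h * l)); last by field.
rewrite normrM normfV mulrC ler_pdivrMr //; apply: le_trans (hT h hr) _.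
rewrite -(real_normK (num_real h)) expr2 mulrA ler_pM2r //.
move: he; rewrite ltr_pdivlMr // mulrC => /ltW; apply: le_trans.
by rewrite ler_wpM2r // (le_trans (ler_norm C)) // lerDl.
Qed.

(** * Matrices of P *)

Section PmatFacts.
Variables (R : realType) (n : nat).
Implicit Types (A B : 'M[R]_n) (x y v : 'rV[R]_n).

Lemma Pmat_dot A v : Pmat A -> 0 <= dot (v *m A) v.
Proof.
move=> [_ [Ap _]]; have := Ap v; have := pA_dot A v; rewrite /pA => h.
by rewrite (_ : (v *m A *m v^T) 0 0 = dot (v *m A) v) //; lra.
Qed.

Lemma evec_mul A i : evec R i *m A = row i A.
Proof. by rewrite /evec -rowE. Qed.

Lemma dot_evec_mul A i j : dot (evec R i *m A) (evec R j) = A i j.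
Proof. by rewrite evec_mul dot_evec mxE. Qed.

(** Positivity on e_i + e_j and e_i - e_j bounds an entry by the mean of two diagonal entries, which
    are at most the trace. *)
Lemma Pmat_norm A : Pmat A -> `|A| <= 1.
Proof.
move=> AP; have [As [_ At]] := AP.
have d0 i : 0 <= A i i by rewrite -dot_evec_mul Pmat_dot.
have d1 i : A i i <= 1.
  by rewrite -At /mxtrace (bigD1 i) //= lerDl sumr_ge0.
rewrite [leLHS]/Num.norm /= mx_normrE; apply/bigmax_leP; split => // -[i j] _ /=.
have Aij : A j i = A i j by rewrite -[in LHS]As mxE.
have p := Pmat_dot (evec R i + evec R j) AP; have m := Pmat_dot (evec R i - evec R j) AP.
rewrite !(mulmxDl, mulmxBl, mulNmx, dotDl, dotDr, dotNl, dotNr) !dot_evec_mul Aij in p m.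
by have := d1 i; have := d1 j; rewrite ler_norml => ? ?; apply/andP; split; lra.
Qed.

(** Cauchy-Schwarz for the semidefinite form of A, with e_i as second vector and A_ii <= 1. It turns
    smallness of the polynomial at v into smallness of its gradient there. *)
Lemma Pmat_cauchy A v (e : R) : Pmat A -> 0 <= e -> 2 * pA A v <= e ^+ 2 -> `|v *m A| <= e.
Proof.
move=> AP e0 h; have [As [_ At]] := AP; apply: norm_le_coord => // i.
have d1 : A i i <= 1.
  rewrite -At /mxtrace (bigD1 i) //= lerDl sumr_ge0 // => j _.
  by rewrite -dot_evec_mul Pmat_dot.
rewrite -(@ler_pXn2r _ 2) ?nnegrE // real_normK ?num_real //.
set t := (v *m A) 0 i; have tE : dot (v *m A) (evec R i) = t by rewrite dot_evec.
have tE' : dot (evec R i *m A) v = t by rewrite dot_mulmx_sym.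
have := Pmat_dot (v - t *: evec R i) AP.
rewrite !(mulmxBl, dotBl, dotBr) -!scalemxAl !(dotZl, dotZr) tE tE' dot_evec_mul.
rewrite pA_dot in h; have := sqr_ge0 t; nra.
Qed.

Lemma pA_scale A (c : R) x : pA A (c *: x) = c ^+ 2 * pA A x.
Proof. by rewrite !pA_dot -scalemxAl dotZl dotZr; ring. Qed.

Lemma pA_sub A B x : pA A x - pA B x = pA (A - B) x.
Proof. by rewrite !pA_dot mulmxBr dotBl; ring. Qed.

(** Polarization with c e_i, c e_j and c (e_i + e_j), all of sup norm at most c for distinct i and
    j; three values enter, hence the 3. *)
Lemma sym_norm_le B (c eta : R) : B^T = B -> 0 < c -> 0 <= eta ->
  (forall x, `|x| <= c -> `|pA B x| <= eta) -> `|B| <= 3 * eta / c ^+ 2.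
Proof.
move=> Bs c0 eta0 h; have c2 : 0 < c ^+ 2 by rewrite exprn_gt0.
rewrite [leLHS]/Num.norm /= mx_normrE; apply/bigmax_leP; split.
  by rewrite divr_ge0 ?mulr_ge0 // ltW.
move=> [i j] _ /=; rewrite ler_pdivlMr // -{1}(ger0_norm (ltW c2)) -normrM.
have Bij : B j i = B i j by rewrite -[in LHS]Bs mxE.
have bi (k : 'I_n) : `|c *: evec R k| <= c.
  by rewrite normrZ (gtr0_norm c0) ler_piMr ?norm_evec ?ltW.
have bij : i != j -> `|c *: (evec R i + evec R j)| <= c.
  move=> ij; rewrite normrZ (gtr0_norm c0) ler_piMr ?(ltW c0) //.
  apply: norm_le_coord => // k; rewrite !mxE eqxx /=.
  have [->|] := eqVneq k i; first by rewrite (negPf ij) addr0 normr1.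
  by move=> _; rewrite /= add0r; case: (k == j); rewrite ?normr1 ?normr0.
have hk k : `|c ^+ 2 * B k k| <= 2 * eta.
  have := h _ (bi k); rewrite pA_scale pA_dot dot_evec_mul.
  by rewrite mulrCA normrM ger0_norm //; lra.
have [<-|ij] := eqVneq i j; first by have := hk i; rewrite mulrC; lra.
have := h _ (bij ij); rewrite pA_scale pA_dot.
rewrite !(mulmxDl, dotDl, dotDr) !dot_evec_mul Bij.
have := hk i; have := hk j; rewrite !ler_norml => /andP[? ?] /andP[? ?] /andP[? ?].
by apply/andP; split; lra.
Qed.

End PmatFacts.

(** * Uniform estimates along the stratum *)

Section Stratum.
Variables (R : realType) (n : nat).
Hypothesis n_gt0 : (0 < n)%N.
Local Notation T := 'rV[R]_n.
Local Notation Q := (fun x : T => is_true (`|x| <= 2)).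
Implicit Types (U v f u : T -> R) (G g h : T -> T) (x y z : T).

Lemma partial_pA (A : 'M[R]_n) i x : A^T = A -> partial i (pA A) x = (x *m A) 0 i.
Proof.
move=> As; apply: (@derive_of_taylor _ _ _ _ _ _ `|2^-1 * A i i| 1) => // h _.
rewrite !pA_dot mulmxDl -!scalemxAl !(dotDl, dotDr, dotZl, dotZr).
rewrite dot_evec dot_evec_mul (dot_mulmx_sym _ x As) dot_evec.
rewrite (_ : _ - _ = (2^-1 * A i i) * h ^+ 2); last by field.
by rewrite normrM (ger0_norm (sqr_ge0 h)).
Qed.

Lemma partial_resc u x0 rho L y r x i : regular u x0 rho L -> `|y - x0| <= rho / 2 ->
  0 < r <= rho / 8 -> `|x| <= 2 -> partial i (resc u y r) x = gresc u y r x 0 i.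
Proof.
move=> ur yx rr xQ; have /andP[r0 r1] := rr.
apply: (@derive_of_taylor _ _ _ _ _ _ L 1) => // h h1.
have in1 := resc_in yx rr xQ.
have in2 : `|y + r *: (x + h *: evec R i) - x0| < rho.
  rewrite addrAC; apply: le_lt_trans (ler_normD _ _) _; rewrite normrZ (gtr0_norm r0).
  have : `|x + h *: evec R i| <= 3.
    apply: le_trans (ler_normD _ _) _; rewrite normrZ.
    have : `|h| * `|evec R i| <= 1 * 1 by rewrite ler_pM // ?norm_evec // ltW.
    lra.
  have rho0 := reg_rho ur.
  move=> h3; have : r * `|x + h *: evec R i| <= rho / 8 * 3 by rewrite ler_pM // ltW.
  lra.
have := reg_taylor ur in1 in2.
have -> : y + r *: (x + h *: evec R i) - (y + r *: x) = (r * h) *: evec R i.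
  by rewrite opprD addrACA subrr add0r -scalerBr addrC addKr scalerA.
rewrite dotZr dot_evec normrZ => hh.
have rN : r != 0 by rewrite gt_eqF.
have -> : gresc u y r x 0 i = r^-1 * grad u (y + r *: x) 0 i by rewrite /gresc mxE.
rewrite /resc.
rewrite (_ : _ - _ = (u (y + r *: (x + h *: evec R i)) - u (y + r *: x) -
   r * h * grad u (y + r *: x) 0 i) / r ^+ 2); last by field.
have r2 : 0 < r ^+ 2 by rewrite exprn_gt0.
rewrite normrM normfV (gtr0_norm r2) ler_pdivrMr //; apply: le_trans hh _.
rewrite -mulrA ler_wpM2l ?(reg_L ur) // exprMn normrM exprMn (gtr0_norm r0).
apply: (@le_trans _ _ (r ^+ 2 * `|h| ^+ 2 * 1)).
  have : 0 <= r ^+ 2 * `|h| ^+ 2 by rewrite mulr_ge0 ?exprn_ge0 // ltW.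
  by move=> p; rewrite ler_wpM2l // exprn_ile1 ?norm_evec.
by rewrite mulr1 real_normK ?num_real // mulrC.
Qed.

Lemma blowup_close u x0 rho L y (A : 'M[R]_n) (e : R) : regular u x0 rho L ->
  `|y - x0| <= rho / 2 -> full_blowup u y A -> 0 < e ->
  exists d : R, 0 < d /\ forall r, 0 < r -> r < d -> r <= rho / 8 ->
    close e (resc u y r) (gresc u y r) (pA A) (fun x => x *m A).
Proof.
move=> ur yx [AP hA] e0; have [As _] := AP.
have [d [d0 hd]] := hA 2 e e0; exists d; split => // r r0 rd r8 x xQ.
have rr : 0 < r <= rho / 8 by rewrite r0.
have [h1 h2] := hd r r0 rd x xQ; split => //.
apply: norm_le_coord; first exact: ltW.
by move=> i; have := h2 i; rewrite (partial_resc _ ur yx rr xQ) partial_pA // !mxE.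
Qed.

Lemma le0_of_small (a K d : R) : 0 < d -> 0 <= K ->
  (forall r, 0 < r -> r < d -> a <= K * r) -> a <= 0.
Proof.
move=> d0 K0 h; apply/ler_addgt0Pr => e e0; rewrite add0r.
have K1 : 0 < K + 1 by rewrite ltr_wpDl.
pose r := Num.min (d / 2) (e / (K + 1)).
have r0 : 0 < r by rewrite lt_min !divr_gt0.
have rd : r < d by rewrite gt_min; apply/orP; left; lra.
apply: le_trans (h r r0 rd) _.
have : r <= e / (K + 1) by rewrite ge_min lexx orbT.
rewrite ler_pdivlMr //; have := mulr_ge0 K0 (ltW r0); lra.
Qed.

(** Closeness of the rescalings at x = 0 bounds [u y / r^2] and [grad u y / r] as r tends to 0. *)
Lemma blowup_contact u x0 rho L y (A : 'M[R]_n) : regular u x0 rho L ->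
  `|y - x0| <= rho / 2 -> full_blowup u y A -> contact u x0 rho y.
Proof.
move=> ur yx hA; have [d [d0 hd]] := blowup_close ur yx hA ltr01.
have rho8 : 0 < rho / 8 by rewrite divr_gt0 ?(reg_rho ur).
have m0 : 0 < Num.min 1 (Num.min d (rho / 8)) by rewrite !lt_min ltr01 d0.
have Q0 : `|0 : T| <= 2 by rewrite normr0.
split => //.
- apply/eqP; rewrite -normr_le0; apply: (le0_of_small m0 ler01) => r r0.
  rewrite !lt_min mul1r => /and3P[r1 rd r8].
  have [h _] := hd r r0 rd (ltW r8) 0 Q0; move: h.
  rewrite /resc /pA mul0mx mul0mx mxE mulr0 subr0 scaler0 addr0 normrM normfV.
  rewrite (gtr0_norm (exprn_gt0 2 r0)) ler_pdivrMr ?exprn_gt0 // mul1r => /le_trans; apply.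
  by rewrite expr2 ler_piMr // ltW.
- apply/eqP; rewrite -normr_le0; apply: (le0_of_small m0 ler01) => r r0.
  rewrite !lt_min mul1r => /and3P[r1 rd r8].
  have [_ h] := hd r r0 rd (ltW r8) 0 Q0; move: h.
  rewrite /gresc mul0mx subr0 scaler0 addr0 normrZ normfV (gtr0_norm r0).
  by rewrite mulrC ler_pdivrMr // mul1r.
Qed.

Lemma C11_common u x0 rho L y r (A : 'M[R]_n) : regular u x0 rho L -> contact u x0 rho y ->
  0 < r <= rho / 8 -> Pmat A ->
  C11 Q (Kreg n L + 2 * (n%:R + n%:R * n%:R)) (resc u y r) (gresc u y r) /\
  C11 Q (Kreg n L + 2 * (n%:R + n%:R * n%:R)) (pA A) (fun x => x *m A).
Proof.
move=> ur uc rr AP; have vC := resc_C11 ur uc rr; have K0 := C11_ge0 vC.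
have n0 : 0 <= n%:R :> R by []; have nn : 0 <= n%:R * n%:R :> R by rewrite mulr_ge0.
split; first by apply: C11_weaken vC; lra.
apply: C11_weaken (C11_pA_norm AP.1); have A1 := Pmat_norm AP.
have h1 : n%:R * `|A| <= n%:R by rewrite ler_piMr.
have h2 : n%:R * (n%:R * `|A|) <= n%:R * n%:R by rewrite ler_wpM2l.
lra.
Qed.

Lemma small_range (d b : R) : 0 < d -> 0 < b -> exists r, [/\ 0 < r, r < d & r <= b].
Proof.
move=> d0 b0; exists (Num.min (d / 2) b); split.
- by rewrite lt_min b0 divr_gt0.
- by rewrite gt_min; apply/orP; left; lra.
- by rewrite ge_min lexx orbT.
Qed.

(** The energy decreases as the scale tends to 0, and its limit there is that of a polynomial of
    P. *)
Lemma weiss_at_ge u x0 rho L y (A : 'M[R]_n) r : local_sol u x0 rho L ->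
  `|y - x0| <= rho / 2 -> full_blowup u y A -> 0 < r -> r <= rho / 8 ->
  @WP R n <= weiss_at u y r.
Proof.
move=> us yx hA r0 r8; have ur := loc_reg us; have uc := blowup_contact ur yx hA.
have AP := hA.1; have Ah := pA_homog AP.
pose C := Kreg n L + 2 * (n%:R + n%:R * n%:R).
pose K := 4 ^+ n * (n%:R * (2 * C) + 2 + 16 * C).
have rr : 0 < r <= rho / 8 by rewrite r0.
have [_ UC] := C11_common ur uc rr AP; rewrite -/C in UC.
have C0 : 0 <= C := C11_ge0 UC.
have K0 : 0 <= K.
  have nC : 0 <= n%:R * (2 * C) by apply: mulr_ge0 => //; apply: mulr_ge0.
  by rewrite /K; apply: mulr_ge0; [exact: exprn_ge0|lra].
have K1 : 0 < K + 1 by rewrite ltr_wpDl.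
apply/ler_addgt0Pr => e e0; have e1 := divr_gt0 e0 K1.
have [d [d0 hd]] := blowup_close ur yx hA e1.
have [s [s0 sd sr]] := small_range d0 r0.
have s8 := le_trans sr r8; have ss : 0 < s <= rho / 8 by rewrite s0.
have [vC _] := C11_common ur uc ss AP.
have := weiss_close vC UC (hd s s0 sd s8); rewrite -/C -/K.
rewrite (weiss_homogE n_gt0 Ah) ler_norml => /andP[h1 _].
have h2 : K * (e / (K + 1)) <= e.
  by rewrite mulrCA ler_piMr ?(ltW e0) // ler_pdivrMr // mul1r lerDl.
have := weiss_at_mono us uc s0 sr r8; rewrite /weiss_at in h1 *; lra.
Qed.

(** Monneau's monotonicity down to scale 0, where the rescalings become [pA A]. *)
Lemma Ipsi_le_resc u x0 rho L y (A : 'M[R]_n) r U G : local_sol u x0 rho L ->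
  `|y - x0| <= rho / 2 -> full_blowup u y A -> homog_sol U G -> 0 < r -> r <= rho / 8 ->
  Ipsi (fun x => (pA A x - U x) ^+ 2) <= Ipsi (fun x => (resc u y r x - U x) ^+ 2).
Proof.
move=> us yx hA Us r0 r8; have ur := loc_reg us; have uc := blowup_contact ur yx hA.
have AP := hA.1; have [D UD] := homog_C11 Us; have D0 := C11_ge0 UD.
have bU := bnd_C11 UD.
have rr : 0 < r <= rho / 8 by rewrite r0.
pose C := Kreg n L + 2 * (n%:R + n%:R * n%:R).
have [_ UC] := C11_common ur uc rr AP; rewrite -/C in UC.
have C0 : 0 <= C := C11_ge0 UC.
pose K := 4 ^+ n * (2 * (2 * (C + D))).
have K0 : 0 <= K by rewrite /K mulr_ge0 ?exprn_ge0 // !mulr_ge0 // addr_ge0.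
have K1 : 0 < K + 1 by rewrite ltr_wpDl.
apply/ler_addgt0Pr => e e0; have e1 := divr_gt0 e0 K1.
have [d [d0 hd]] := blowup_close ur yx hA e1.
have [s [s0 sd sr]] := small_range d0 r0.
have s8 := le_trans sr r8; have ss : 0 < s <= rho / 8 by rewrite s0.
have [vC _] := C11_common ur uc ss AP; rewrite -/C in vC.
have hW t : 0 < t -> t <= rho / 8 -> weiss U G <= weiss_at u y t.
  by move=> t0 t8; rewrite (weiss_homogE n_gt0 Us); exact: weiss_at_ge us yx hA t0 t8.
have mono := monneau_mono us uc Us hW s0 sr r8.
have cl := hd s s0 sd s8.
have b1 : bnd (fun x => (resc u y s x - U x) ^+ 2).
  by apply: bndX; apply: bndB => //; exact: bnd_C11 vC.
have b2 : bnd (fun x => (pA A x - U x) ^+ 2).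
  by apply: bndX; apply: bndB => //; exact: bnd_C11 UC.
have pt x : `|x| <= 1 -> `|(resc u y s x - U x) ^+ 2 - (pA A x - U x) ^+ 2|
    <= 2 * (C + D) * (e / (K + 1)).
  move=> x1; apply: (close_sq vC UC cl D0 x1).
  by apply: (C11_val UD); exact: norm_le1_le2.
have := Ipsi_close b1 b2 pt.
rewrite (_ : _ * (2 * _) = K * (e / (K + 1))); last by rewrite /K; ring.
have h2 : K * (e / (K + 1)) <= e.
  by rewrite mulrCA ler_piMr ?(ltW e0) // ler_pdivrMr // mul1r lerDl.
by rewrite ler_norml => /andP[h1 _]; lra.
Qed.

(** Continuity in the centre at one fixed scale; [d] shrinks with r. Only the monotonicity formulas
    make the outcome uniform over small scales. *)
Lemma resc_center_close u x0 rho L y' r (e : R) : regular u x0 rho L -> contact u x0 rho y' ->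
  0 < r <= rho / 8 -> 0 < e -> exists d : R, 0 < d /\ forall y, `|y - x0| <= rho / 2 ->
    `|y - y'| < d -> close e (resc u y r) (gresc u y r) (resc u y' r) (gresc u y' r).
Proof.
move=> ur uc rr e0; have [yx uy gy] := uc; have /andP[r0 r8] := rr; have L0 := reg_L ur.
have yin : `|y' - x0| < rho by have := reg_rho ur; lra.
pose K := n%:R * (2 * r * L) + L + 1.
have n0 : 0 <= n%:R * (2 * r * L) by rewrite !mulr_ge0 // ltW.
have K0 : 0 < K by rewrite /K; lra.
have r2 : 0 < r ^+ 2 by rewrite exprn_gt0.
have d1 : 0 < e * r ^+ 2 / K by rewrite divr_gt0 // mulr_gt0.
have d2 : 0 < e * r / K by rewrite divr_gt0 // mulr_gt0.
exists (Num.min 1 (Num.min (e * r ^+ 2 / K) (e * r / K))); split.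
  by rewrite !lt_min ltr01 d1.
move=> y yx' ; rewrite !lt_min => /and3P[y1 /ltW yd1 /ltW yd2] x xQ.
have in1 := resc_in yx rr xQ; have in2 := resc_in yx' rr xQ.
have E : y + r *: x - (y' + r *: x) = y - y' by rewrite opprD addrACA subrr addr0.
have t := reg_taylor ur in1 in2; have l := reg_glip ur in1 in2.
have l0 := reg_glip ur yin in1; rewrite E in t l.
rewrite gy subr0 (_ : y' + r *: x - y' = r *: x) in l0; last by rewrite addrC addKr.
have D0 := normr_ge0 (y - y'); set D := `|y - y'| in t l yd1 yd2 D0 y1.
rewrite ler_pdivlMr // in yd1; rewrite ler_pdivlMr // in yd2.
split.
- rewrite /resc -mulrBl normrM normfV (gtr0_norm r2) ler_pdivrMr //.
  have g2 : `|grad u (y' + r *: x)| <= 2 * r * L.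
    apply: le_trans l0 _; rewrite normrZ (gtr0_norm r0).
    have : r * `|x| <= r * 2 by rewrite ler_pM2l.
    nra.
  have dd := dot_le g2 (lexx D); rewrite -/D in dd.
  have DD : L * D ^+ 2 <= L * D by rewrite ler_wpM2l // expr2 ler_piMr // ltW.
  have := ler_normD (u (y + r *: x) - u (y' + r *: x) - dot (grad u (y' + r *: x)) (y - y'))
    (dot (grad u (y' + r *: x)) (y - y')).
  rewrite subrK => /le_trans; apply; apply: le_trans yd1; rewrite /K.
  by lra.
- rewrite /gresc -scalerBr normrZ normfV (gtr0_norm r0) mulrC ler_pdivrMr //.
  apply: le_trans l _; apply: le_trans yd2; rewrite /K.
  have := mulr_ge0 n0 D0; lra.
Qed.

(* A subsequential blow-up [U] at [y0], a limit of singular points, is homogeneous. By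
   Monneau's monotonicity, [resc u y s] is then close to [U], and to [pA (A y)], for all
   singular [y] near [y0] and all small [s], uniformly. For the second estimate evaluate
   at the contact point [z], at the scale [s] comparable to [|z - y|]. *)
Lemma stratum_key u x0 rho L (E : set T) (A : T -> 'M[R]_n) y0 : local_sol u x0 rho L ->
  (forall y, E y -> `|y - x0| <= rho / 2 /\ full_blowup u y (A y)) ->
  `|y0 - x0| <= rho / 2 -> (forall d : R, 0 < d -> exists y, E y /\ `|y - y0| < d) ->
  forall e : R, 0 < e -> exists d : R, 0 < d /\ forall y z, E y -> E z ->
    `|y - y0| < d -> `|z - y0| < d ->
    `|A y - A z| <= e /\ `|(z - y) *m A y| <= e * `|z - y|.
Proof.
move=> us EA y0x adh e e0; have ur := loc_reg us; have rho0 := reg_rho ur; have L0 := reg_L ur.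
have rho8 : 0 < rho / 8 by rewrite divr_gt0.
have inE y : E y -> `|y - x0| < rho by move=> /EA[+ _]; lra.
have y0in : `|y0 - x0| < rho by lra.
have Ec y : E y -> contact u x0 rho y by move=> /EA[h1 h2]; exact: (blowup_contact ur h1 h2).
have uc : contact u x0 rho y0.
  split => //.
  - apply/eqP; rewrite -normr_le0; apply: (le0_of_small ltr01 L0) => r r0 r1.
    have [y [Ey yr]] := adh r r0; have [_ uy gy] := Ec y Ey.
    have := reg_taylor ur (inE _ Ey) y0in; rewrite uy gy dot0l !subr0 => /le_trans; apply.
    rewrite ler_wpM2l // distrC expr2; have := normr_ge0 (y - y0); nra.
  - apply/eqP; rewrite -normr_le0; apply: (le0_of_small ltr01 L0) => r r0 r1.
    have [y [Ey yr]] := adh r r0; have [_ uy gy] := Ec y Ey.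
    have := reg_glip ur (inE _ Ey) y0in; rewrite gy subr0 => /le_trans; apply.
    by rewrite ler_wpM2l // distrC ltW.
(* The point y0 is only a limit of points of [E]: at each fixed scale the energy bound passes to it
   by continuity in the centre. *)
have hW r : 0 < r -> r <= rho / 8 -> @WP R n <= weiss_at u y0 r.
  move=> r0 r8; have rr : 0 < r <= rho / 8 by rewrite r0.
  have vC := resc_C11 ur uc rr; have C0 := C11_ge0 vC.
  pose K := 4 ^+ n * (n%:R * (2 * Kreg n L) + 2 + 16 * Kreg n L).
  have K0 : 0 <= K.
    have nC : 0 <= n%:R * (2 * Kreg n L) by apply: mulr_ge0 => //; apply: mulr_ge0.
    by rewrite /K; apply: mulr_ge0; [exact: exprn_ge0|lra].
  have K1 : 0 < K + 1 by rewrite ltr_wpDl.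
  apply/ler_addgt0Pr => t t0; have t1 := divr_gt0 t0 K1.
  have [d [d0 hd]] := resc_center_close ur uc rr t1.
  have [y [Ey yd]] := adh d d0; have [yx hA] := EA y Ey.
  have := weiss_close (resc_C11 ur (Ec y Ey) rr) vC (hd y yx yd); rewrite -/K ler_norml => /andP[_ h].
  have h2 : K * (t / (K + 1)) <= t.
    by rewrite mulrCA ler_piMr ?(ltW t0) // ler_pdivrMr // mul1r lerDl.
  by have := weiss_at_ge us yx hA r0 r8; rewrite /weiss_at in h *; lra.
have [U [G [Us Ucl]]] := blowup_homog n_gt0 us uc hW.
have [D UD] := homog_C11 Us; have bU := bnd_C11 UD.
have c4 : 0 < 4 ^+ n :> R by rewrite exprn_gt0.
have unif (m : R) : 0 < m -> exists r d : R, [/\ 0 < r, r <= rho / 8, 0 < d &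
    forall y, E y -> `|y - y0| < d -> Ipsi (fun x => (pA (A y) x - U x) ^+ 2) <= m /\
      forall s, 0 < s -> s <= r -> Ipsi (fun x => (resc u y s x - U x) ^+ 2) <= m].
  (* The rescaling at y is within t of that at y0, which is within t of U; the squared distance
     integrates to at most 8 4^n t^2. *)
  move=> m0; pose t := Num.min 1 (m / (8 * 4 ^+ n)).
  have t0 : 0 < t by rewrite lt_min ltr01 divr_gt0 // mulr_gt0.
  have tm : 4 ^+ n * (2 * (t + t) ^+ 2) <= m.
    have : t <= m / (8 * 4 ^+ n) by rewrite ge_min lexx orbT.
    have : t <= 1 by rewrite ge_min lexx.
    rewrite ler_pdivlMr ?mulr_gt0 // => t1 h; have : t ^+ 2 <= t by rewrite expr2 ler_piMr // ltW.
    rewrite -(ler_pM2l c4); lra.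
  have [r [/andP[r0 r8] hr]] := Ucl t t0; have rr : 0 < r <= rho / 8 by rewrite r0.
  have [d [d0 hd]] := resc_center_close ur uc rr t0.
  exists r, d; split => // y Ey yd; have [yx hA] := EA y Ey; have yc := Ec y Ey.
  have hWU s : 0 < s -> s <= rho / 8 -> weiss U G <= weiss_at u y s.
    by move=> s0 s8; rewrite (weiss_homogE n_gt0 Us); exact: weiss_at_ge us yx hA s0 s8.
  have top : Ipsi (fun x => (resc u y r x - U x) ^+ 2) <= m.
    apply: le_trans tm; apply: le_trans (ler_norm _) _; apply: Ipsi_abs => x x1.
    have xQ := norm_le1_le2 x1; rewrite ger0_norm ?sqr_ge0 //.
    rewrite -(real_normK (num_real (_ - _))) ler_pXn2r ?nnegrE ?addr_ge0 ?(ltW t0) //.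
    have [h1 _] := hd y yx yd x xQ; have h2 := hr x xQ.
    rewrite (_ : _ - _ = (resc u y r x - resc u y0 r x) + (resc u y0 r x - U x)); last by ring.
    by apply: le_trans (ler_normD _ _) _; rewrite lerD.
  split; first exact: le_trans (Ipsi_le_resc us yx hA Us r0 r8) top.
  by move=> s s0 sr; exact: le_trans (monneau_mono us yc Us hWU s0 sr r8) top.
pose C := Kreg n L + 2 * (n%:R + n%:R * n%:R).
have C0 : 0 <= C.
  have : 0 <= Kreg n L by rewrite mulr_ge0 // addr_ge0 // mulr_ge0.
  have : 0 <= n%:R * n%:R :> R by rewrite mulr_ge0.
  by have : 0 <= n%:R :> R by []; rewrite /C; lra.
have nn1 : 0 < 2 * (n%:R + 1) :> R by rewrite mulr_gt0 // ltr_wpDl.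
(* The sup ball of radius [k] lies in the region [dot x x <= 1 - 1/2] where [Ipsi_sup] gives
   pointwise bounds. *)
pose k : R := (2 * (n%:R + 1))^-1; have k0 : 0 < k by rewrite invr_gt0.
have k2 : 0 < k ^+ 2 by rewrite exprn_gt0.
have nk : n%:R * k ^+ 2 <= 1 - 2^-1.
  rewrite /k exprVn ler_pdivrMr ?exprn_gt0 //; have : 0 <= n%:R :> R by [].
  nra.
have dk x : `|x| <= k -> dot x x <= 1 - 2^-1.
  move=> xk; apply: le_trans nk; apply: le_trans (dotxx_le x) _.
  by rewrite ler_wpM2l // ler_pXn2r ?nnegrE // ltW.
(* The first bound serves [sym_norm_le], the second [Pmat_cauchy]. *)
pose eta := Num.min (e * k ^+ 2 / 3) (e ^+ 2 * k ^+ 2 / 2).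
have eta0 : 0 < eta by rewrite lt_min !divr_gt0 // mulr_gt0 // exprn_gt0.
have eta1 : 3 * eta / k ^+ 2 <= e.
  have : eta <= e * k ^+ 2 / 3 by rewrite ge_min lexx.
  by rewrite ler_pdivrMr //; lra.
have eta2 : 2 * eta <= e ^+ 2 * k ^+ 2.
  have : eta <= e ^+ 2 * k ^+ 2 / 2 by rewrite ge_min lexx orbT.
  by lra.
have half : 0 < 2^-1 :> R by rewrite invr_gt0.
have CC0 : 0 <= C + C by rewrite addr_ge0.
have [t [t0 ht]] := Ipsi_sup n CC0 eta0 half.
(* With t / 4 for each of v and w, the inequality (v - w)^2 <= 2 (v - U)^2 + 2 (w - U)^2 gives at
   most t. *)
have [r [d [r0 r8 d0 hd]]] := unif (t / 4) (divr_gt0 t0 (ltr0n _ 4)).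
have diff_small (v w : T -> R) g h : C11 Q C v g -> C11 Q C w h ->
    Ipsi (fun x => (v x - U x) ^+ 2) <= t / 4 -> Ipsi (fun x => (w x - U x) ^+ 2) <= t / 4 ->
    forall x, `|x| <= k -> `|v x - w x| < eta.
  move=> vC wC hv hw x xk; have bv := bnd_C11 vC; have bw := bnd_C11 wC.
  apply: (ht (fun x => v x - w x)); [exact: bndB| | |exact: dk].
    move=> a b aQ bQ; rewrite mulrDl (_ : _ - _ = (v a - v b) - (w a - w b)); last by ring.
    by apply: le_trans (ler_normB _ _) _; rewrite lerD // ?(C11_lip vC) ?(C11_lip wC).
  have b1 : bnd (fun x => (v x - U x) ^+ 2) by apply: bndX; apply: bndB.
  have b2 : bnd (fun x => (w x - U x) ^+ 2) by apply: bndX; apply: bndB.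
  have : Ipsi (fun x => (v x - w x) ^+ 2) <=
      Ipsi (fun x => 2 * (v x - U x) ^+ 2 + 2 * (w x - U x) ^+ 2).
    apply: Ipsi_le => [||a _].
    - by apply: bndX; apply: bndB.
    - by apply: bndD; apply: bndM => //; exact: bndC.
    - by have := sqr_ge0 (v a + w a - 2 * U a); nra.
  rewrite IpsiD; [|by apply: bndM => //; exact: bndC..].
  by rewrite !IpsiZ //; lra.
exists (Num.min d (k * r / 2)); split; first by rewrite lt_min d0 divr_gt0 // mulr_gt0.
move=> y z Ey Ez; rewrite !lt_min => /andP[yd yk] /andP[zd zk].
have [yx hA] := EA y Ey; have [zx hB] := EA z Ez; have yc := Ec y Ey; have zc := Ec z Ez.
have rr : 0 < r <= rho / 8 by rewrite r0.
have [_ AC] := C11_common ur yc rr hA.1; have [_ BC] := C11_common ur zc rr hB.1.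
have [hy1 hy2] := hd y Ey yd; have [hz1 hz2] := hd z Ez zd.
split.
  apply: le_trans eta1; apply: sym_norm_le => //; last by move=> x xk; rewrite -pA_sub ltW // (diff_small _ _ _ _ AC BC).
    by rewrite linearB /= hA.1.1 hB.1.1.
  exact: ltW.
have [->|zy] := eqVneq z y; first by rewrite subrr mul0mx !normr0 mulr0.
have D0 : 0 < `|z - y| by rewrite normr_gt0 subr_eq0.
(* At this scale z appears at a point of norm k. There the rescaling vanishes since u z = 0, so the
   polynomial of y is below eta; the bound k r / 2 on both distances to y0 makes s at most r. *)
pose s := `|z - y| / k; have s0 : 0 < s by rewrite divr_gt0.
have sr : s <= r.
  rewrite ler_pdivrMr // mulrC; have := ler_normD (z - y0) (y0 - y).
  by rewrite addrA subrK -[`|y0 - y|]normrN opprB; lra.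
have ss : 0 < s <= rho / 8 by rewrite s0 (le_trans sr).
have [vC _] := C11_common ur yc ss hA.1.
have xk : `|s^-1 *: (z - y)| <= k.
  rewrite normrZ normfV (gtr0_norm s0) /s invfM invrK mulrAC mulVf ?mul1r //.
  by rewrite gt_eqF.
have := diff_small _ _ _ _ vC AC (hy2 s s0 sr) hy1 _ xk.
have -> : resc u y s (s^-1 *: (z - y)) = 0.
  rewrite /resc scalerA mulfV ?gt_eqF // scale1r addrC subrK.
  by have [_ -> _] := zc; rewrite mul0r.
rewrite sub0r normrN => /ltW /(le_trans (ler_norm _)).
rewrite pA_scale exprVn mulrC ler_pdivrMr ?exprn_gt0 // => hs.
apply: Pmat_cauchy hA.1 _ _; first by rewrite mulr_ge0 // ltW.
have : eta * s ^+ 2 * 2 <= (e * `|z - y|) ^+ 2.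
  rewrite /s exprMn exprVn mulrA mulrAC ler_pdivrMr //.
  rewrite (_ : _ * 2 = 2 * eta * `|z - y| ^+ 2); last by ring.
  rewrite (_ : _ ^+ 2 * _ = e ^+ 2 * k ^+ 2 * `|z - y| ^+ 2); last by ring.
  by rewrite ler_wpM2r ?exprn_ge0.
lra.
Qed.

End Stratum.

(** * Whitney extension *)

Lemma dyadic_scale (R : realType) (a D : R) J : 0 < a -> a <= D -> D < 4 ^+ J * a ->
  exists j, (j < J)%N /\ 4 ^+ j * a <= D < 4 ^+ j.+1 * a.
Proof.
move=> a0 aD; elim: J => [|J IH]; first by rewrite expr0 mul1r ltNge aD.
move=> DJ; have [/IH[j [jJ h]]|h] := ltP D (4 ^+ J * a).
  by exists j; split => //; rewrite ltnS ltnW.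
by exists J; rewrite h DJ.
Qed.

Lemma pow4_unbounded (R : realType) (c : R) : exists J, c < 4 ^+ J.
Proof.
exists (Num.bound `|c|); apply: le_lt_trans (ler_norm c) _.
apply: lt_le_trans (archi_boundP (normr_ge0 c)) _.
rewrite -natrX ler_nat; apply: ltnW; exact: ltn_expl.
Qed.

Section Whitney.
Variables (R : realType) (n : nat).
Local Notation T := 'rV[R]_n.
Implicit Types (x y z p q : T).

(* The factor 2 avoids any discussion of whether the distance is attained. *)
Lemma near_projection (K : set T) : closed K -> K !=set0 ->
  exists pr : T -> T, forall z, K (pr z) /\ forall y, K y -> `|z - pr z| <= 2 * `|z - y|.
Proof.
move=> Kc [k0 Kk0].
suff /choice[pr hpr] : forall z, exists p, K p /\ forall y, K y -> `|z - p| <= 2 * `|z - y|.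
  by exists pr.
move=> z; have [Kz|nKz] := pselect (K z).
  by exists z; split => // y _; rewrite subrr normr0 mulr_ge0.
have : nbhs z (~` K) by apply: open_nbhs_nbhs; split => //; exact: closed_openC.
move=> /nbhs_ballP[e /= e0 he].
pose S := [set `|z - y| | y in K].
have S0 : S !=set0 by exists `|z - k0|, k0.
have lb y : K y -> e <= `|z - y|.
  move=> Ky; rewrite leNgt; apply/negP => h; apply: (he y) => //.
  by rewrite mx_norm_ball.
have Slb : has_lbound S by exists e => _ [y Ky <-]; exact: lb.
have i0 : 0 < inf S.
  apply: lt_le_trans e0 _; apply: lb_le_inf => // _ [y Ky <-]; exact: lb.
have [_ [p Kp <-] hp] := inf_adherent i0 (conj S0 Slb).
exists p; split => // y Ky; have : inf S <= `|z - y| by apply: ge_inf => //; exists y.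
by lra.
Qed.

Variables (K : set T) (pr : T -> T) (a : T -> T) (Ca : R).
Hypothesis K_half : forall y, K y -> `|y| <= 2^-1.
Hypothesis pr_in : forall z, K (pr z).
Hypothesis pr_near : forall z y, K y -> `|z - pr z| <= 2 * `|z - y|.
Hypothesis a_bound : forall y, K y -> `|a y| <= Ca.

Let N := n.+2.

(* [wdist z x] is comparable to [|x - z|^2 + dist(z, K)^2]; the weights
   [wdist ^ - (n + 2)] concentrate on the points [z] with
   [|x - z| <= C dist(x, K)], as does a Whitney partition of unity. *)
Definition wdist z x : R := dot (x - z) (x - z) + `|z - pr z| ^+ 2.
Definition wt z x : R := (wdist z x)^-1 ^+ N.
(** The affine function prescribed at [pr z], with value 0 and gradient [a (pr z)]. *)
Definition jet z x : R := dot (a (pr z)) (x - pr z).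

Definition dK x : R := `|x - pr x|.

Lemma wdist_ge0 z x : 0 <= wdist z x.
Proof. by rewrite addr_ge0 ?dotxx_ge0 ?exprn_ge0. Qed.

Lemma dot_le_wdist z x : dot (x - z) (x - z) <= wdist z x.
Proof. by rewrite lerDl exprn_ge0. Qed.

Lemma dist_le_wdist z x : `|x - pr z| ^+ 2 <= 2 * wdist z x.
Proof.
have h : `|x - pr z| <= `|x - z| + `|z - pr z|.
  by rewrite (_ : x - pr z = (x - z) + (z - pr z)) ?ler_normD // addrA subrK.
have := norm_sq_le_dot (x - z); rewrite /wdist.
have := normr_ge0 (x - pr z); have := normr_ge0 (x - z); have := normr_ge0 (z - pr z).
move: h; set A := `|x - pr z|; set B := `|x - z|; set E := `|z - pr z| => h e0 b0 a0 hB.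
have : A ^+ 2 <= (B + E) ^+ 2 by rewrite ler_pXn2r ?nnegrE ?addr_ge0.
have := sqr_ge0 (B - E); nra.
Qed.

Lemma dK_le z x : dK x <= 2 * `|x - pr z|.
Proof. exact: pr_near. Qed.

Lemma dK_wdist z x : dK x ^+ 2 / 8 <= wdist z x.
Proof.
have h := dK_le z x; have h2 := dist_le_wdist z x.
have : dK x ^+ 2 <= (2 * `|x - pr z|) ^+ 2.
  by rewrite ler_pXn2r ?nnegrE ?mulr_ge0 // normr_ge0.
rewrite exprMn; lra.
Qed.

Lemma wdist_gt0 z x : 0 < dK x -> 0 < wdist z x.
Proof. by move=> d0; apply: lt_le_trans (dK_wdist z x); rewrite divr_gt0 // exprn_gt0. Qed.

Lemma wt_ge0 z x : 0 <= wt z x.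
Proof. by rewrite exprn_ge0 // invr_ge0 wdist_ge0. Qed.

Lemma bnd_wt x : 0 < dK x -> bnd (fun z => wt z x).
Proof.
move=> d0; exists ((dK x ^+ 2 / 8)^-1 ^+ N) => z _; rewrite ger0_norm ?wt_ge0 //.
have a0 : 0 < dK x ^+ 2 / 8 by rewrite divr_gt0 // exprn_gt0.
rewrite ler_pXn2r ?nnegrE ?invr_ge0 ?wdist_ge0 ?(ltW a0) //.
by rewrite lef_pV2 ?posrE ?wdist_gt0 // dK_wdist.
Qed.

Lemma dK_le1 x : `|x| <= 2^-1 -> dK x <= 1.
Proof.
move=> xh; apply: le_trans (ler_normB _ _) _; have := K_half (pr_in x); lra.
Qed.

(** For z in the cube of radius [dK x] about x, the distance from z to [pr z] is at most 4 [dK x],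
    so [wdist z x] is at most (n + 16) [dK x ^+ 2]. *)
Lemma wt_low x : `|x| <= 2^-1 -> 0 < dK x ->
  ((n%:R + 16) * dK x ^+ 2)^-1 ^+ N * dK x ^+ n <= intQ (fun z => wt z x).
Proof.
move=> xh d0; have d1 := dK_le1 xh; have x1 : `|x| <= 1 by lra.
have d01 : 0 < dK x <= 1 by rewrite d0.
have c0 : 0 < (n%:R + 16) * dK x ^+ 2 by rewrite mulr_gt0 ?exprn_gt0 // ltr_wpDl.
set c := _^-1 ^+ N; have cp : 0 < c by rewrite exprn_gt0 // invr_gt0.
have := intQ_cube_ge x1 d01; rewrite -(ler_pM2l cp) => /le_trans; apply.
rewrite -intQZ; last exact: bnd_box_ind.
apply: intQ_le; [by apply: bndM; [exact: bndC|exact: bnd_box_ind]|exact: bnd_wt|].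
move=> z zQ; have [zx|zx] := pselect (box (x - const_mx (dK x)) (x + const_mx (dK x)) z); last first.
  by rewrite box_ind_out // mulr0 wt_ge0.
rewrite box_ind_in // mulr1.
have zxd : `|x - z| <= dK x.
  apply: norm_le_coord; first exact: ltW.
  by move=> i; have := zx i; rewrite !mxE ler_norml => /andP[? ?]; apply/andP; split; lra.
have zd : `|z - pr z| <= 4 * dK x.
  apply: le_trans (pr_near z (pr_in x)) _.
  have := ler_normD (z - x) (x - pr x); rewrite addrA subrK -[`|z - x|]normrN opprB.
  by rewrite -/(dK x); lra.
rewrite ler_pXn2r ?nnegrE ?invr_ge0 ?wdist_ge0 ?(ltW c0) // lef_pV2 ?posrE ?wdist_gt0 //.
rewrite /wdist mulrDl; apply: lerD.
  apply: le_trans (dotxx_le _) _; rewrite ler_wpM2l // ler_pXn2r ?nnegrE // ltW //.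
apply: (@le_trans _ _ ((4 * dK x) ^+ 2)); last by rewrite exprMn; lra.
by rewrite ler_pXn2r ?nnegrE // mulr_ge0 // ltW.
Qed.

Lemma geom_half_sum J : \sum_(j < J) (2^-1 ^+ j : R) <= 2.
Proof.
suff : \sum_(j < J) (2^-1 ^+ j : R) = 2 - 2 * 2^-1 ^+ J.
  by move=> ->; rewrite gerBl mulr_ge0 // exprn_ge0.
elim: J => [|J IH]; first by rewrite big_ord0 expr0; ring.
by rewrite big_ord_recr /= IH exprS; field.
Qed.

(** The factors come from a geometric series, the volume of the boxes, the lower bound
    [dK x ^+ 2 / 8] of [wdist], and the mass bound [wt_low]. *)
Definition Cw : R := 2 * 4 ^+ n * 8 ^+ n.+1 * (n%:R + 16) ^+ N.

Lemma Cw_ge0 : 0 <= Cw.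
Proof.
have h : 0 <= n%:R + 16 :> R by rewrite addr_ge0.
by rewrite /Cw mulr_ge0 ?exprn_ge0 // mulr_ge0 ?exprn_ge0 // mulr_ge0 ?exprn_ge0.
Qed.

Lemma bnd_wdist x : bnd (fun z => wdist z x).
Proof.
have [k0 Kk0] : K !=set0 by exists (pr 0).
exists (n%:R * (`|x| + 2) ^+ 2 + 36) => z zQ; rewrite ger0_norm ?wdist_ge0 //.
apply: lerD.
  apply: le_trans (dotxx_le _) _; rewrite ler_wpM2l // ler_pXn2r ?nnegrE ?addr_ge0 //.
  by apply: le_trans (ler_normB _ _) _; rewrite lerD.
have h : `|z - pr z| <= 6.
  apply: le_trans (pr_near z Kk0) _; have := ler_normB z k0; have := K_half Kk0; lra.
by have := normr_ge0 (z - pr z); nra.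
Qed.

(** In weighted average [wdist] is of order [dK x ^+ 2]. Cut dyadically: where [wdist] is between
    4^j c and 4^(j+1) c, z lies in a box of side 2^(j+2) d and the integrand is at most (4^j
    c)^-(n+1), so shell j contributes of order 2^(-j (n+2)). *)
Lemma wt_moment x : `|x| <= 2^-1 -> 0 < dK x ->
  intQ (fun z => wdist z x * wt z x) <= Cw * dK x ^+ 2 * intQ (fun z => wt z x).
Proof.
move=> xh d0; set d := dK x in d0 *; have dN : d != 0 by rewrite gt_eqF.
pose c := d ^+ 2 / 8; have c0 : 0 < c by rewrite divr_gt0 // exprn_gt0.
have [M hM] := bnd_wdist x; have [J hJ] := pow4_unbounded (M / c).
pose al j := (4 ^+ j * c)^-1 ^+ n.+1.
have al0 j : 0 < al j by rewrite exprn_gt0 // invr_gt0 mulr_gt0 // exprn_gt0.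
pose bx j := box_ind (x - const_mx (2 ^+ j.+1 * d)) (x + const_mx (2 ^+ j.+1 * d)).
have pt z : `|z| <= 2 -> wdist z x * wt z x <= \sum_(j < J) al j * bx j z.
  move=> zQ; have D0 := wdist_gt0 z d0.
  have -> : wdist z x * wt z x = (wdist z x)^-1 ^+ n.+1.
    have DN : wdist z x != 0 by rewrite gt_eqF.
    by rewrite /wt /N exprS mulrA mulfV // mul1r.
  have DJ : wdist z x < 4 ^+ J * c.
    rewrite -ltr_pdivrMr //; apply: le_lt_trans hJ.
    rewrite ler_pM2r ?invr_gt0 //; apply: le_trans (ler_norm _) _; exact: hM.
  have [j [jJ /andP[j1 j2]]] := dyadic_scale c0 (dK_wdist z x) DJ.
  rewrite (bigD1 (Ordinal jJ)) //= -[leLHS]addr0; apply: lerD; last first.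
    by apply: sumr_ge0 => i _; rewrite mulr_ge0 ?box_ind_ge0 // ltW.
  rewrite /bx box_ind_in ?mulr1.
    have cj : 0 < 4 ^+ j * c by rewrite mulr_gt0 // exprn_gt0.
    rewrite ler_pXn2r ?nnegrE ?invr_ge0 ?wdist_ge0 ?(ltW cj) //.
    by rewrite lef_pV2 ?posrE.
  have h : `|x - z| <= 2 ^+ j.+1 * d.
    have dp : 0 <= 2 ^+ j.+1 * d by rewrite mulr_ge0 ?exprn_ge0 // ltW.
    rewrite -(@ler_pXn2r _ 2) ?nnegrE //; apply: le_trans (norm_sq_le_dot _) _.
    have : dot (x - z) (x - z) <= wdist z x by rewrite /wdist lerDl exprn_ge0.
    move=> h1; apply: (le_trans h1); apply: le_trans (ltW j2) _.
    have -> : (2 ^+ j.+1 * d) ^+ 2 = 4 ^+ j.+1 * d ^+ 2.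
      rewrite exprMn exprAC; congr (_ ^+ _ * _); ring.
    have d2 : 0 <= d ^+ 2 by rewrite exprn_ge0 // ltW.
    by rewrite ler_wpM2l ?exprn_ge0 // /c; lra.
  move=> i; have := le_trans (coord_le_norm (x - z) i) h; rewrite !mxE ler_norml.
  by move=> /andP[? ?]; apply/andP; split; lra.
have bb j : bnd (bx j) by exact: bnd_box_ind.
have bl : bnd (fun z => wdist z x * wt z x) by apply: bndM; [exact: bnd_wdist|exact: bnd_wt].
apply: (@le_trans _ _ (\sum_(j < J) al j * (2 ^+ j.+2 * d) ^+ n)).
  apply: (@le_trans _ _ (intQ (fun z => \sum_(j < J) al j * bx j z))).
    apply: intQ_le => //; apply: bnd_sum => j; apply: bndM => //; exact: bndC.
  rewrite intQ_sum; last by move=> j; apply: bndM => //; exact: bndC.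
  apply: ler_sum => j _; rewrite intQZ // ler_wpM2l ?(ltW (al0 _)) //.
  apply: le_trans (intQ_box_le _) _.
    by move=> i; rewrite !mxE; have : 0 <= 2 ^+ j.+1 * d; [rewrite mulr_ge0 ?exprn_ge0 // ltW|lra].
  rewrite /box_vol (eq_bigr (fun _ => 2 ^+ j.+2 * d)); first by rewrite prodr_const card_ord.
  by move=> i _; rewrite !mxE [2 ^+ j.+2]exprS; ring.
have low := wt_low xh d0; rewrite -/d in low.
apply: (@le_trans _ _ (Cw * d ^+ 2 * (((n%:R + 16) * d ^+ 2)^-1 ^+ N * d ^+ n))); last first.
  by rewrite ler_wpM2l // mulr_ge0 ?Cw_ge0 // exprn_ge0 // ltW.
have nN : (n%:R + 16 : R) != 0 by rewrite gt_eqF // ltr_wpDl.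
have E : Cw * d ^+ 2 * (((n%:R + 16) * d ^+ 2)^-1 ^+ N * d ^+ n) =
   2 * (4 ^+ n * (c^-1 ^+ n.+1 * d ^+ n)).
  have n16 : (n%:R + 16) ^+ N * (n%:R + 16)^-1 ^+ N = 1 :> R.
    by rewrite -exprMn mulfV // expr1n.
  have d2 : d ^+ 2 * (d ^+ 2)^-1 ^+ N = (d ^+ 2)^-1 ^+ n.+1.
    have d2N : d ^+ 2 != 0 by rewrite expf_neq0.
    by rewrite /N [d ^- 2 ^+ n.+2]exprS mulrA mulfV // mul1r.
  have cV : c^-1 ^+ n.+1 = 8 ^+ n.+1 * d ^- 2 ^+ n.+1.
    by rewrite /c -exprMn; congr (_ ^+ _); rewrite invfM invrK mulrC.
  have nV : ((n%:R + 16) * d ^+ 2)^-1 ^+ N = (n%:R + 16)^-1 ^+ N * d ^- 2 ^+ N.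
    by rewrite -exprMn invfM.
  rewrite nV cV -d2 /Cw; move: (d ^- 2 ^+ N) ((n%:R + 16)^-1 ^+ N) n16 => p q n16.
  transitivity (2 * 4 ^+ n * 8 ^+ n.+1 * ((n%:R + 16) ^+ N * q) * (d ^+ 2 * p) * d ^+ n).
    by ring.
  by rewrite n16; ring.
rewrite E; apply: (@le_trans _ _ (\sum_(j < J) (2^-1 ^+ j) * (4 ^+ n * (c^-1 ^+ n.+1 * d ^+ n)))); last first.
  rewrite -mulr_suml ler_wpM2r ?geom_half_sum //.
  by rewrite !mulr_ge0 ?exprn_ge0 ?invr_ge0 // ltW.
apply: ler_sum => j _.
have -> : al j * (2 ^+ j.+2 * d) ^+ n =
    (4 ^- j ^+ n.+1 * 2 ^+ j ^+ n) * (4 ^+ n * (c^-1 ^+ n.+1 * d ^+ n)).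
  have aE : al j = 4 ^- j ^+ n.+1 * c^-1 ^+ n.+1 by rewrite /al -exprMn -invfM.
  have bE : (2 ^+ j.+2 * d) ^+ n = (2 ^+ j) ^+ n * 4 ^+ n * d ^+ n.
    by rewrite -!exprMn; congr (_ ^+ _); rewrite !exprS; ring.
  by rewrite aE bE; move: (4 ^- j ^+ n.+1) (c^-1 ^+ n.+1) => p q; ring.
rewrite ler_wpM2r //; first by rewrite !mulr_ge0 ?exprn_ge0 ?invr_ge0 // ltW.
have -> : (4 : R) = 2 * 2 by ring.
rewrite exprMn invfM exprMn [X in X * _ * _]exprS.
have t1 : (2 ^- j) ^+ n.+1 <= 2^-1 ^+ j :> R.
  rewrite -exprVn exprS ler_piMr ?exprn_ge0 ?invr_ge0 //.
  by rewrite exprn_ile1 ?exprn_ge0 ?invr_ge0 // exprn_ile1 ?invr_ge0 // invf_le1 ?ler1n.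
have t2 : (2 ^- j) ^+ n * (2 ^+ j) ^+ n = 1 :> R.
  by rewrite -exprMn mulVf ?expr1n // expf_neq0.
rewrite (_ : 2 ^- j * _ * _ * _ = 2 ^- j * ((2 ^- j) ^+ n * (2 ^+ j) ^+ n) * (2 ^- j) ^+ n.+1); last by ring.
rewrite t2 mulr1; apply: le_trans _ t1; rewrite ler_piMl ?exprn_ge0 ?invr_ge0 ?exprn_ge0 //.
by rewrite -exprVn exprn_ile1 ?invr_ge0 // invf_le1 ?ler1n.
Qed.

End Whitney.

Section WhitneyC1.
Variables (R : realType) (n : nat).
Local Notation T := 'rV[R]_n.
Implicit Types (x y z p q : T).
Variables (K : set T) (pr : T -> T) (a : T -> T) (Ca : R).
Hypothesis K_half : forall y, K y -> `|y| <= 2^-1.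
Hypothesis pr_in : forall z, K (pr z).
Hypothesis pr_near : forall z y, K y -> `|z - pr z| <= 2 * `|z - y|.
Hypothesis a_bound : forall y, K y -> `|a y| <= Ca.

Let N := n.+2.
Local Notation wdist := (wdist pr).
Local Notation wt := (wt pr).
Local Notation jet := (jet pr a).
Local Notation dK := (dK pr).
Local Notation Cw := (Cw R n).

Lemma Ca_ge0 : 0 <= Ca.
Proof. exact: le_trans (normr_ge0 _) (a_bound (pr_in 0)). Qed.

(** The gradient of [wt z], in the shape that [C11X] and [C11_inv] produce. *)
Definition gwt z x : T :=
  (N%:R * (wdist z x)^-1 ^+ N.-1) *: ((- (wdist z x) ^- 2) *: (2 *: (x - z))).

Definition wsum x : R := intQ (fun z => wt z x).
Definition jsum x : R := intQ (fun z => wt z x * jet z x).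
Definition gwsum x : T := \row_i intQ (fun z => gwt z x 0 i).
Definition gjsum x : T := \row_i intQ (fun z => (wt z x *: a (pr z) + jet z x *: gwt z x) 0 i).
Definition wavg x : R := jsum x * (wsum x)^-1.
Definition gwavg x : T :=
  jsum x *: ((- (wsum x) ^- 2) *: gwsum x) + (wsum x)^-1 *: gjsum x.

Lemma intQ_abs_le (f : T -> R) : bnd f -> `|intQ f| <= intQ (fun z => `|f z|).
Proof.
move=> bf; have ba : bnd (fun z => `|f z|) by case: bf => C h; exists C => z /h; rewrite normr_id.
rewrite ler_norml -intQN //; apply/andP; split; apply: intQ_le => //.
- exact: bndN.
- by move=> z _; rewrite lerNl -normrN ler_norm.
- by move=> z _; exact: ler_norm.
Qed.

(** At distance eta from K, [wdist z x] is bounded below uniformly in z, and so is [wsum]; the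
    constant degenerates as eta tends to 0, and the behaviour near K needs the estimates that
    follow. *)
Lemma C11_wavg x1 (eta : R) : 0 < eta -> (forall x y, `|x - x1| < eta -> K y -> eta <= `|x - y|) ->
  exists C, C11 (fun x => `|x - x1| < eta /\ `|x| < 2^-1) C wavg gwavg.
Proof.
move=> eta0 far; pose B x := `|x - x1| < eta /\ `|x| < 2^-1.
have Bh x : B x -> `|x| <= 2^-1 by move=> [_ /ltW].
have dK0 x : B x -> eta <= dK x by move=> [h _]; apply: far.
have Dlow z x : B x -> eta ^+ 2 / 8 <= wdist z x.
  move=> Bx; apply: le_trans (dK_wdist pr_in pr_near z x).
  by rewrite ler_pM2r ?invr_gt0 // ler_pXn2r ?nnegrE ?dK0 ?(ltW eta0) ?normr_ge0.
have c0 : 0 < eta ^+ 2 / 8 by rewrite divr_gt0 // exprn_gt0.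
have prz z : `|z| <= 2 -> `|z - pr z| <= 6.
  move=> zQ; apply: le_trans (pr_near z (pr_in 0)) _.
  by have := ler_normB z (pr 0); have := K_half (pr_in 0); lra.
pose CD := 4 * (n%:R + 1) * (3 * 3) + 36 : R.
have DC z : `|z| <= 2 -> C11 B CD (wdist z) (fun x => 2 *: (x - z)).
  move=> zQ.
  have h1 : C11 B (4 * (n%:R + 1) * (3 * 3)) (fun x => dot (x - z) (x - z)) (fun x => 2 *: (x - z)).
    apply: C11_sqdist => [|x Bx]; first by rewrite ler1n.
    by apply: le_trans (ler_normB _ _) _; have := Bh x Bx; lra.
  have h2 : C11 B 36 (fun _ : T => `|z - pr z| ^+ 2) (fun _ => 0).
    apply: C11_weaken (C11_cst B (`|z - pr z| ^+ 2)).
    rewrite ger0_norm ?exprn_ge0 //; have := prz z zQ; have := normr_ge0 (z - pr z); nra.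
  by apply: C11_ext (C11D h1 h2) => // x _; rewrite addr0.
have [KI hKI] := C11_inv B CD c0.
have IC z : `|z| <= 2 -> C11 B KI (fun x => (wdist z x)^-1)
    (fun x => (- (wdist z x) ^- 2) *: (2 *: (x - z))).
  by move=> zQ; apply: hKI (DC z zQ) _ => x Bx; exact: Dlow.
have WC z : `|z| <= 2 -> C11 B (4 ^+ N * (KI + 1) ^+ N) (wt z) (gwt z).
  by move=> zQ; exact: C11X (IC z zQ).
have Ca0 := Ca_ge0.
pose CJ := n%:R * (Ca * 1) + Ca + n%:R * Ca + n%:R * (Ca * 1).
have JC z : `|z| <= 2 -> C11 B CJ (jet z) (fun _ => a (pr z)).
  move=> zQ; have := C11_affine (a (pr z)) (- dot (a (pr z)) (pr z)) ler01 (_ : forall x, B x -> `|x| <= 1).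
  move=> h; apply: C11_weaken (C11_ext _ _ (h _)) => //.
  - rewrite normrN /CJ; have ab := a_bound (pr_in z).
    have k1 : `|pr z| <= 1 by have := K_half (pr_in z); lra.
    have h1 : n%:R * (`|a (pr z)| * 1) <= n%:R * (Ca * 1) by rewrite ler_wpM2l // ler_wpM2r.
    have h2 : n%:R * `|a (pr z)| <= n%:R * Ca by rewrite ler_wpM2l.
    have h3 := dot_le ab k1; lra.
  - by move=> x _; rewrite /jet dotBr.
  - by move=> x Bx; have := Bh x Bx; lra.
have PC z (zQ : `|z| <= 2) := C11M (WC z zQ) (JC z zQ).
have SC : C11 B (4 ^+ n * (4 ^+ N * (KI + 1) ^+ N)) wsum gwsum by exact: C11_intQ WC.
have QC : C11 B (4 ^+ n * (4 * (4 ^+ N * (KI + 1) ^+ N * CJ))) jsum gjsum by exact: C11_intQ PC.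
have n16 : 0 < n%:R + 16 :> R by rewrite ltr_wpDl.
have low x : B x -> (n%:R + 16)^-1 ^+ N * eta ^+ n <= wsum x.
  move=> Bx; have d0 : 0 < dK x := lt_le_trans eta0 (dK0 x Bx).
  apply: le_trans (wt_low K_half pr_in pr_near (Bh x Bx) d0).
  have d1 := dK_le1 K_half pr_in (Bh x Bx).
  have dd : 0 < (n%:R + 16) * dK x ^+ 2 by rewrite mulr_gt0 // exprn_gt0.
  apply: ler_pM.
  - by rewrite exprn_ge0 // invr_ge0 ltW.
  - by rewrite exprn_ge0 // ltW.
  - rewrite ler_pXn2r ?nnegrE ?invr_ge0 ?(ltW dd) ?(ltW n16) //.
    by rewrite lef_pV2 ?posrE // ler_piMr ?(ltW n16) // exprn_ile1 // ltW.
  - by apply: lerXn2r; rewrite ?nnegrE ?(ltW d0) ?(ltW eta0) // dK0.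
have low0 : 0 < (n%:R + 16)^-1 ^+ N * eta ^+ n by rewrite mulr_gt0 ?exprn_gt0 // invr_gt0.
have [KS hKS] := C11_inv B (4 ^+ n * (4 ^+ N * (KI + 1) ^+ N)) low0.
by eexists; exact: C11M QC (hKS _ _ SC low).
Qed.

(** * Comparison of the weighted average with the nearest jet, close to K *)

Section Estimate.
Variables (y : T) (e d : R).
Hypothesis (Ky : K y) (e0 : 0 <= e) (d0 : 0 < d).
Hypothesis jet_small : forall p q, K p -> K q -> `|p - y| < d -> `|q - y| < d ->
  `|a p - a q| <= e /\ `|dot (a p) (q - p)| <= e * `|q - p|.
Variable x : T.
Hypothesis (x_half : `|x| <= 2^-1) (xy : `|x - y| < d / 8) (dK_gt0 : 0 < dK x).

Let y' := pr x.
Let J' := dot (a y') (x - y').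
Let D := dK x.

Lemma y'_near : `|y' - y| < d.
Proof.
have := ler_normD (y' - x) (x - y); rewrite addrA subrK -[`|y' - x|]normrN opprB.
have h2 : `|x - y'| <= 2 * `|x - y| := pr_near x Ky.
by move: d0 xy h2; lra.
Qed.

(** If [pr z] is within d of y, the compatibility conditions apply. Otherwise s is at least d / 2,
    and the crude bounds by [Ca] are absorbed by powers of 2 s / d >= 1. *)
Lemma jet_err z : let s := `|x - pr z| in
  `|jet z x - J'| <= (2 * n%:R + 3) * e * s + 6 * n%:R * Ca / d * s ^+ 2 /\
  `|a (pr z) - a y'| <= e + 8 * Ca / d ^+ 2 * s ^+ 2.
Proof.
move=> s; have s0 : 0 <= s by exact: normr_ge0.
have Ca0 := Ca_ge0; have n0 : 0 <= n%:R :> R by [].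
have Ds : D <= 2 * s := pr_near x (pr_in z).
have p1 : 0 <= 6 * n%:R * Ca / d * s ^+ 2 by rewrite !mulr_ge0 ?invr_ge0 ?exprn_ge0 ?(ltW d0).
have p2 : 0 <= 8 * Ca / d ^+ 2 * s ^+ 2 by rewrite !mulr_ge0 ?invr_ge0 ?exprn_ge0 ?(ltW d0).
have p3 : 0 <= (2 * n%:R + 3) * e * s by rewrite !mulr_ge0 ?addr_ge0 ?mulr_ge0.
have pK := pr_in z; have yK : K y' := pr_in x.
have py' : `|y' - pr z| <= D + s.
  rewrite (_ : y' - pr z = (x - pr z) - (x - y')); last by rewrite opprB [RHS]addrC addrA subrK.
  by apply: le_trans (ler_normB _ _) _; rewrite addrC.
have [pn|pf] := ltP `|pr z - y| d.
  have [h1 _] := jet_small pK yK pn y'_near.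
  have [_ h2] := jet_small pK yK pn y'_near.
  split; last by lra.
  rewrite /jet /J' (_ : _ - _ = dot (a (pr z) - a y') (x - y') + dot (a (pr z)) (y' - pr z)); last first.
    by rewrite !(dotBl, dotBr); ring.
  apply: le_trans (ler_normD _ _) _.
  have t1 := dot_le h1 (lexx `|x - y'|); rewrite -/(dK x) -/D in t1.
  have t2 : n%:R * (e * D) <= n%:R * (e * (2 * s)) by rewrite ler_wpM2l // ler_wpM2l.
  have t3 : e * `|y' - pr z| <= e * (3 * s) by rewrite ler_wpM2l //; lra.
  lra.
have sd : d / 2 <= s.
  have := ler_normD (pr z - x) (x - y); rewrite addrA subrK -[`|pr z - x|]normrN opprB -/s.
  by move: d0 xy pf; lra.
have sd1 : 1 <= 2 * s / d by rewrite ler_pdivlMr //; lra.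
have sd2 : 1 <= 4 * s ^+ 2 / d ^+ 2.
  have -> : 4 * s ^+ 2 / d ^+ 2 = (2 * s / d) ^+ 2 by field; rewrite gt_eqF.
  exact: exprn_ege1.
split.
  apply: (@le_trans _ _ (3 * n%:R * Ca * s)).
    rewrite /jet /J'; apply: le_trans (ler_normB _ _) _.
    have t1 := dot_le (a_bound pK) (lexx s); have t2 := dot_le (a_bound yK) Ds.
    by lra.
  have h : 3 * n%:R * Ca * s * 1 <= 3 * n%:R * Ca * s * (2 * s / d).
    by rewrite ler_wpM2l // !mulr_ge0.
  have -> : 6 * n%:R * Ca / d * s ^+ 2 = 3 * n%:R * Ca * s * (2 * s / d).
    by field; rewrite gt_eqF.
  lra.
apply: le_trans (ler_normB _ _) _.
have t1 := a_bound pK; have t2 := a_bound yK.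
have h : 2 * Ca * 1 <= 2 * Ca * (4 * s ^+ 2 / d ^+ 2) by rewrite ler_wpM2l // mulr_ge0.
have -> : 8 * Ca / d ^+ 2 * s ^+ 2 = 2 * Ca * (4 * s ^+ 2 / d ^+ 2).
  by field; rewrite gt_eqF.
by move: e0; lra.
Qed.

Let S := wsum x.

Lemma wsum_gt0 : 0 < S.
Proof.
apply: lt_le_trans (wt_low K_half pr_in pr_near x_half dK_gt0).
by rewrite mulr_gt0 ?exprn_gt0 // invr_gt0 mulr_gt0 ?exprn_gt0 // ltr_wpDl.
Qed.

Definition A1 : R := (2 * n%:R + 3) * (Cw + 1).
Definition A2 : R := 12 * n%:R * Ca / d * Cw.
Definition A3 : R := 16 * Ca / d ^+ 2 * Cw.

Lemma bnd_jet : bnd (fun z => jet z x).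
Proof.
exists (n%:R * (Ca * 1)) => z _; apply: dot_le; first exact: a_bound (pr_in z).
by apply: le_trans (ler_normB _ _) _; have := K_half (pr_in z); move: x_half; lra.
Qed.

Lemma bnd_abs (f : T -> R) : bnd f -> bnd (fun z => `|f z|).
Proof. by case=> C h; exists C => z /h; rewrite normr_id. Qed.

Lemma bnd_wtx : bnd (fun z => wt z x). Proof. exact: (@bnd_wt _ _ K pr pr_in pr_near x dK_gt0). Qed.
Lemma bnd_wdx : bnd (fun z => wdist z x). Proof. exact: bnd_wdist K_half pr_in pr_near x. Qed.

Lemma avg_jet : intQ (fun z => wt z x * `|jet z x - J'|) <= S * (A1 * e * D + A2 * D ^+ 2).
Proof.
have Ca0 := Ca_ge0; have bw := bnd_wtx; have bd := bnd_wdx.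
have DN : D != 0 by rewrite gt_eqF.
have Cw0 := Cw_ge0 R n.
pose c1 := (2 * n%:R + 3) * e; have c10 : 0 <= c1 by rewrite mulr_ge0 // addr_ge0 // mulr_ge0.
pose c2 := 6 * n%:R * Ca / d; have c20 : 0 <= c2 by rewrite !mulr_ge0 ?invr_ge0 ?(ltW d0).
have := wt_moment K_half pr_in pr_near x_half dK_gt0; rewrite -/(wsum x) -/S -/D => mom.
apply: (@le_trans _ _ (intQ (fun z => (c1 / D + 2 * c2) * (wdist z x * wt z x) + (c1 * D / 2) * wt z x))).
  apply: intQ_le.
  - apply: bndM => //; apply: bnd_abs; apply: bndB; [exact: bnd_jet|exact: bndC].
  - by apply: bndD; apply: bndM => //; [exact: bndC|exact: bndM|exact: bndC].
  move=> z zQ; have [h _] := jet_err z; rewrite -/c1 -/c2 in h.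
  (* The term linear in s is made accessible to [wt_moment] by s <= wdist / D + D / 2, from 2 s D <=
     s^2 + D^2 and s^2 <= 2 wdist. *)
  rewrite (_ : _ + _ = wt z x * (c1 * (wdist z x / D + D / 2) + c2 * (2 * wdist z x))); last by ring.
  apply: ler_wpM2l; first exact: wt_ge0.
  apply: le_trans h _; set s := `|x - pr z|.
  have s2 : s ^+ 2 <= 2 * wdist z x by exact: dist_le_wdist.
  apply: lerD; last by rewrite ler_wpM2l.
  rewrite ler_wpM2l // -(ler_pM2r dK_gt0) mulrDl divfK //.
  have := sqr_ge0 (s - D); rewrite -/D; nra.
rewrite intQD; [|by apply: bndM; [exact: bndC|exact: bndM]|by apply: bndM => //; exact: bndC].
rewrite !intQZ //; last exact: bndM.
rewrite -/(wsum x) -/S.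
have k0 : 0 <= c1 / D + 2 * c2 by apply: addr_ge0; [apply: divr_ge0 => //; exact: ltW|apply: mulr_ge0].
have := ler_wpM2l k0 mom; have S0 := ltW wsum_gt0.
have -> : (c1 / D + 2 * c2) * (Cw * D ^+ 2 * S) = S * (c1 * Cw * D + 2 * c2 * Cw * D ^+ 2).
  by field.
have -> : A1 * e * D + A2 * D ^+ 2 = c1 * Cw * D + c1 * D + 2 * c2 * Cw * D ^+ 2.
  by rewrite /A1 /A2 /c1 /c2; field; rewrite gt_eqF.
have : 0 <= S * (c1 * D) by rewrite !mulr_ge0 // ltW.
lra.
Qed.

Lemma avg_grad : intQ (fun z => wt z x * `|a (pr z) - a y'|) <= S * (e + A3 * D ^+ 2).
Proof.
have Ca0 := Ca_ge0; have bw := bnd_wtx; have bd := bnd_wdx.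
pose c2 := 8 * Ca / d ^+ 2; have c20 : 0 <= c2 by rewrite !mulr_ge0 ?invr_ge0 ?exprn_ge0 ?(ltW d0).
have := wt_moment K_half pr_in pr_near x_half dK_gt0; rewrite -/(wsum x) -/S -/D => mom.
apply: (@le_trans _ _ (intQ (fun z => e * wt z x + (2 * c2) * (wdist z x * wt z x)))).
  apply: intQ_le.
  - apply: bndM => //; exists (Ca + Ca) => z _; rewrite normr_id.
    by apply: le_trans (ler_normB _ _) _; apply: lerD; [exact: a_bound (pr_in z)|exact: a_bound (pr_in x)].
  - by apply: bndD; apply: bndM => //; [exact: bndC|exact: bndC|exact: bndM].
  move=> z zQ; have [_ h] := jet_err z; rewrite -/c2 in h.
  rewrite (_ : _ + _ = wt z x * (e + c2 * (2 * wdist z x))); last by ring.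
  apply: ler_wpM2l; first exact: wt_ge0.
  apply: le_trans h _; rewrite lerD2l ler_wpM2l //; exact: dist_le_wdist.
rewrite intQD; [|by apply: bndM => //; exact: bndC|by apply: bndM; [exact: bndC|exact: bndM]].
rewrite !intQZ //; last exact: bndM.
rewrite -/(wsum x) -/S; have k0 : 0 <= 2 * c2 by rewrite mulr_ge0.
have := ler_wpM2l k0 mom; rewrite /A3 /c2; lra.
Qed.

Lemma wavg_err : `|wavg x - J'| <= A1 * e * D + A2 * D ^+ 2.
Proof.
have S0 := wsum_gt0; have bw := bnd_wtx; have bj := bnd_jet.
have -> : wavg x - J' = intQ (fun z => wt z x * (jet z x - J')) / S.
  have -> : intQ (fun z => wt z x * (jet z x - J')) = jsum x - J' * S.
    rewrite /jsum /S /wsum -intQZ // -intQB; [|exact: bndM|by apply: bndM => //; exact: bndC].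
    by apply: intQ_ext => z _; ring.
  by rewrite /wavg -/S; field; rewrite gt_eqF.
rewrite normrM normfV (gtr0_norm S0) ler_pdivrMr // mulrC.
apply: le_trans avg_jet; apply: le_trans (intQ_abs_le _) _.
  by apply: bndM => //; apply: bndB => //; exact: bndC.
rewrite le_eqVlt; apply/orP; left; apply/eqP; apply: intQ_ext => z _.
by rewrite normrM (ger0_norm (wt_ge0 _ _ _)).
Qed.

(** The logarithmic derivative of the weight is of order 1 / D: both (x_i - z_i)^2 and D^2 / 8 are
    at most [wdist z x], and 3 bounds the square root of 8. *)
Lemma gwt_bound z i : `|gwt z x 0 i| <= 6 * N%:R / D * wt z x.
Proof.
have w0 := wdist_gt0 pr_in pr_near z dK_gt0.
have wN : wdist z x != 0 by rewrite gt_eqF.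
rewrite /gwt !mxE !normrM normrN !(@ger0_norm _ _%:R) //.
rewrite (ger0_norm (exprn_ge0 _ _)) ?invr_ge0 ?(ltW w0) //.
rewrite normfV (ger0_norm (exprn_ge0 _ (ltW w0))).
set c := `|x 0 i - z 0 i|; set W := wdist z x in w0 wN *.
have cW : c * D <= 3 * W.
  have c2 : c ^+ 2 <= W.
    have h : c <= `|x - z| by have := coord_le_norm (x - z) i; rewrite !mxE.
    apply: (@le_trans _ _ (`|x - z| ^+ 2)).
      by rewrite ler_pXn2r ?nnegrE // normr_ge0.
    exact: le_trans (norm_sq_le_dot _) (dot_le_wdist pr z x).
  have D2 : D ^+ 2 / 8 <= W := dK_wdist pr_in pr_near z x.
  have c0 : 0 <= c by exact: normr_ge0.
  rewrite -(@ler_pXn2r _ 2) ?nnegrE ?mulr_ge0 ?(ltW w0) ?(ltW dK_gt0) //.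
  have : c ^+ 2 * D ^+ 2 <= W * (8 * W) by rewrite ler_pM ?exprn_ge0 ?(ltW dK_gt0) //; lra.
  rewrite !exprMn; have := sqr_ge0 W; lra.
have -> : N%:R * W^-1 ^+ N.-1 * (W ^- 2 * (2 * c)) = (2 * N%:R) * (c / W) * (W^-1 ^+ N).
  rewrite /N /= [W^-1 ^+ n.+2]exprS -exprVn; ring.
rewrite (_ : wt z x = W^-1 ^+ N) // ler_wpM2r ?exprn_ge0 ?invr_ge0 ?(ltW w0) //.
have -> : 6 * N%:R / D = (2 * N%:R) * (3 / D) by ring.
rewrite ler_wpM2l ?mulr_ge0 // ler_pdivrMr // mulrAC ler_pdivlMr //.
Qed.

(* The gradient of the weighted average sees only [jet z x - J'], since the gradients of
   the normalised weights add up to [0]. *)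
Lemma gwavg_err : `|gwavg x - a y'| <= 12 * N%:R * (A1 * e + A2 * D) + (e + A3 * D ^+ 2).
Proof.
have S0 := wsum_gt0; have bw := bnd_wtx; have bj := bnd_jet; have Ca0 := Ca_ge0.
have DN : D != 0 by rewrite gt_eqF.
have SN : S != 0 by rewrite gt_eqF.
have Cw0 := Cw_ge0 R n; have wav := wavg_err; have aj := avg_jet; have ag := avg_grad.
have rhs0 : 0 <= A1 * e * D + A2 * D ^+ 2 by exact: le_trans wav.
have A30 : 0 <= A3.
  rewrite /A3; apply: mulr_ge0 => //; apply: mulr_ge0; first exact: mulr_ge0.
  by rewrite invr_ge0 exprn_ge0 // (ltW d0).
have N0 : 0 <= 6 * N%:R / D by rewrite divr_ge0 ?mulr_ge0 // ltW.
have E12 : 12 * N%:R * (A1 * e + A2 * D) = 6 * N%:R / D * (2 * (A1 * e * D + A2 * D ^+ 2)).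
  by field.
have ba i : bnd (fun z => a (pr z) 0 i).
  by exists Ca => z _; apply: le_trans (coord_le_norm _ i) _; exact: a_bound.
have bg i : bnd (fun z => gwt z x 0 i).
  have [M hM] := bw; exists (6 * N%:R / D * M) => z zQ; apply: le_trans (gwt_bound z i) _.
  by rewrite ler_wpM2l //; apply: le_trans (ler_norm _) _; exact: hM.
apply: norm_le_coord => [|i].
  apply: addr_ge0; first by rewrite E12; apply: mulr_ge0 => //; exact: mulr_ge0.
  by apply: addr_ge0 => //; apply: mulr_ge0 => //; exact: sqr_ge0.
have b1 : bnd (fun z => wt z x * (a (pr z) 0 i - a y' 0 i)).
  by apply: bndM => //; apply: bndB => //; exact: bndC.
have b2 : bnd (fun z => (jet z x - J') * gwt z x 0 i).
  by apply: bndM => //; apply: bndB => //; exact: bndC.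
have E : (gwavg x - a y') 0 i = (intQ (fun z => wt z x * (a (pr z) 0 i - a y' 0 i)) +
    intQ (fun z => (jet z x - J') * gwt z x 0 i) +
    (J' - wavg x) * intQ (fun z => gwt z x 0 i)) / S.
  have e1 : intQ (fun z => wt z x * (a (pr z) 0 i - a y' 0 i)) =
      intQ (fun z => wt z x * a (pr z) 0 i) - a y' 0 i * S.
    rewrite /S /wsum -intQZ // -intQB; [|exact: bndM|by apply: bndM => //; exact: bndC].
    by apply: intQ_ext => z _; ring.
  have e2 : intQ (fun z => (jet z x - J') * gwt z x 0 i) =
      intQ (fun z => jet z x * gwt z x 0 i) - J' * intQ (fun z => gwt z x 0 i).
    rewrite -intQZ // -intQB; [|exact: bndM|by apply: bndM => //; exact: bndC].
    by apply: intQ_ext => z _; ring.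
  have e3 : gjsum x 0 i = intQ (fun z => wt z x * a (pr z) 0 i) +
      intQ (fun z => jet z x * gwt z x 0 i).
    rewrite mxE -intQD; [|exact: bndM|exact: bndM].
    by apply: intQ_ext => z _; rewrite !mxE.
  have e4 (p q r : T) (s t v : R) :
      (s *: (t *: p) + v *: q - r) 0 i = s * (t * p 0 i) + v * q 0 i - r 0 i by rewrite !mxE.
  rewrite e1 e2 /gwavg e4 e3 [gwsum x 0 i]mxE /wavg -/S.
  by field.
rewrite E normrM normfV (gtr0_norm S0) ler_pdivrMr //.
have i1 : `|intQ (fun z => wt z x * (a (pr z) 0 i - a y' 0 i))| <= S * (e + A3 * D ^+ 2).
  apply: le_trans ag; apply: le_trans (intQ_abs_le b1) _; apply: intQ_le.
  - exact: bnd_abs.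
  - apply: bndM => //; exists (Ca + Ca) => z _; rewrite normr_id.
    by apply: le_trans (ler_normB _ _) _; apply: lerD; [exact: a_bound (pr_in z)|exact: a_bound (pr_in x)].
  move=> z _; rewrite normrM (ger0_norm (wt_ge0 _ _ _)) ler_wpM2l ?wt_ge0 //.
  by have := coord_le_norm (a (pr z) - a y') i; rewrite !mxE.
have i2 : `|intQ (fun z => (jet z x - J') * gwt z x 0 i)| <=
    6 * N%:R / D * (S * (A1 * e * D + A2 * D ^+ 2)).
  apply: le_trans (ler_wpM2l N0 aj); rewrite -intQZ; last first.
    by apply: bndM => //; apply: bnd_abs; apply: bndB => //; exact: bndC.
  apply: le_trans (intQ_abs_le b2) _; apply: intQ_le.
  - exact: bnd_abs.
  - apply: bndM; [exact: bndC|apply: bndM => //; apply: bnd_abs; apply: bndB => //; exact: bndC].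
  move=> z _; rewrite normrM mulrA [leLHS]mulrC ler_wpM2r //; exact: gwt_bound.
have i3 : `|intQ (fun z => gwt z x 0 i)| <= 6 * N%:R / D * S.
  rewrite /S /wsum -intQZ //; apply: le_trans (intQ_abs_le (bg i)) _; apply: intQ_le.
  - exact: bnd_abs.
  - by apply: bndM => //; exact: bndC.
  by move=> z _; exact: gwt_bound.
have i4 : `|(J' - wavg x) * intQ (fun z => gwt z x 0 i)| <=
    (A1 * e * D + A2 * D ^+ 2) * (6 * N%:R / D * S).
  by rewrite normrM ler_pM // distrC.
apply: le_trans (ler_normD _ _) _; apply: le_trans (lerD (ler_normD _ _) (lexx _)) _.
rewrite E12; lra.
Qed.

End Estimate.

End WhitneyC1.

Definition C1_jet (R : realType) (n : nat) (f : 'rV[R]_n -> R) (g : 'rV[R]_n -> 'rV[R]_n) (x : 'rV[R]_n) :=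
  forall e : R, 0 < e -> exists d : R, 0 < d /\ forall x', `|x' - x| < d ->
    `|f x' - f x - dot (g x) (x' - x)| <= e * `|x' - x| /\ `|g x' - g x| <= e.

Lemma C1_jet_C11 (R : realType) (n : nat) (f : 'rV[R]_n -> R) g (B : 'rV[R]_n -> Prop) C x (eta : R) :
  C11 B C f g -> 0 < eta -> (forall x', `|x' - x| < eta -> B x') -> C1_jet f g x.
Proof.
move=> fC eta0 inB e e0; have C0 := C11_ge0 fC.
have C1 : 0 < C + 1 by rewrite ltr_wpDl.
have eC : 0 < e / (C + 1) by rewrite divr_gt0.
exists (Num.min eta (e / (C + 1))); split; first by rewrite lt_min eta0.
move=> x'; rewrite lt_min => /andP[h1]; rewrite ltr_pdivlMr // => h2.
have Bx : B x by apply: inB; rewrite subrr normr0.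
have Ce : C * `|x' - x| <= e by have := normr_ge0 (x' - x); nra.
split; last by apply: le_trans Ce; exact: (C11_glip fC Bx (inB _ h1)).
apply: le_trans (C11_taylor fC Bx (inB _ h1)) _.
by rewrite expr2 mulrA ler_wpM2r.
Qed.

Lemma C1_jet_ext (R : realType) (n : nat) (f f' : 'rV[R]_n -> R) g g' x (eta : R) : 0 < eta ->
  (forall x', `|x' - x| < eta -> f x' = f' x' /\ g x' = g' x') -> C1_jet f g x -> C1_jet f' g' x.
Proof.
move=> eta0 E h e /h[d [d0 hd]]; exists (Num.min eta d); split; first by rewrite lt_min eta0.
move=> x'; rewrite lt_min => /andP[/E[<- <-] /hd].
by have [<- <-] : f x = f' x /\ g x = g' x by apply: E; rewrite subrr normr0.
Qed.

(** Off K the extension is locally C^{1,1} by [C11_wavg]. At x in K, a nearby x' off K is compared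
    with the jet at [pr x'], and that jet with the one at x by compatibility, [pr x'] being within 3
    |x' - x| of x. *)
Lemma whitney_C1 (R : realType) (n : nat) (K : set 'rV[R]_n) (a : 'rV[R]_n -> 'rV[R]_n) (Ca : R) :
  closed K -> K !=set0 -> (forall y, K y -> `|y| <= 2^-1) -> (forall y, K y -> `|a y| <= Ca) ->
  (forall y, K y -> forall e : R, 0 < e -> exists d : R, 0 < d /\
    forall p q, K p -> K q -> `|p - y| < d -> `|q - y| < d ->
      `|a p - a q| <= e /\ `|dot (a p) (q - p)| <= e * `|q - p|) ->
  exists f g, (forall x, K x -> f x = 0 /\ g x = a x) /\
    forall x, `|x| < 2^-1 -> C1_jet f g x.
Proof.
move=> Kc K0 Kh ab jl; have [pr hpr] := near_projection Kc K0.
have pr_in z : K (pr z) := (hpr z).1.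
have pr_near z y : K y -> `|z - pr z| <= 2 * `|z - y| := (hpr z).2 y.
pose f x := if pselect (K x) then 0 else wavg pr a x.
pose g x := if pselect (K x) then a x else gwavg pr a x.
have fK x : K x -> f x = 0 /\ g x = a x by rewrite /f /g; case: pselect.
have fN x : ~ K x -> f x = wavg pr a x /\ g x = gwavg pr a x by rewrite /f /g; case: pselect.
move: f g fK fN => f g fK fN; exists f, g; split=> [|x xh]; first exact: fK.
have [Ky|nKx] := pselect (K x); last first.
  have : nbhs x (~` K) by apply: open_nbhs_nbhs; split => //; exact: closed_openC.
  move=> /nbhs_ballP[e0 /= e00 he0].
  pose eta := e0 / 2; have eta0 : 0 < eta by rewrite divr_gt0.
  have far x' y : `|x' - x| < eta -> K y -> eta <= `|x' - y|.
    move=> h Ky; rewrite leNgt; apply/negP => h2; apply: (he0 y) => //.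
    rewrite mx_norm_ball /ball_ /=.
    have := ler_normD (x - x') (x' - y); rewrite addrA subrK -[`|x - x'|]normrN opprB.
    by move: h h2; rewrite /eta; lra.
  have [C hC] := C11_wavg Kh pr_in pr_near ab eta0 far.
  have r0 : 0 < Num.min eta (2^-1 - `|x|) by rewrite lt_min eta0 /=; lra.
  have in' x' : `|x' - x| < Num.min eta (2^-1 - `|x|) -> `|x' - x| < eta /\ `|x'| < 2^-1.
    rewrite lt_min => /andP[h1 h2]; split => //.
    by have := ler_normD (x' - x) x; rewrite subrK; lra.
  apply: (C1_jet_ext r0 _ (C1_jet_C11 hC r0 in')) => x' /in'[h _].
  suff nK : ~ K x' by have [-> ->] := fN _ nK.
  by move=> Kx'; have := far x' x' h Kx'; rewrite subrr normr0; lra.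
move=> e e0; have [-> ->] := fK _ Ky.
have Ca0 : 0 <= Ca by exact: le_trans (normr_ge0 _) (ab _ Ky).
have Cw0 := Cw_ge0 R n; have n0 : 0 <= n%:R :> R by [].
have A10 : 0 <= A1 R n by rewrite /A1; apply: mulr_ge0; lra.
pose N : R := n.+2%:R; have N0 : 0 <= N by [].
pose c1 := 24 * N * A1 R n + 2 * A1 R n + 2 * n%:R + 8.
have c10 : 0 < c1.
  have : 0 <= 24 * N * A1 R n by apply: mulr_ge0 => //; apply: mulr_ge0.
  by rewrite /c1; lra.
pose e1 := e / (2 * c1); have e10 : 0 < e1 by rewrite divr_gt0 // mulr_gt0.
have e1c : e1 * c1 = e / 2 by rewrite /e1; field; rewrite gt_eqF.
have [d1 [d10 loc]] := jl _ Ky _ e10.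
have A20 : 0 <= A2 n Ca d1.
  rewrite /A2; apply: mulr_ge0 => //; apply: mulr_ge0; first by rewrite !mulr_ge0.
  by rewrite invr_ge0 ltW.
have A30 : 0 <= A3 n Ca d1.
  rewrite /A3; apply: mulr_ge0 => //; apply: mulr_ge0; first exact: mulr_ge0.
  by rewrite invr_ge0 exprn_ge0 // (ltW d10).
pose c2 := 24 * N * A2 n Ca d1 + 4 * A2 n Ca d1 + 4 * A3 n Ca d1 + 1.
have c20 : 0 < c2.
  have : 0 <= 24 * N * A2 n Ca d1 by apply: mulr_ge0 => //; apply: mulr_ge0.
  by rewrite /c2; lra.
pose d2 := e / (2 * c2); have d20 : 0 < d2 by rewrite divr_gt0 // mulr_gt0.
have d2c : d2 * c2 = e / 2 by rewrite /d2; field; rewrite gt_eqF.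
exists (Num.min (Num.min (d1 / 8) (2^-1 - `|x|)) (Num.min 1 d2)).
split; first by rewrite !lt_min divr_gt0 //= d20 ltr01 !andbT; lra.
move=> x'; rewrite !lt_min => /andP[/andP[h1 h2] /andP[h3 h4]].
have t0 := normr_ge0 (x' - x).
have x1 : `|x - x| < d1 by rewrite subrr normr0.
have e1e : e1 <= e.
  have : 1 <= c1.
    have : 0 <= 24 * N * A1 R n by apply: mulr_ge0 => //; apply: mulr_ge0.
    by rewrite /c1; lra.
  by move=> c11; have : e1 * 1 <= e1 * c1; [rewrite ler_wpM2l // ltW|rewrite e1c; lra].
have [Kx'|nKx'] := pselect (K x').
  have [-> ->] := fK _ Kx'; have h5 : `|x' - x| < d1 by lra.
  have [_ l1] := loc _ _ Ky Kx' x1 h5.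
  have [l2 _] := loc _ _ Kx' Ky h5 x1.
  rewrite subr0 sub0r normrN; split; last by apply: le_trans l2 _.
  by apply: le_trans l1 _; rewrite ler_wpM2r.
have [-> ->] := fN _ nKx'; have x'h : `|x'| <= 2^-1 by have := ler_normD (x' - x) x; rewrite subrK; lra.
have dK0 : 0 < dK pr x'.
  rewrite normr_gt0 subr_eq0; apply/eqP => E; apply: nKx'; rewrite E; exact: pr_in.
have Dt : dK pr x' <= 2 * `|x' - x| := pr_near x' _ Ky.
have w1 := wavg_err Kh pr_in pr_near ab Ky (ltW e10) d10 loc x'h h1 dK0.
have w2 := gwavg_err Kh pr_in pr_near ab Ky (ltW e10) d10 loc x'h h1 dK0.
have prx : `|pr x' - x| <= 3 * `|x' - x|.
  have := ler_normD (pr x' - x') (x' - x); rewrite addrA subrK -[`|pr x' - x'|]normrN opprB.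
  by rewrite -/(dK pr x'); lra.
have prd : `|pr x' - x| < d1 by lra.
have [l1 _] := loc _ _ (pr_in x') Ky prd x1.
have [_ l2] := loc _ _ Ky (pr_in x') x1 prd.
have D0 := ltW dK0; set D := dK pr x' in D0 Dt w1 w2.
set t := `|x' - x| in t0 h1 h2 h3 h4 Dt prx *.
have D2 : D ^+ 2 <= 4 * (d2 * t) by rewrite expr2; nra.
have D2' : D ^+ 2 <= 4 * d2.
  by apply: le_trans D2 _; rewrite ler_wpM2l // ler_piMr ?(ltW d20) // ltW.
have ee : e = e1 * c1 + d2 * c2 by rewrite e1c d2c; field.
have l3 := dot_le l1 (lexx `|x' - pr x'|).
have aD : A1 R n * e1 * D <= A1 R n * e1 * (2 * t).
  by rewrite ler_wpM2l // mulr_ge0 // ltW.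
have bD : A2 n Ca d1 * D ^+ 2 <= A2 n Ca d1 * (4 * (d2 * t)) by rewrite ler_wpM2l.
have bD' : A2 n Ca d1 * D <= A2 n Ca d1 * (2 * d2) by rewrite ler_wpM2l //; lra.
have cD : A3 n Ca d1 * D ^+ 2 <= A3 n Ca d1 * (4 * d2) by rewrite ler_wpM2l.
have nD : n%:R * (e1 * D) <= n%:R * (e1 * (2 * t)) by rewrite ler_wpM2l // ler_wpM2l // ltW.
have pD : e1 * `|pr x' - x| <= e1 * (3 * t) by rewrite ler_wpM2l // ltW.
have NA : 0 <= N * A1 R n by exact: mulr_ge0.
have NB : 0 <= N * A2 n Ca d1 by exact: mulr_ge0.
rewrite -/(dK pr x') -/D in l3; rewrite -/N in w2.
have p1 : 0 <= N * A1 R n * (e1 * t) by apply: mulr_ge0 => //; rewrite mulr_ge0 // ltW.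
have p2 : 0 <= N * A2 n Ca d1 * (d2 * t) by apply: mulr_ge0 => //; rewrite mulr_ge0 // ltW.
have p3 : 0 <= A3 n Ca d1 * (d2 * t) by apply: mulr_ge0 => //; rewrite mulr_ge0 // ltW.
have p4 : 0 <= e1 * t by rewrite mulr_ge0 // ltW.
have p5 : 0 <= d2 * t by rewrite mulr_ge0 // ltW.
have q1 : 0 <= A1 R n * e1 by apply: mulr_ge0 => //; exact: ltW.
have q2 : 0 <= A2 n Ca d1 * d2 by apply: mulr_ge0 => //; exact: ltW.
have q3 : N * (A2 n Ca d1 * D) <= N * (A2 n Ca d1 * (2 * d2)) by rewrite ler_wpM2l.
have q4 : 0 <= n%:R * e1 by apply: mulr_ge0 => //; exact: ltW.
split.
  rewrite (_ : _ - _ - _ = (wavg pr a x' - dot (a (pr x')) (x' - pr x')) +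
    (dot (a (pr x') - a x) (x' - pr x') - dot (a x) (pr x' - x))); last first.
    by rewrite !(dotBl, dotBr); ring.
  apply: le_trans (ler_normD _ _) _; apply: le_trans (lerD w1 (ler_normB _ _)) _.
  apply: le_trans (lerD (lerD aD bD) (lerD (le_trans l3 nD) (le_trans l2 pD))) _.
  by rewrite ee /c1 /c2; move: (e1) (d2) p1 p2 p3 p4 p5 => r1 r2 p1 p2 p3 p4 p5; lra.
apply: le_trans (_ : `|gwavg pr a x' - a (pr x')| + `|a (pr x') - a x| <= _).
  by rewrite (_ : gwavg pr a x' - a x = (gwavg pr a x' - a (pr x')) + (a (pr x') - a x)) ?ler_normD // addrA subrK.
apply: le_trans (lerD w2 l1) _.
have q5 : 0 <= N * A1 R n * e1 by apply: mulr_ge0 => //; exact: ltW.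
rewrite [leRHS]ee /c1 /c2; move: (ltW e10) (ltW d20) => e1p d2p; lra.
Qed.

Lemma jacobian_of_taylor (R : realType) n k (F : 'rV[R]_n -> 'rV[R]_k) (J : 'M[R]_(n, k)) x :
  (forall e : R, 0 < e -> exists d : R, 0 < d /\ forall x', `|x' - x| < d ->
    `|F x' - F x - (x' - x) *m J| <= e * `|x' - x|) ->
  differentiable F x /\ jacobian F x = J.
Proof.
move=> tay; pose df : {linear 'rV[R]_n -> 'rV[R]_k} := mulmxr J.
have dfc : continuous df.
  apply: bounded_linear_continuous; apply/bounded_funP => r.
  exists (n%:R * (r * `|J|)) => v vr; apply: le_trans (mulmx_norm _ _) _.
  by rewrite ler_wpM2l // ler_wpM2r.
pose V : normedModType R := 'rV[R]_n; pose W : normedModType R := 'rV[R]_k.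
have H : (F : V -> W) \o @shift V x = cst (F x) + (df : V -> W) +o_ (0 : V) id.
  apply/eqaddoP => e e0; have [d [d0 hd]] := tay e e0.
  apply/nbhs_ballP; exists d => //= v; rewrite mx_norm_ball /ball_ /= sub0r normrN => vd.
  have := hd (v + x); rewrite addrK => /(_ vd).
  by rewrite !fctE /= opprD addrA.
have U := diff_unique dfc H.
split; first by apply/diff_locallyP; rewrite U.
by rewrite /jacobian U; apply/row_matrixP => i; rewrite !rowE mul_rV_lin1.
Qed.

(** If v L J = 0, then |v| = |v (L J - 1)| <= k / (k + 1) |v|, so v = 0. Maximal rank is thereby
    stable under small changes of J. *)
Lemma rank_near_identity (R : realType) n k (L : 'M[R]_(k, n)) (J : 'M[R]_(n, k)) :
  `|L *m J - 1%:M| <= (k%:R + 1)^-1 -> \rank J = k.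
Proof.
move=> h; apply/eqP; rewrite eqn_leq rank_leq_col /=.
have LJ : row_free (L *m J).
  rewrite -kermx_eq0; apply/rowV0P => v /sub_kermxP vLJ.
  have k1 : 0 < k%:R + 1 :> R by rewrite ltr_wpDl.
  have := mulmx_norm v (L *m J - 1%:M); rewrite mulmxBr vLJ mulmx1 sub0r normrN.
  have v0 := normr_ge0 v; have kV : 0 < (k%:R + 1)^-1 :> R by rewrite invr_gt0.
  move=> h2; have h3 : `|v| <= k%:R * (`|v| * (k%:R + 1)^-1).
    by apply: le_trans h2 _; rewrite ler_wpM2l // ler_wpM2l.
  apply/eqP; rewrite -normr_eq0 eq_le v0 andbT.
  have : `|v| * (k%:R + 1) <= k%:R * `|v| by rewrite -ler_pdivlMr // -mulrA.
  lra.
by rewrite -{1}(eqP LJ) mxrankM_maxr.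
Qed.

Lemma closure_norm (R : realType) n (E : set 'rV[R]_n) y :
  closure E y <-> forall d : R, 0 < d -> exists z, E z /\ `|z - y| < d.
Proof.
split=> [Ey d d0|h B /nbhs_ballP[d /= d0 dB]].
  have [z [Ez]] := Ey _ (nbhsx_ballx y d d0).
  by rewrite mx_norm_ball /ball_ /= distrC => h; exists z.
have [z [Ez zd]] := h d d0; exists z; split => //; apply: dB.
by rewrite mx_norm_ball /ball_ /= distrC.
Qed.

(** The substitution x = x0 + s z reduces to the cube of radius 1/2; the factor s in front of f
    restores the gradient [a]. *)
Lemma whitney_C1_scaled (R : realType) (n : nat) (K : set 'rV[R]_n) (a : 'rV[R]_n -> 'rV[R]_n) (Ca s : R) x0 :
  0 < s -> closed K -> K !=set0 -> (forall y, K y -> `|y - x0| <= s / 2) ->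
  (forall y, K y -> `|a y| <= Ca) ->
  (forall y, K y -> forall e : R, 0 < e -> exists d : R, 0 < d /\
    forall p q, K p -> K q -> `|p - y| < d -> `|q - y| < d ->
      `|a p - a q| <= e /\ `|dot (a p) (q - p)| <= e * `|q - p|) ->
  exists f g, (forall x, K x -> f x = 0 /\ g x = a x) /\
    forall x, `|x - x0| < s / 2 -> C1_jet f g x.
Proof.
move=> s0 Kc [k0 Kk0] Ks ab loc; have sN : s != 0 by rewrite gt_eqF.
pose h z := x0 + s *: z; pose hV x := s^-1 *: (x - x0).
have hK x : h (hV x) = x by rewrite /h /hV scalerA mulfV // scale1r addrC subrK.
have hVK z : hV (h z) = z by rewrite /h /hV addrC addKr scalerA mulVf // scale1r.
have hB z w : h z - h w = s *: (z - w) by rewrite /h opprD addrACA subrr add0r scalerBr.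
have hVB x y : hV x - hV y = s^-1 *: (x - y).
  by rewrite /hV -scalerBr opprB addrA subrK.
have nB z w : `|h z - h w| = s * `|z - w| by rewrite hB normrZ gtr0_norm.
pose K' := [set z | K (h z)].
have Kc' : closed K'.
  apply/closure_id/seteqP; split; first exact: subset_closure.
  move=> z /closure_norm zc; apply: Kc; apply/closure_norm => d d0.
  have [w [Kw wz]] := zc (d / s) (divr_gt0 d0 s0).
  by exists (h w); split => //; rewrite nB mulrC -ltr_pdivlMr.
have [||||f [g [fg jt]]] := @whitney_C1 R n K' (fun z => a (h z)) Ca Kc'.
- by exists (hV k0); rewrite /K' /= hK.
- move=> z /Ks; rewrite /h addrC addKr normrZ gtr0_norm //.
  by rewrite -ler_pdivlMl // mulrA mulVf // mul1r.
- by move=> z /ab.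
- move=> z Kz e e0; have [d [d0 hd]] := loc _ Kz e e0.
  exists (d / s); split; first exact: divr_gt0.
  move=> p q Kp Kq; rewrite !ltr_pdivlMr // ![_ * s]mulrC -!nB => pz qz.
  have [h1 h2] := hd _ _ Kp Kq pz qz; split => //.
  rewrite -(ler_pM2l s0) mulrCA -nB; apply: le_trans h2.
  by rewrite hB dotZr normrM gtr0_norm.
exists (fun x => s * f (hV x)), (fun x => g (hV x)); split=> [x Kx|x xs].
  have [|-> ->] := fg (hV x); first by rewrite /K' /= hK.
  by rewrite mulr0 hK.
have hx : `|hV x| < 2^-1 by rewrite /hV normrZ normfV gtr0_norm // mulrC ltr_pdivrMr // mulrC.
move=> e e0; have [d [d0 hd]] := jt _ hx e e0.
exists (s * d); split; first exact: mulr_gt0.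
move=> x' x'd; have nV : `|hV x' - hV x| = s^-1 * `|x' - x|.
  by rewrite hVB normrZ normfV gtr0_norm.
have [|h1 h2] := hd (hV x'); first by rewrite nV mulrC ltr_pdivrMr // mulrC.
split => //; rewrite nV in h1.
have -> : s * f (hV x') - s * f (hV x) - dot (g (hV x)) (x' - x) =
   s * (f (hV x') - f (hV x) - dot (g (hV x)) (hV x' - hV x)).
  by rewrite hVB dotZr; field.
rewrite normrM gtr0_norm // -ler_pdivlMl //; apply: le_trans h1 _.
by rewrite mulrCA.
Qed.

(** * The stratum lies in a C^1 submanifold *)

Lemma adherent_limit (R : realType) n (E : set 'rV[R]_n) (A : 'rV[R]_n -> 'M[R]_n) y (C : R) :
  closure E y -> (forall p, E p -> `|A p| <= C) ->
  (forall e : R, 0 < e -> exists d : R, 0 < d /\ forall p q, E p -> E q ->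
    `|p - y| < d -> `|q - y| < d -> `|A p - A q| <= e) ->
  exists b, forall e : R, 0 < e -> exists d : R, 0 < d /\ forall p, E p -> `|p - y| < d ->
    `|A p - b| <= e.
Proof.
move=> /closure_norm Ey AC cau.
have /choice[s hs] : forall k, exists p, E p /\ `|p - y| < k.+1%:R^-1.
  by move=> k; apply: Ey; rewrite invr_gt0.
have sb i j : bounded_seq (fun k => A (s k) i j).
  by exists C => k; apply: le_trans (entry_le_norm _ _ _) _; apply: AC; case: (hs k).
exists (\matrix_(i, j) ulim (fun k => A (s k) i j)) => e e0.
have [d [d0 hd]] := cau e e0; exists d; split => // p Ep pd.
apply: mx_norm_le => [|i j]; first exact: ltW.
have [N0 hN0] : exists N0 : nat, forall k, (N0 <= k)%N -> `|s k - y| < d.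
  exists (Num.bound d^-1) => k Nk; apply: lt_le_trans (hs k).2 _.
  have dV : 0 <= d^-1 by rewrite invr_ge0 ltW.
  rewrite -[leRHS]invrK lef_pV2 ?posrE ?invr_gt0 //.
  apply: le_trans (ltW (archi_boundP dV)) _; rewrite ler_nat; exact: leqW.
pose c k := if (N0 <= k)%N then A (s k) i j else A p i j.
have cE : ulim (fun k => A (s k) i j) = ulim c.
  by apply: (ulim_eventually (N0 := N0)) => // k Nk; rewrite /c Nk.
have cn k : `|A p i j - c k| <= e.
  rewrite /c; case: ifP => Nk; last by rewrite subrr normr0 ltW.
  have := hd _ _ Ep (hs k).1 pd (hN0 _ Nk).
  by apply: le_trans; have := entry_le_norm (A p - A (s k)) i j; rewrite !mxE.
have cb : bounded_seq c.
  exists (`|A p i j| + e) => k; rewrite (_ : c k = A p i j - (A p i j - c k)); last by ring.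
  by apply: le_trans (ler_normB _ _) _; rewrite lerD2l.
have bc (r : R) : bounded_seq (fun _ : nat => r) by exists `|r|.
have l1 : ulim c <= A p i j + e.
  rewrite -(ulim_cst (A p i j + e)); apply: ulim_le => // k.
  by have := cn k; rewrite ler_norml => /andP[? ?]; lra.
have l2 : A p i j - e <= ulim c.
  rewrite -(ulim_cst (A p i j - e)); apply: ulim_le => // k.
  by have := cn k; rewrite ler_norml => /andP[? ?]; lra.
by rewrite !mxE cE ler_norml; apply/andP; split; lra.
Qed.

(** Whitney's theorem asks for data on a closed set. The estimates around limit points make A Cauchy
    there, so it extends by limits; at the added points B is just this limit, with no blow-up
    attached to it. *)
Lemma closure_jet (R : realType) n (E : set 'rV[R]_n) (A : 'rV[R]_n -> 'M[R]_n) (C : R) :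
  (forall p, E p -> `|A p| <= C) ->
  (forall y, closure E y -> forall e : R, 0 < e -> exists d : R, 0 < d /\
    forall p q, E p -> E q -> `|p - y| < d -> `|q - y| < d ->
      `|A p - A q| <= e /\ `|(q - p) *m A p| <= e * `|q - p|) ->
  exists B : 'rV[R]_n -> 'M[R]_n, (forall p, E p -> B p = A p) /\
    (forall p, closure E p -> `|B p| <= C + 1) /\
    (forall y, closure E y -> forall e : R, 0 < e -> exists d : R, 0 < d /\
      forall p q, closure E p -> closure E q -> `|p - y| < d -> `|q - y| < d ->
        `|B p - B q| <= e /\ `|(q - p) *m B p| <= e * `|q - p|).
Proof.
move=> AC key; pose lm y b := forall e : R, 0 < e -> exists d : R, 0 < d /\
  forall p, E p -> `|p - y| < d -> `|A p - b| <= e.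
have /choice[B hB] : forall y, exists b, (E y -> b = A y) /\ (closure E y -> lm y b).
  move=> y; have [Ey|nEy] := pselect (E y).
    exists (A y); split => // cy e e0; have [d [d0 hd]] := key _ cy e e0.
    exists d; split => // p Ep pd; have yy : `|y - y| < d by rewrite subrr normr0.
    by have [] := hd _ _ Ep Ey pd yy.
  have [cy|ncy] := pselect (closure E y); last by exists 0; split => // /ncy.
  have [|b hb] := adherent_limit cy AC; last by exists b; split => // /nEy.
  move=> e e0; have [d [d0 hd]] := key _ cy e e0; exists d; split => // p q Ep Eq pd qd.
  by have [] := hd _ _ Ep Eq pd qd.
have approx p (e : R) : closure E p -> 0 < e ->
    exists p', E p' /\ `|p' - p| <= e /\ `|A p' - B p| <= e.
  move=> cp e0; have [d [d0 hd]] := (hB p).2 cp e e0.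
  have m0 : 0 < Num.min d e by rewrite lt_min d0.
  have [p' [Ep']] := (closure_norm E p).1 cp _ m0; rewrite lt_min => /andP[h1 h2].
  by exists p'; split => //; split; [exact: ltW|exact: hd].
exists B; split=> [p Ep|]; first by apply: (hB p).1.
split=> [p cp|y cy e e0].
  have [p' [Ep' [_ h]]] := approx p 1 cp ltr01.
  rewrite (_ : B p = A p' - (A p' - B p)); last by rewrite opprB addrCA subrr addr0.
  by apply: le_trans (ler_normB _ _) _; apply: lerD => //; exact: AC.
have C0 : 0 <= C.
  have [p' [Ep' _]] := approx y 1 cy ltr01; exact: le_trans (normr_ge0 _) (AC _ Ep').
(* The sum of the three error coefficients in the last estimate below. *)
pose K : R := 3 + n%:R + 2 * n%:R * C; have n0 : 0 <= n%:R :> R by [].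
have nC : 0 <= n%:R * C by exact: mulr_ge0.
have K0 : 0 < K by rewrite /K; lra.
pose e1 := e / K; have e10 : 0 < e1 by rewrite divr_gt0.
have eE : e = e1 * K by rewrite /e1; field; rewrite gt_eqF.
have [d [d0 hd]] := key _ cy e1 e10.
exists (d / 2); split=> [|p q cp cq pd qd]; first by rewrite divr_gt0.
have near' (z z' : 'rV[R]_n) : `|z - y| < d / 2 -> `|z' - z| <= d / 4 -> `|z' - y| < d.
  by move=> h1 h2; have := ler_normD (z' - z) (z - y); rewrite addrA subrK; lra.
have d40 : 0 < d / 4 by rewrite divr_gt0.
have e3 : 3 * e1 <= e by rewrite eE /K; nra.
split.
  have m0 : 0 < Num.min (d / 4) e1 by rewrite lt_min d40.
  have [p' [Ep' []]] := approx p _ cp m0; rewrite !le_min => /andP[p1 _] /andP[_ p2].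
  have [q' [Eq' []]] := approx q _ cq m0; rewrite !le_min => /andP[q1 _] /andP[_ q2].
  have [h _] := hd _ _ Ep' Eq' (near' _ _ pd p1) (near' _ _ qd q1).
  rewrite (_ : B p - B q = (A q' - B q) - (A p' - B p) + (A p' - A q')); last first.
    by apply/matrixP => i j; rewrite !mxE; ring.
  apply: le_trans (ler_normD _ _) _; apply: le_trans (lerD (ler_normB _ _) h) _; lra.
have [->|qp] := eqVneq q p; first by rewrite subrr mul0mx !normr0 mulr0.
have t0 : 0 < `|q - p| by rewrite normr_gt0 subr_eq0.
set t := `|q - p| in t0 *.
(* Points of [E] within e1 t of p and q change the product by a multiple of e1 t only; within t they
   keep |q' - p'| at most 3 t. *)
have m0 : 0 < Num.min (d / 4) (Num.min e1 (Num.min (e1 * t) t)).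
  by rewrite !lt_min d40 e10 t0 mulr_gt0.
have [p' [Ep' []]] := approx p _ cp m0.
rewrite !le_min => /and4P[p1 _ p3 p4] /and4P[_ p2 _ _].
have [q' [Eq' []]] := approx q _ cq m0.
rewrite !le_min => /and4P[q1 _ q3 q4] _.
have [_ h] := hd _ _ Ep' Eq' (near' _ _ pd p1) (near' _ _ qd q1).
have E1 : (q - p) *m B p = (q' - p') *m A p' + ((p' - p) - (q' - q)) *m A p' - (q - p) *m (A p' - B p).
  rewrite -mulmxDl (_ : (q' - p') + ((p' - p) - (q' - q)) = q - p); last by apply/rowP => i; rewrite !mxE; ring.
  by rewrite -mulmxBr opprB addrCA subrr addr0.
have n1 := mulmx_norm ((p' - p) - (q' - q)) (A p').
have n2 := mulmx_norm (q - p) (A p' - B p).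
have n3 : `|(p' - p) - (q' - q)| <= 2 * (e1 * t).
  by apply: le_trans (ler_normB _ _) _; lra.
have n4 : `|q' - p'| <= 3 * t.
  have -> : q' - p' = (q - p) + ((q' - q) - (p' - p)) by apply/rowP => i; rewrite !mxE; ring.
  apply: le_trans (ler_normD _ _) _; apply: le_trans (lerD (lexx _) (ler_normB _ _)) _.
  by rewrite -/t; lra.
have n5 : n%:R * (`|(p' - p) - (q' - q)| * `|A p'|) <= n%:R * (2 * (e1 * t) * C).
  by rewrite ler_wpM2l // ler_pM // AC.
have n6 : n%:R * (`|q - p| * `|A p' - B p|) <= n%:R * (t * e1).
  by rewrite ler_wpM2l // ler_wpM2l // ltW.
have n7 : e1 * `|q' - p'| <= e1 * (3 * t) by rewrite ler_wpM2l // ltW.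
rewrite E1; apply: le_trans (ler_normB _ _) _; apply: le_trans (lerD (ler_normD _ _) (lexx _)) _.
rewrite eE /K; lra.
Qed.

(** [P] picks k independent combinations of the columns of A, and [L] certifies their independence
    in the form that [rank_near_identity] perturbs. *)
Lemma rank_factor (R : realType) n k (A : 'M[R]_n) : \rank A = k ->
  exists (P : 'M[R]_(n, k)) (L : 'M[R]_(k, n)), L *m (A *m P) = 1%:M.
Proof.
move=> <-; have /row_freeP[P hP] := row_base_free A.
have /row_fullP[L hL] := col_base_full A.
exists P, L; have -> : A *m P = col_base A *m (row_base A *m P) by rewrite mulmxA mulmx_base.
by rewrite hP mulmx1.
Qed.

(** Whitney's theorem is applied to each column of [B y *m P]; the finitely many radii have a common
    positive lower bound. *)
Lemma C1_map (R : realType) (n k : nat) (K : set 'rV[R]_n) (B : 'rV[R]_n -> 'M[R]_n) (P : 'M[R]_(n, k))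
    (CB s : R) x0 :
  0 < s -> closed K -> K !=set0 -> (forall y, K y -> `|y - x0| <= s / 2) ->
  (forall y, K y -> `|B y| <= CB) ->
  (forall y, K y -> forall e : R, 0 < e -> exists d : R, 0 < d /\
    forall p q, K p -> K q -> `|p - y| < d -> `|q - y| < d ->
      `|B p - B q| <= e /\ `|(q - p) *m B p| <= e * `|q - p|) ->
  exists (F : 'rV[R]_n -> 'rV[R]_k) (J : 'rV[R]_n -> 'M[R]_(n, k)),
    (forall x, K x -> F x = 0 /\ J x = B x *m P) /\
    forall x, `|x - x0| < s / 2 -> [/\ differentiable F x, jacobian F x = J x &
      forall e : R, 0 < e -> exists d : R, 0 < d /\ forall x', `|x' - x| < d -> `|J x' - J x| <= e].
Proof.
move=> s0 Kc K0 Ks BC loc.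
pose a j y := (col j (B y *m P))^T.
have aE j y i : a j y 0 i = (B y *m P) i j by rewrite !mxE.
have aN j (X : 'M[R]_n) : `|(col j (X *m P))^T| <= n%:R * (`|X| * `|P|).
  apply: norm_le_coord => [|i]; first by rewrite !mulr_ge0.
  have -> : (col j (X *m P))^T 0 i = (X *m P) i j by rewrite !mxE.
  exact: le_trans (entry_le_norm _ _ _) (mulmx_norm X P).
have P1 : 0 < n%:R * `|P| + 1 by rewrite ltr_wpDl // mulr_ge0.
have /choice[fg hfg] : forall j, exists fg : ('rV[R]_n -> R) * ('rV[R]_n -> 'rV[R]_n),
    (forall x, K x -> fg.1 x = 0 /\ fg.2 x = a j x) /\
    forall x, `|x - x0| < s / 2 -> C1_jet fg.1 fg.2 x.
  move=> j.
  have [||f [g h]] := @whitney_C1_scaled R n K (a j) (n%:R * (CB * `|P|)) s x0 s0 Kc K0 Ks.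
  - move=> y Ky; apply: le_trans (aN _ _) _; rewrite ler_wpM2l // ler_wpM2r //; exact: BC.
  - move=> y Ky e e0; have e10 : 0 < e / (n%:R * `|P| + 1) by rewrite divr_gt0.
    have [d [d0 hd]] := loc y Ky _ e10.
    have eP : n%:R * (e / (n%:R * `|P| + 1) * `|P|) <= e.
      rewrite (_ : _ * _ = e * ((n%:R * `|P|) / (n%:R * `|P| + 1))); last by ring.
      by rewrite ler_piMr ?(ltW e0) // ler_pdivrMr // mul1r lerDl.
    exists d; split => // p q Kp Kq pd qd; have [h1 h2] := hd _ _ Kp Kq pd qd.
    split.
      rewrite /a -linearB /= -linearB /= -mulmxBl; apply: le_trans (aN _ _) _.
      by apply: le_trans eP; rewrite ler_wpM2l // ler_wpM2r.
    have -> : dot (a j p) (q - p) = ((q - p) *m B p *m P) 0 j.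
      rewrite -mulmxA mxE; apply: eq_bigr => i _; rewrite aE; exact: mulrC.
    apply: le_trans (coord_le_norm _ _) _; apply: le_trans (mulmx_norm _ _) _.
    apply: (@le_trans _ _ (n%:R * (e / (n%:R * `|P| + 1) * `|q - p| * `|P|))).
      by rewrite ler_wpM2l // ler_wpM2r.
    rewrite (_ : _ * _ = n%:R * (e / (n%:R * `|P| + 1) * `|P|) * `|q - p|); last by ring.
    by rewrite ler_wpM2r.
  by exists (f, g).
exists (fun x => \row_j (fg j).1 x), (fun x => \matrix_(i, j) (fg j).2 x 0 i).
split=> [x Kx|x xs].
  split; [apply/rowP|apply/matrixP] => i.
    by rewrite !mxE; have [[-> _]] := (hfg i).1 x Kx.
  by move=> j; rewrite mxE; have [_ ->] := (hfg j).1 x Kx; rewrite aE.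
have unif (e : R) : 0 < e -> exists d : R, 0 < d /\ forall j x', `|x' - x| < d ->
    `|(fg j).1 x' - (fg j).1 x - dot ((fg j).2 x) (x' - x)| <= e * `|x' - x| /\
    `|(fg j).2 x' - (fg j).2 x| <= e.
  move=> e0; have /choice[d hd] : forall j, exists d : R, 0 < d /\ forall x', `|x' - x| < d ->
      `|(fg j).1 x' - (fg j).1 x - dot ((fg j).2 x) (x' - x)| <= e * `|x' - x| /\
      `|(fg j).2 x' - (fg j).2 x| <= e by move=> j; exact: (hfg j).2.
  have [d' [d'0 h]] := fin_min_pos (fun j => (hd j).1).
  by exists d'; split => // j x' x'd; apply: (hd j).2; exact: lt_le_trans x'd (h j).
set J := fun x => \matrix_(i, j) (fg j).2 x 0 i.
have [|D Jx] := @jacobian_of_taylor R n k (fun x => \row_j (fg j).1 x) (J x) x.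
  move=> e e0; have [d [d0 hd]] := unif e e0; exists d; split => // x' x'd.
  apply: norm_le_coord => [|j]; first by rewrite mulr_ge0 // ltW.
  have [h _] := hd j x' x'd.
  have E : ((x' - x) *m J x) 0 j = dot ((fg j).2 x) (x' - x).
    by rewrite mxE; apply: eq_bigr => i _; rewrite /J [X in _ * X]mxE mulrC.
  have E2 (p q r : 'rV[R]_k) : (p - q - r) 0 j = p 0 j - q 0 j - r 0 j by rewrite !mxE.
  by rewrite E2 E !mxE.
split => // e e0; have [d [d0 hd]] := unif e e0; exists d; split => // x' x'd.
apply: mx_norm_le => [|i j]; first exact: ltW.
have [_ h] := hd j x' x'd; apply: le_trans h.
by have := coord_le_norm ((fg j).2 x' - (fg j).2 x) i; rewrite !mxE.
Qed.

Lemma stratum_in_submanifold (R : realType) (n m : nat) u (x0 : 'rV[R]_n) rho L (S : set 'rV[R]_n) :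
  (0 < n)%N -> (m <= n)%N -> local_sol u x0 rho L -> S x0 ->
  (forall y, S y -> exists A, full_blowup u y A /\ \rank (kermx A) = m) ->
  exists (r : R) (M : set 'rV[R]_n), 0 < r /\ C1_submanifold m M /\ S `&` ball x0 r `<=` M.
Proof.
move=> n0 mn us Sx0 SA; have rho0 := reg_rho (loc_reg us).
have /choice[A hA] : forall y, exists A, S y -> full_blowup u y A /\ \rank (kermx A) = m.
  move=> y; have [Sy|nSy] := pselect (S y); last by exists 0.
  by have [A hA] := SA y Sy; exists A.
(* The non-strict bound survives in the closure, where [stratum_key] and [C1_map] need it. *)
pose E := [set y | S y /\ `|y - x0| <= rho / 2].
have Ex0 : E x0 by split => //; rewrite subrr normr0 divr_ge0 // ltW.
have EA y : E y -> `|y - x0| <= rho / 2 /\ full_blowup u y (A y).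
  by move=> [Sy yx]; split => //; have [] := hA y Sy.
have EAn y : E y -> `|A y| <= 1 by move=> /EA[_ [/Pmat_norm]].
have clE y : closure E y -> `|y - x0| <= rho / 2.
  move=> /closure_norm yc; apply/ler_addgt0Pr => e e0; have [z [[_ zx] zy]] := yc e e0.
  by have := ler_normD (y - z) (z - x0); rewrite addrA subrK -[`|y - z|]normrN opprB; lra.
have [|B [BA [Bn loc]]] := @closure_jet R n E A 1 EAn.
  move=> y cy e e0; apply: (stratum_key n0 us EA (clE y cy) _ e0).
  exact: (closure_norm E y).1.
have kA : \rank (A x0) = (n - m)%N.
  have [_] := hA x0 Sx0; rewrite mxrank_ker => <-.
  by rewrite subKn // rank_leq_row.
have [P [Lm hL]] := rank_factor kA.
have E0 : closure E !=set0 by exists x0; exact: subset_closure.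
have [F [J [FK FJ]]] := @C1_map R n _ (closure E) B P (1 + 1) rho x0 rho0 (@closed_closure _ E) E0 clE Bn loc.
have x00 : `|x0 - x0| < rho / 2 by rewrite subrr normr0 divr_gt0.
have Jx0 : Lm *m J x0 = 1%:M.
  by have [_ ->] := FK x0 (subset_closure Ex0); rewrite BA.
have [_ _ Jc] := FJ x0 x00.
(* If J moves by at most [c], then [Lm *m J] moves by at most 1 / (k + 1), as [rank_near_identity]
   allows. *)
pose k := (n - m)%N; pose c := (k%:R + 1 : R)^-1 / (n%:R * `|Lm| + 1).
have Lp : 0 < n%:R * `|Lm| + 1 by rewrite ltr_wpDl // mulr_ge0.
have k1 : 0 < k%:R + 1 :> R by rewrite ltr_wpDl.
have c0 : 0 < c by rewrite divr_gt0 // invr_gt0.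
have [d [d0 hd]] := Jc c c0.
have Jrk x : `|x - x0| < d -> \rank (J x) = k.
  move=> /hd h; apply: (@rank_near_identity R n k Lm).
  rewrite -Jx0 -mulmxBr; apply: le_trans (mulmx_norm _ _) _.
  apply: (@le_trans _ _ (n%:R * (`|Lm| * c))); first by rewrite ler_wpM2l // ler_wpM2l.
  rewrite /c (_ : _ * _ = (k%:R + 1)^-1 * ((n%:R * `|Lm|) / (n%:R * `|Lm| + 1))); last by ring.
  by rewrite ler_piMr ?invr_ge0 ?(ltW k1) // ler_pdivrMr // mul1r lerDl.
pose r := Num.min d (rho / 2); have r0 : 0 < r by rewrite lt_min d0 divr_gt0.
have inV x : ball x0 r x -> `|x - x0| < d /\ `|x - x0| < rho / 2.
  by rewrite mx_norm_ball /ball_ /= distrC lt_min => /andP.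
(* The zero set is taken inside the open ball, so the same [F] and ball serve at each of its
   points. *)
exists r, [set x | ball x0 r x /\ F x = 0]; split => //; split.
  split=> // y [yV Fy]; exists (ball x0 r), F; split; first exact: ball_open.
  split=> //; split; last split.
  - split=> [x /inV[_ h]|i j x xV]; first by have [] := FJ x h.
    have [_ xr] := inV x xV.
    have [_ Jx Jxc] := FJ x xr.
    apply/(@cvgrPdist_le _ _ _ (nbhs x)) => e e0; have [d' [d'0 hd']] := Jxc e e0.
    have : nbhs x (ball x0 r) by apply: open_nbhs_nbhs; split => //; exact: ball_open.
    move=> /nbhs_ballP[t /= t0 tV].
    apply/nbhs_ballP; exists (Num.min t d') => [|z zb]; first by rewrite /= lt_min t0.
    have zV : ball x0 r z by apply: tV; apply: le_ball zb; rewrite ge_min lexx.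
    have [_ Jz _] := FJ z (inV z zV).2.
    rewrite Jx Jz distrC.
    have zd : `|z - x| < d'.
      by move: zb; rewrite mx_norm_ball /ball_ /= distrC lt_min => /andP[].
    by apply: le_trans (hd' z zd); have := entry_le_norm (J z - J x) i j; rewrite !mxE.
  - by move=> x /inV[h1 h2]; have [_ -> _] := FJ x h2; exact: Jrk.
  - by apply/seteqP; split=> [x [[? ?] _]|x [? ?]].
move=> y [Sy yV]; split => //; have [_ h] := inV y yV.
by have [] := FK y (subset_closure (conj Sy (ltW h))).
Qed.

Lemma derive_grad (R : realType) n (u : 'rV[R]_n -> R) x v : differentiable u x ->
  'D_v u x = dot (grad u x) v.
Proof.
move=> du; rewrite deriveE //; have E := row_sum_delta v.
rewrite {1}E linear_sum /= /dot; apply: eq_bigr => i _.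
by rewrite linearZ /= mxE /partial deriveE // mulrC.
Qed.

(** The mean value theorem along the segment from x to y, which stays in the convex ball; the factor
    n comes from bounding [dot] by sup norms. *)
Lemma taylor_of_C11_loc (R : realType) n (u : 'rV[R]_n -> R) x0 (r L : R) : 0 <= L ->
  (forall x, `|x - x0| < r -> differentiable u x) ->
  (forall x y, `|x - x0| < r -> `|y - x0| < r -> `|grad u y - grad u x| <= L * `|y - x|) ->
  forall x y, `|x - x0| < r -> `|y - x0| < r ->
    `|u y - u x - dot (grad u x) (y - x)| <= n%:R * L * `|y - x| ^+ 2.
Proof.
move=> L0 du gl x y xr yr; pose v := y - x; pose p (t : R) := x + t *: v.
have pr t : 0 <= t <= 1 -> `|p t - x0| < r.
  move=> /andP[t0 t1].
  rewrite (_ : p t - x0 = (1 - t) *: (x - x0) + t *: (y - x0)); last first.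
    by apply/rowP => i; rewrite !mxE; ring.
  apply: le_lt_trans (ler_normD _ _) _; rewrite !normrZ (ger0_norm t0) ger0_norm ?subr_ge0 //.
  have [t1'|t1'] := ltP t 1; nra.
pose g t := u (p t).
have gd t : 0 <= t <= 1 -> is_derive (t : R) (1 : R) g (dot (grad u (p t)) v).
  move=> /pr/du dp; rewrite -derive_grad //.
  have E : (fun h : R => h^-1 *: ((g \o shift t) (h *: 1) - g t)) =
      (fun h => h^-1 *: ((u \o shift (p t)) (h *: v) - u (p t))).
    apply/funext => h /=; congr (_ *: (u _ - _)).
    by rewrite /p [h *: 1]mulr1 scalerDl addrCA.
  have dv : derivable u (p t) v by exact: diff_derivable.
  by split; [rewrite /derivable E|rewrite /derive E].
have [||c] := @MVT R g (fun t => dot (grad u (p t)) v) 0 1 ltr01.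
- by move=> t; rewrite in_itv /= => /andP[t0 t1]; apply: gd; rewrite !ltW.
- by apply: derivable_within_continuous => t; rewrite in_itv /= => /gd[].
rewrite in_itv /= => /andP[c0 c1]; rewrite /g /p scale0r addr0 scale1r subr0 mulr1.
have -> : x + v = y by rewrite /v addrC subrK.
move=> ->; rewrite -/v -dotBl.
have c01 : 0 <= c <= 1 by rewrite !ltW.
have h := gl x (p c) xr (pr c c01).
apply: le_trans (dot_le h (lexx _)) _.
have -> : p c - x = c *: v by rewrite /p addrC addKr.
rewrite normrZ (ger0_norm (ltW c0)) expr2 !mulrA ler_wpM2r //.
rewrite mulrAC ler_piMr ?(ltW c1) //.
by rewrite mulr_ge0 // mulr_ge0.
Qed.

Lemma local_sol_of_obstacle (R : realType) n (Omega : set 'rV[R]_n) u x0 :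
  C11_loc Omega u -> (forall x, Omega x -> 0 <= u x) -> obstacle_eq_ae Omega u ->
  Omega x0 -> exists rho L, local_sol u x0 rho L.
Proof.
move=> [du C11u] u0 [N [N0 Nae]] /C11u[r [L [r0 [rO Lp]]]].
have inb x : `|x - x0| < r -> ball x0 r x by rewrite mx_norm_ball /ball_ /= distrC.
have inO x : `|x - x0| < r -> Omega x by move=> /inb/rO.
have gl x y : `|x - x0| < r -> `|y - x0| < r -> `|grad u y - grad u x| <= `|L| * `|y - x|.
  move=> xr yr; apply: norm_le_coord => [|i]; first exact: mulr_ge0.
  rewrite !mxE; apply: le_trans (Lp _ _ i (inb _ yr) (inb _ xr)) _.
  by rewrite ler_wpM2r // ler_norm.
have dub x : `|x - x0| < r -> differentiable u x by move=> /inO/du.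
(* One constant for both the Taylor bound n |L| and the Lipschitz bound |L|; the absolute value is
   taken because [C11_loc] does not fix the sign of [L]. *)
exists r, ((n%:R + 1) * `|L|); split.
- split=> // [x y xr yr|x y xr yr].
    apply: le_trans (taylor_of_C11_loc (normr_ge0 L) dub gl xr yr) _.
    by rewrite ler_wpM2r ?exprn_ge0 // ler_wpM2r // lerDl.
  apply: le_trans (gl _ _ xr yr) _.
  by rewrite ler_wpM2r // ler_peMl // lerDr.
- by move=> x /inO/u0.
- by exists N; split => // x /inO/Nae; apply.
Qed.

Theorem theorem9p1 (R : realType) (n : nat) (Omega : set 'rV[R]_n)
  (u : 'rV[R]_n -> R) :
  open Omega ->
  C11_loc Omega u ->
  (forall x, Omega x -> 0 <= u x) ->
  obstacle_eq_ae Omega u ->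
  forall m : nat, (m < n)%N ->
  forall x0 : 'rV[R]_n, singular_stratum Omega u m x0 ->
  exists (r : R) (M : set 'rV[R]_n),
    0 < r /\ C1_submanifold m M /\
    singular_stratum Omega u m `&` ball x0 r `<=` M.
Proof.
move=> _ C11u u0 eqn m mn x0 Sx0.
have [rho [L us]] := local_sol_of_obstacle C11u u0 eqn Sx0.1.1.
apply: (stratum_in_submanifold (leq_ltn_trans (leq0n m) mn) (ltnW mn) us Sx0).
by move=> y [].
Qed.
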